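(* Let $1\le r\le\min\{p_1,p_2\}$. Suppose $W_{L,R}=MW_{LM,RM^{-\top}}M^\top$ and $V_{L,R}=M^{-\top}V_{LM,RM^{-\top}}M^{-1}$ hold for all $(L,R)\in\mathbb{R}^{p_1\times r}_*\times\mathbb{R}^{p_2\times r}_*$ and $M\in\mathrm{GL}(r)$, and $V_Y=OV_{YO}O^\top$, $W_Y=OW_{YO}O^\top$ hold for all $Y\in\mathbb{R}^{p_2\times r}_*$ and $O\in\mathbb{O}_r$. Then: (a) Given $L\in\mathbb{R}^{p_1\times r}_*$, $R\in\mathbb{R}^{p_2\times r}_*$, $U\in\mathrm{St}(r,p_1)$, $B\in\mathbb{S}_+(r)$, $V\in\mathrm{St}(r,p_2)$, $Y\in\mathbb{R}^{p_2\times r}_*$: if $[L,R]$ (resp. $[U,B,V]$; $[U,Y]$) is a Riemannian FOSP, or SOSP, or strict saddle of $h_r$ on $\mathcal{M}^{q_1}_r$ (resp. $\mathcal{M}^{q_2}_r$; $\mathcal{M}^{q_3}_r$), then $X=LR^\top$ (resp. $X=UBV^\top$; $X=UY^\top$) is a Riemannian FOSP, or SOSP, or strict saddle, respectively, of $\min_{X\in\mathcal{M}^e_r}f(X)$. (b) If $X$ is a Riemannian FOSP, or SOSP, or strict saddle of $\min_{X\in\mathcal{M}^e_r}f(X)$, then there is a unique $[L,R]$ (resp. $[U,B,V]$; $[U,Y]$) such that $LR^\top=X$ (resp. $UBV^\top=X$; $UY^\top=X$), and it is a Riemannian FOSP, or SOSP, or strict saddle, respectively, of $h_r$ on $\mathcal{M}^{q_1}_r$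 (resp. $\mathcal{M}^{q_2}_r$; $\mathcal{M}^{q_3}_r$).
   Context: Notation: $\mathbb{R}^{p\times r}_*$ = full-column-rank $p\times r$ matrices; $\mathrm{St}(r,p)$ = $p\times r$ matrices with orthonormal columns; $\mathbb{O}_r$ = orthogonal, $\mathrm{GL}(r)$ = invertible $r\times r$ matrices; $\mathbb{S}^{r\times r}$, $\mathbb{S}_+(r)$ = symmetric, resp. symmetric positive definite, $r\times r$ matrices; $U_\perp$ = orthonormal complement of $U$. $f:\mathbb{R}^{p_1\times p_2}\to\mathbb{R}$ is twice continuously differentiable. For a function on a Riemannian manifold, a point is a Riemannian FOSP if the Riemannian gradient vanishes there; a Riemannian SOSP if moreover the Riemannian Hessian is positive semidefinite; a strict saddle if it is a FOSP at which the Riemannian Hessian has a strictly negative eigenvalue. Embedded geometry: $\mathcal{M}^e_r=\{X\in\mathbb{R}^{p_1\times p_2}:\operatorname{rank}X=r\}$ with the metric induced by the Euclidean inner product. Quotient geometries: for a total space $\overline{\mathcal{M}}$ with metric $\bar g$, an equivalence relation with quotient map $\pi$ and a horizontal space at each point, the quotient metric is $g(\eta,\theta)=\bar g(\bar\eta,\bar\theta)$, where $\bar\eta,\bar\theta$ are horizontal lifts (the unique horizontal vectors mapped to $\eta,\theta$ by $\mathrm{D}\pi$). - $\mathcal{M}^{q_1}_r=(\mathbb{R}^{p_1\times r}_*\times\mathbb{R}^{p_2\times r}_* )/\mathrm{GL}(r)$, $[L,R]=\{(LM,RM^{-\top}):M\in\mathrm{GL}(r)\}$, $\bar g^r_{(L,R)}(\eta,\theta)=\operatorname{tr}(W_{L,R}\eta_L^\top\theta_L)+\operatorname{tr}(V_{L,R}\eta_R^\top\theta_R)$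 with $W_{L,R},V_{L,R}\in\mathbb{S}_+(r)$ smooth in $(L,R)$; the horizontal space is the $\bar g^r$-orthogonal complement of the tangent space of the fiber. $h_r([L,R])=f(LR^\top)$. - $\mathcal{M}^{q_2}_r=(\mathrm{St}(r,p_1)\times\mathbb{S}_+(r)\times\mathrm{St}(r,p_2))/\mathbb{O}_r$, $[U,B,V]=\{(UO,O^\top BO,VO):O\in\mathbb{O}_r\}$, $\bar g^r_{(U,B,V)}(\eta,\theta)=\operatorname{tr}(\eta_U^\top\theta_U)+\operatorname{tr}(B^{-1}\eta_BB^{-1}\theta_B)+\operatorname{tr}(\eta_V^\top\theta_V)$; horizontal space $\{(\theta_U,\theta_B,\theta_V):\theta_U=U_\perp D_1+U\Omega,\ \theta_B\in\mathbb{S}^{r\times r},\ \theta_V=V_\perp D_2-V\Omega,\ \Omega=-\Omega^\top,\ D_1\in\mathbb{R}^{(p_1-r)\times r},\ D_2\in\mathbb{R}^{(p_2-r)\times r}\}$. $h_r([U,B,V])=f(UBV^\top)$. - $\mathcal{M}^{q_3}_r=(\mathrm{St}(r,p_1)\times\mathbb{R}^{p_2\times r}_* )/\mathbb{O}_r$, $[U,Y]=\{(UO,YO):O\in\mathbb{O}_r\}$, $\bar g^r_{(U,Y)}(\eta,\theta)=\operatorname{tr}(V_Y\eta_U^\top\theta_U)+\operatorname{tr}(W_Y\eta_Y^\top\theta_Y)$ with $V_Y,W_Y\in\mathbb{S}_+(r)$ smooth in $Y$; horizontal space $\{(\theta_U,\theta_Y):\theta_U=U_\perp D,\ D\in\mathbb{R}^{(p_1-r)\times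 r},\ \theta_Y\in\mathbb{R}^{p_2\times r}\}$. $h_r([U,Y])=f(UY^\top)$. *)

(* Defs.v *)
From HB Require Import structures.
From mathcomp Require Import all_boot all_order all_algebra.
From mathcomp Require Import all_classical all_reals all_analysis.
Set Implicit Arguments.
Unset Strict Implicit.
Unset Printing Implicit Defensive.
Import Order.TTheory GRing.Theory Num.Theory numFieldNormedType.Exports.
Local Open Scope classical_set_scope.
Local Open Scope ring_scope.

(* Meant for open D and finite-dimensional E, where this is the usual notion:
   F is C^k.+1 iff it is differentiable and each of its directional derivatives
   is C^k. *)
Fixpoint Ck_on (R : realType) (E F : normedModType R) (k : nat)
    (D : set E) (f : E -> F) : Prop :=
  if k is k'.+1 then
    (forall x, D x -> differentiable f x) /\
    (forall v : E, Ck_on k' D (fun x => 'D_v f x))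
  else forall x, D x -> {for x, continuous f}.

Definition smooth_on (R : realType) (E F : normedModType R)
    (D : set E) (f : E -> F) : Prop := forall k, Ck_on k D f.

(* Velocities at x of the curves in S; this is the usual tangent space when S
   is an embedded submanifold of E. *)
Definition tangent_space (R : realType) (E : normedModType R)
    (S : set E) (x : E) : set E :=
  [set v | exists g : R -> E,
     [/\ g 0 = x, \forall t \near (0 : R), S (g t) &
         is_derive (0 : R) (1 : R) g v]].

(* Riemannian calculus in local coordinates on R^d: G is the matrix of metric
   coefficients and h the function read in the coordinates. *)
Section LocalCoordinates.
Context {R : realType} {d : nat}.
Implicit Types (G : 'rV[R]_d -> 'M[R]_d) (h : 'rV[R]_d -> R) (u : 'rV[R]_d).

Definition e_ (i : 'I_d) : 'rV[R]_d := delta_mx 0 i.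

Definition partial (i : 'I_d) h u : R := 'D_(e_ i) h u.

(* Christoffel symbol Gamma^k_ij of the Levi-Civita connection. *)
Definition christoffel G u (k i j : 'I_d) : R :=
  2^-1 * \sum_(l < d) invmx (G u) k l *
    (partial i (fun w => G w j l) u + partial j (fun w => G w i l) u
     - partial l (fun w => G w i j) u).

Definition riem_grad G h u : 'rV[R]_d :=
  \row_k \sum_(l < d) invmx (G u) k l * partial l h u.

(* Matrix of xi |-> nabla_xi (grad h) for the Levi-Civita connection nabla,
   acting on row vectors: the coordinates of Hess h [xi] are
   xi *m riem_hess G h u. *)
Definition riem_hess G h u : 'M[R]_d :=
  \matrix_(j, k) (partial j (fun w => riem_grad G h w 0 k) u +
                  \sum_(l < d) christoffel G u k j l * riem_grad G h u 0 l).

End LocalCoordinates.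

(* A Riemannian quotient total/rel of a submanifold [total] of E, with
   a (not necessarily orthogonal) horizontal space at each point and a metric
   on the total space.  An embedded submanifold is the case where rel is
   equality. *)
Record quotient_geometry (R : realType) (E : normedModType R) :=
  QuotientGeometry {
    total : set E;
    rel_eq : E -> E -> Prop;
    hor : E -> set E;
    metric : E -> E -> E -> R
  }.

Section QuotientGeometry.
Context {R : realType} {E : normedModType R}.
Variable Q : quotient_geometry E.

(* The point [x] of the quotient. *)
Definition qclass (x : E) : set E := [set y | total Q y /\ rel_eq Q x y].

Definition vertical (x : E) : set E := tangent_space (qclass x) x.

(* The horizontal lift at x of D pi(x)[v], for v tangent to the total space;
   recall that the vertical space is the kernel of D pi(x). *)
Definition hlift (x v : E) : E :=
  xget 0 [set w | hor Q x w /\ vertical x (v - w)].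

(* pi \o s is a local parametrization of the quotient: s is a smooth map into
   the total space and D(pi \o s)(u) : R^d -> T(total) / vertical is a linear
   isomorphism for every u in D.  By the inverse function theorem pi \o s
   restricts to a diffeomorphism from a neighbourhood of 0 onto an open set;
   as only germs at 0 matter, injectivity on the whole of D is not required. *)
Definition local_param (d : nat) (D : set 'rV[R]_d) (s : 'rV[R]_d -> E) : Prop :=
  [/\ open D /\ D 0,
      smooth_on D s,
      (forall u, D u -> total Q (s u)),
      (forall u xi, D u -> vertical (s u) ('d s u xi) -> xi = 0) &
      (forall u v, D u -> tangent_space (total Q) (s u) v ->
         exists xi, vertical (s u) (v - 'd s u xi))].

(* Coefficients g(d_i, d_j) of the quotient metric
   g(eta, theta) = metric (lift eta) (lift theta) in the parametrization. *)
Definition qmetric_mx (d : nat) (s : 'rV[R]_d -> E) (u : 'rV[R]_d) : 'M[R]_d :=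
  \matrix_(i, j) metric Q (s u) (hlift (s u) ('D_(e_ i) s u))
                                (hlift (s u) ('D_(e_ j) s u)).

End QuotientGeometry.

Variant point_kind := FOSP | SOSP | StrictSaddle.

(* The point c (an equivalence class) of the quotient is a Riemannian FOSP,
   SOSP or strict saddle of the function on the quotient that h induces; h is
   given on the total space and constant on the classes.  The notions do not
   depend on the parametrization around c. *)
Definition riem_point (R : realType) (E : normedModType R) (k : point_kind)
    (Q : quotient_geometry E) (h : E -> R) (c : set E) : Prop :=
  exists (d : nat) (D : set 'rV[R]_d) (s : 'rV[R]_d -> E),
    let G := qmetric_mx Q s in
    let H := riem_hess G (h \o s) 0 in
    [/\ local_param Q D s, c (s 0), riem_grad G (h \o s) 0 = 0 &
      match k with
      | FOSP => True
      | SOSP => forall xi : 'rV[R]_d, 0 <= ((xi *m H) *m G 0 *m xi^T) 0 0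
      | StrictSaddle => exists2 a : R, a < 0 & eigenvalue H a
      end].

Section FixedRank.
Context {R : realType}.

Definition full_col_rank (p r : nat) (A : 'M[R]_(p, r)) : Prop := \rank A = r.

Definition stiefel (p r : nat) (U : 'M[R]_(p, r)) : Prop := U^T *m U = 1%:M.

Definition orthogonal_mx (r : nat) (O : 'M[R]_r) : Prop := O^T *m O = 1%:M.

Definition symmetric_mx (r : nat) (A : 'M[R]_r) : Prop := A^T = A.

Definition spd (r : nat) (A : 'M[R]_r) : Prop :=
  symmetric_mx A /\
  forall x : 'cV[R]_r, x != 0 -> 0 < (x^T *m A *m x) 0 0.

(* Up is an orthonormal complement of U, i.e. [U Up] is orthogonal. *)
Definition orth_compl (p r : nat) (U : 'M[R]_(p, r)) (Up : 'M[R]_(p, p - r)) :=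
  stiefel Up /\ U^T *m Up = 0.

Variables p1 p2 r : nat.

Definition embedded_geometry : quotient_geometry 'M[R]_(p1, p2) :=
  let tot : set 'M[R]_(p1, p2) := [set X | \rank X = r] in
  {| total := tot;
     rel_eq := fun X Y => X = Y;
     hor := fun X => tangent_space tot X;
     metric := fun _ eta theta => \tr (eta^T *m theta) |}.

Definition tot1 : set ('M[R]_(p1, r) * 'M[R]_(p2, r))%type :=
  [set x | full_col_rank x.1 /\ full_col_rank x.2].

Definition rel1 (x y : 'M[R]_(p1, r) * 'M[R]_(p2, r)) : Prop :=
  exists2 M : 'M[R]_r, M \in unitmx & y = (x.1 *m M, x.2 *m (invmx M)^T).

Definition metric1 (W V : 'M[R]_(p1, r) * 'M[R]_(p2, r) -> 'M[R]_r)
    (x eta theta : 'M[R]_(p1, r) * 'M[R]_(p2, r)) : R :=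
  \tr (W x *m eta.1^T *m theta.1) + \tr (V x *m eta.2^T *m theta.2).

(* The fibers are contained in the open set tot1, whose tangent spaces are the
   whole ambient space. *)
Definition quotient_geometry1
    (W V : 'M[R]_(p1, r) * 'M[R]_(p2, r) -> 'M[R]_r) :
    quotient_geometry ('M[R]_(p1, r) * 'M[R]_(p2, r))%type :=
  {| total := tot1;
     rel_eq := rel1;
     hor := fun x => [set theta | forall eta,
       tangent_space [set y | rel1 x y] x eta -> metric1 W V x eta theta = 0];
     metric := metric1 W V |}.

Definition map1 (x : 'M[R]_(p1, r) * 'M[R]_(p2, r)) : 'M[R]_(p1, p2) :=
  x.1 *m x.2^T.

(* Triples (U, B, V) are represented as ((U, B), V). *)
Definition quotient_geometry2 :
    quotient_geometry ('M[R]_(p1, r) * 'M[R]_(r, r) * 'M[R]_(p2, r))%type :=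
  {| total := [set x | [/\ stiefel x.1.1, spd x.1.2 & stiefel x.2]];
     rel_eq := fun x y => exists2 O : 'M[R]_r, orthogonal_mx O &
       y = (x.1.1 *m O, O^T *m x.1.2 *m O, x.2 *m O);
     hor := fun x => [set theta |
       exists (Up : 'M[R]_(p1, p1 - r)) (Vp : 'M[R]_(p2, p2 - r))
              (D1 : 'M[R]_(p1 - r, r)) (D2 : 'M[R]_(p2 - r, r))
              (Om : 'M[R]_r),
         [/\ orth_compl x.1.1 Up /\ orth_compl x.2 Vp,
             Om = - Om^T,
             theta.1.1 = Up *m D1 + x.1.1 *m Om,
             symmetric_mx theta.1.2 &
             theta.2 = Vp *m D2 - x.2 *m Om]];
     metric := fun x eta theta =>
       \tr (eta.1.1^T *m theta.1.1)
       + \tr (invmx x.1.2 *m eta.1.2 *m invmx x.1.2 *m theta.1.2)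
       + \tr (eta.2^T *m theta.2) |}.

Definition map2 (x : 'M[R]_(p1, r) * 'M[R]_(r, r) * 'M[R]_(p2, r)) :
    'M[R]_(p1, p2) :=
  x.1.1 *m x.1.2 *m x.2^T.

Definition quotient_geometry3 (VY WY : 'M[R]_(p2, r) -> 'M[R]_r) :
    quotient_geometry ('M[R]_(p1, r) * 'M[R]_(p2, r))%type :=
  {| total := [set x | stiefel x.1 /\ full_col_rank x.2];
     rel_eq := fun x y => exists2 O : 'M[R]_r, orthogonal_mx O &
       y = (x.1 *m O, x.2 *m O);
     hor := fun x => [set theta |
       exists (Up : 'M[R]_(p1, p1 - r)) (D : 'M[R]_(p1 - r, r)),
         orth_compl x.1 Up /\ theta.1 = Up *m D];
     metric := fun x eta theta =>
       \tr (VY x.2 *m eta.1^T *m theta.1)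
       + \tr (WY x.2 *m eta.2^T *m theta.2) |}.

Definition map3 (x : 'M[R]_(p1, r) * 'M[R]_(p2, r)) : 'M[R]_(p1, p2) :=
  x.1 *m x.2^T.

End FixedRank.

(* c is a class [x] with phi x = X. *)
Definition class_over (R : realType) (E : normedModType R) (F : Type)
    (Q : quotient_geometry E) (phi : E -> F) (X : F) (c : set E) : Prop :=
  exists x : E, [/\ total Q x, c = qclass Q x & phi x = X].

(* Main.v *)
Require Import Defs.
From HB Require Import structures.
From mathcomp Require Import all_boot all_order all_algebra.
From mathcomp Require Import all_classical all_reals all_analysis.
From mathcomp Require Import complex ring lra.
Import Defs.
Set Implicit Arguments.
Unset Strict Implicit.
Unset Printing Implicit Defensive.
Import Order.TTheory GRing.Theory Num.Theory numFieldNormedType.Exports.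
Local Open Scope classical_set_scope.
Local Open Scope ring_scope.

(* At a critical point the Riemannian Hessian in coordinates is S G^-1, where S
   is the ordinary Hessian of the function read in the coordinates and G the
   metric matrix: the Christoffel terms are multiplied by the gradient.  Hence
   being a FOSP, SOSP or strict saddle only depends on the partial derivatives
   of h o s, not on the metric.  Composing a parametrization s of a quotient
   with the map phi to matrices of rank r gives a parametrization of the
   embedded manifold in which f reads f o phi o s, so all three notions push
   forward; conversely a parametrization of the embedded manifold lifts through
   a smooth local section of phi, built from the square root of positive definite
   matrices, so they pull back. *)

(** * Positive definite matrices *)

(** The quotient metric is evaluated on horizontal lifts, so its matrix [G] varies with the point
    only as regularly as the horizontal projections do. An explicit projection is found for each
    geometry, and its continuity is enough: at a zero of the gradient the product rule does not
    differentiate [G]. A strict saddle is defined by an eigenvalue of S G^-1, which need not be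
    symmetric; the passage to a direction of negative curvature conjugates by the square root of
    G^-1 and uses the symmetry of S, hence Schwarz's theorem. One linear equation recurs, the
    Sylvester equation P Z W + V Z Q = C with positive definite coefficients: it governs the
    uniqueness and differentiability of square roots, the horizontal projection for GL(r), and the
    kernel and image of the differential of U B V^T. Tangent and vertical spaces are sets of
    velocities of curves, so every tangency claim needs an actual curve: Cayley transforms for
    rotations, congruences for positive definite matrices. *)

Section SymmetricSqrt.
Context {R : realType}.

(** Realizes the fourth root on a finite spectrum as a polynomial. A new node is corrected by a
    multiple of [w], which vanishes at the old ones. *)
Lemma poly_interpolation (F : fieldType) (s : seq F) (g : F -> F) :
  exists q : {poly F}, forall x, x \in s -> q.[x] = g x.
Proof.
elim: s => [|a s [q hq]]; first by exists 0.
have [ains|anins] := boolP (a \in s).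
  by exists q => x; rewrite inE => /predU1P[->|]; apply: hq.
pose w := \prod_(y <- s) ('X - y%:P).
have wa : w.[a] != 0 by rewrite -[_ == _]/(root w a) root_prod_XsubC.
exists (q + ((g a - q.[a]) / w.[a]) *: w) => x; rewrite inE => /predU1P[->|xs].
  by rewrite hornerD hornerZ divfK// addrC subrK.
rewrite hornerD hornerZ (_ : w.[x] = 0) ?mulr0 ?addr0 ?hq//.
by apply/eqP; rewrite -[_ == _]/(root w x) root_prod_XsubC.
Qed.

Lemma trmx_horner_mx n (A : 'M[R]_n.+1) (q : {poly R}) :
  (horner_mx A q)^T = horner_mx A^T q.
Proof.
elim/poly_ind: q => [|q c IHq]; first by rewrite !rmorph0 trmx0.
rewrite !rmorphD [in LHS]rmorphM/= [in RHS]mulrC rmorphM/= !horner_mx_C !horner_mx_X.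
by rewrite linearD/= tr_scalar_mx -IHq [in LHS]/GRing.mul/= trmx_mul.
Qed.

(** The complexification of [A] is diagonalized with real eigenvalues, and [C = q(A)] for a real
    polynomial [q] taking fourth roots on them, so [C] is real and symmetric. With a fourth root,
    [C *m C] is a square root that is visibly a Gram matrix, hence positive semidefinite. *)
Lemma symmetric_fourth_root n (A : 'M[R]_n) : A^T = A ->
  (forall (a : R) (v : 'rV[R]_n), v != 0 -> v *m A = a *: v -> 0 <= a) ->
  exists2 C : 'M[R]_n, C^T = C & (C *m C) *m (C *m C) = A.
Proof.
case: n A => [|n] A symA eigA.
  by exists 0; rewrite ?trmx0// [A]flatmx0 [LHS]flatmx0.
pose toC := real_complex R; pose AC := map_mx toC A.
have herm : AC \is hermsymmx.
  apply: realsym_hermsym.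
    by apply/is_hermitianmxP; rewrite expr0 scale1r map_mx_id// map_trmx symA.
  by apply/mxOverP => i j; rewrite mxE complex_real.
have eqAC := orthomx_spectralP (hermitian_normalmx herm).
have spR := hermitian_spectral_diag_real herm.
set P := spectralmx AC in eqAC; set sp := spectral_diag AC in eqAC spR.
have uP : P \in unitmx by exact: spectral_unit.
pose e i := complex.Re (sp 0 i); pose D : 'rV[R]_n.+1 := \row_i e i.
have spE : sp = map_mx toC D.
  apply/rowP => i; rewrite !mxE; apply/esym; rewrite /toC.
  by apply: RRe_real; have /mxOverP := spR; apply.
have e0 i : 0 <= e i.
  (* [A - e i] is singular over the complex numbers, so its real determinant vanishes and there is a
     real eigenvector to which [eigA] applies. *)
  have : ~~ (A - (e i)%:M \in unitmx).
    rewrite -(map_unitmx toC) map_mxB map_scalar_mx /= -/AC eqAC spE.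
    have -> : (toC (e i))%:M = invmx P *m (toC (e i))%:M *m P.
      by rewrite scalar_mxC mulmxKV ?mulVmx// -scalar_mxC mulmxA mulmxV ?mul1mx.
    rewrite -mulmxBl -mulmxBr !unitmx_mul unitmx_inv uP /= andbT.
    rewrite unitmxE unitfE negbK; apply/det0P; exists (delta_mx 0 i).
      by apply/negP => /eqP/rowP/(_ i)/eqP; rewrite !mxE !eqxx oner_eq0.
    rewrite -rowE; apply/rowP => j; rewrite !mxE.
    by have [->|_] := eqVneq i j; rewrite ?eqxx ?mulr1n ?mulr0n subrr.
  rewrite unitmxE unitfE negbK => /det0P[v v0 vA]; apply: (eigA _ v v0).
  by apply/eqP; rewrite -subr_eq0 -vA mulmxBr mul_mx_scalar.
have [q hq] := poly_interpolation [seq e i | i : 'I_n.+1] (fun x => Num.sqrt (Num.sqrt x)).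
exists (horner_mx A q); first by rewrite trmx_horner_mx symA.
apply: (@map_mx_inj _ _ toC).
rewrite !map_mxM map_horner_mx/= -/AC eqAC horner_mx_uconjC// spE.
have -> : horner_mx (diag_mx (map_mx toC D)) (map_poly toC q) =
    map_mx toC (diag_mx (map_mx (horner q) D)).
  by rewrite -horner_mx_diag map_horner_mx map_diag_mx.
set X := map_mx toC (diag_mx _).
have XX : (X *m X) *m (X *m X) = diag_mx (map_mx toC D).
  rewrite /X -!map_mxM !mulmx_diag map_diag_mx; congr diag_mx; apply/rowP => i.
  rewrite !mxE hq ?map_f ?mem_enum//.
  by rewrite -!expr2 !sqr_sqrtr ?sqrtr_ge0.
have conjM Y Z : invmx P *m Y *m P *m (invmx P *m Z *m P) =
    invmx P *m (Y *m Z) *m P by rewrite !mulmxA mulmxK.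
by rewrite !conjM XX.
Qed.

End SymmetricSqrt.

Section PositiveDefinite.
Context {R : realType}.

Lemma frobE m n (A B : 'M[R]_(m, n)) :
  \tr (A^T *m B) = \sum_i \sum_j A i j * B i j.
Proof.
rewrite /mxtrace exchange_big/=; apply: eq_bigr => j _; rewrite mxE.
by apply: eq_bigr => i _; rewrite mxE.
Qed.

Lemma frob_ge0 m n (A : 'M[R]_(m, n)) : 0 <= \tr (A^T *m A).
Proof.
rewrite frobE; apply: sumr_ge0 => i _; apply: sumr_ge0 => j _.
by rewrite -expr2 sqr_ge0.
Qed.

Lemma frob_entry_le m n (A : 'M[R]_(m, n)) i j : A i j ^+ 2 <= \tr (A^T *m A).
Proof.
rewrite frobE (bigD1 i)//= (bigD1 j)//= -expr2 -addrA lerDl addr_ge0//.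
  by apply: sumr_ge0 => k _; rewrite -expr2 sqr_ge0.
by apply: sumr_ge0 => k _; apply: sumr_ge0 => l _; rewrite -expr2 sqr_ge0.
Qed.

Lemma frob_eq0 m n (A : 'M[R]_(m, n)) : \tr (A^T *m A) = 0 -> A = 0.
Proof.
move=> A0; apply/matrixP => i j; rewrite mxE; apply/eqP; rewrite -sqrf_eq0.
by rewrite eq_le sqr_ge0 andbT -A0 frob_entry_le.
Qed.

Lemma frobC m n (A B : 'M[R]_(m, n)) : \tr (A^T *m B) = \tr (B^T *m A).
Proof. by rewrite -[LHS]mxtrace_tr trmx_mul trmxK. Qed.

Lemma tr11 (A : 'M[R]_1) : \tr A = A 0 0.
Proof. by rewrite /mxtrace big_ord_recl big_ord0 addr0. Qed.

Lemma spd_sym n (A : 'M[R]_n) : spd A -> A^T = A.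
Proof. by case. Qed.

Lemma spd_row n (A : 'M[R]_n) (v : 'rV[R]_n) :
  spd A -> v != 0 -> 0 < (v *m A *m v^T) 0 0.
Proof.
case=> _ pA v0; have := pA v^T; rewrite trmxK; apply.
by apply: contraNneq v0 => vT0; rewrite -[v]trmxK vT0 trmx0.
Qed.

Lemma spd_unit n (A : 'M[R]_n) : spd A -> A \in unitmx.
Proof.
move=> pA; rewrite unitmxE unitfE; apply/negP => /det0P[v v0 vA].
by have := spd_row pA v0; rewrite vA mul0mx mxE ltxx.
Qed.

Lemma spd_gram m n (A : 'M[R]_(m, n)) :
  (forall v : 'cV[R]_n, A *m v = 0 -> v = 0) -> spd (A^T *m A).
Proof.
move=> injA; split; first by rewrite /symmetric_mx trmx_mul trmxK.
move=> x x0; rewrite mulmxA -mulmxA -trmx_mul -tr11 lt_neqAle frob_ge0 andbT.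
by apply: contraNneq x0 => /esym/frob_eq0/injA ->.
Qed.

Lemma spd_unit_gram n (A : 'M[R]_n) : A \in unitmx -> spd (A^T *m A).
Proof. by move=> uA; apply: spd_gram => v Av; rewrite -(mulKmx uA v) Av mulmx0. Qed.

Lemma spd_sqrt n (A : 'M[R]_n) : spd A -> exists2 B, spd B & B *m B = A.
Proof.
move=> pA; have [] := @symmetric_fourth_root R n A (spd_sym pA).
  move=> a v v0 vA; have := spd_row pA v0.
  rewrite vA -scalemxAl mxE => avv; rewrite leNgt; apply/negP => a0.
  by move: avv; rewrite nmulr_rgt0// -tr11 -{1}[v]trmxK ltNge frob_ge0.
move=> C symC CA; exists (C *m C) => //; rewrite -{1}symC; apply: spd_unit_gram.
by have := spd_unit pA; rewrite -CA !unitmx_mul => /andP[/andP[]].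
Qed.

Lemma spd_inv n (A : 'M[R]_n) : spd A -> spd (invmx A).
Proof.
move=> pA; have [B pB BA] := spd_sqrt pA.
have uB := spd_unit pB; rewrite -{A}BA in pA *.
have -> : invmx (B *m B) = (invmx B)^T *m invmx B.
  rewrite trmx_inv (spd_sym pB); apply: (can_inj (mulKmx (spd_unit pA))).
  by rewrite mulmxV ?spd_unit// mulmxA mulmxK// mulmxV.
by apply: spd_unit_gram; rewrite unitmx_inv.
Qed.

Lemma spd_1 n : spd (1%:M : 'M[R]_n).
Proof. by rewrite -[1%:M]mulmx1 -{1}trmx1; apply: spd_unit_gram; rewrite unitmx1. Qed.

Lemma spdD n (A B : 'M[R]_n) : spd A -> spd B -> spd (A + B).
Proof.
move=> [sA pA] [sB pB]; split; first by rewrite /symmetric_mx linearD/= sA sB.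
by move=> x x0; rewrite mulmxDr mulmxDl mxE addr_gt0 ?pA ?pB.
Qed.

Lemma spd_congr n (A C : 'M[R]_n) : spd A -> C \in unitmx -> spd (C^T *m A *m C).
Proof.
move=> [sA pA] uC; split; first by rewrite /symmetric_mx !trmx_mul trmxK sA mulmxA.
move=> x x0; rewrite !mulmxA -trmx_mul -mulmxA; apply: pA.
by apply: contraNneq x0 => Cx; rewrite -(mulKmx uC x) Cx mulmx0.
Qed.

(** Square roots of the weights turn the weighted form into a squared Frobenius norm, which yields
    its nonnegativity and definiteness. *)
Lemma wfrobE m n (P A : 'M[R]_m) (W C : 'M[R]_n) (Z : 'M[R]_(m, n)) :
  A^T = A -> C^T = C -> A *m A = P -> C *m C = W ->
  \tr (Z^T *m (P *m Z *m W)) = \tr ((A *m Z *m C)^T *m (A *m Z *m C)).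
Proof.
move=> sA sC <- <-; rewrite !trmx_mul sA sC !mulmxA.
by rewrite [LHS]mxtrace_mulC !mulmxA.
Qed.

Lemma wfrob_ge0 m n (P : 'M[R]_m) (W : 'M[R]_n) (Z : 'M[R]_(m, n)) :
  spd P -> spd W -> 0 <= \tr (Z^T *m (P *m Z *m W)).
Proof.
move=> /spd_sqrt[A /spd_sym sA AP] /spd_sqrt[C /spd_sym sC CW].
by rewrite (wfrobE Z sA sC AP CW) frob_ge0.
Qed.

Lemma wfrob_eq0 m n (P : 'M[R]_m) (W : 'M[R]_n) (Z : 'M[R]_(m, n)) :
  spd P -> spd W -> \tr (Z^T *m (P *m Z *m W)) = 0 -> Z = 0.
Proof.
move=> /spd_sqrt[A pA AP] /spd_sqrt[C pC CW].
rewrite (wfrobE Z (spd_sym pA) (spd_sym pC) AP CW) => /frob_eq0 AZC.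
rewrite -[Z](mulKmx (spd_unit pA)) -[A *m Z](mulmxK (spd_unit pC)) AZC.
by rewrite mul0mx mulmx0.
Qed.

Lemma wfrob_gt0 m n (P : 'M[R]_m) (W : 'M[R]_n) (Z : 'M[R]_(m, n)) :
  spd P -> spd W -> Z != 0 -> 0 < \tr (Z^T *m (P *m Z *m W)).
Proof.
move=> pP pW Z0; rewrite lt_neqAle wfrob_ge0// andbT.
by apply: contraNneq Z0 => /esym/(wfrob_eq0 pP pW) ->.
Qed.

(** Matrix of the generalized Sylvester operator on vectorized matrices. As the solution is then
    given by [invmx], it depends smoothly on the coefficients. *)
Definition sylmx n (P W V Q : 'M[R]_n) : 'M[R]_(n * n) :=
  lin_mx (fun Z => P *m Z *m W + V *m Z *m Q).

Lemma mul_sylmx n (P W V Q Z : 'M[R]_n) :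
  mxvec Z *m sylmx P W V Q = mxvec (P *m Z *m W + V *m Z *m Q).
Proof.
pose f := (fun Z : 'M[R]_n => mulmxr W (mulmx P Z) + mulmxr Q (mulmx V Z)).
have lf : linear f.
  by move=> a A B; rewrite /f !linearP/= scalerDr addrACA.
pose F : {linear 'M[R]_n -> 'M[R]_n} :=
  HB.pack f (GRing.isLinear.Build _ _ _ _ f lf).
exact: (mul_vec_lin F Z).
Qed.

(** Take the Frobenius product of the equation with [Z]: both summands are nonnegative, so the first
    vanishes, and it is definite. *)
Lemma syl_eq0 n (P W V Q Z : 'M[R]_n) : spd P -> spd W -> spd V -> spd Q ->
  P *m Z *m W + V *m Z *m Q = 0 -> Z = 0.
Proof.
move=> pP pW pV pQ eq0; apply: (wfrob_eq0 pP pW).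
have : \tr (Z^T *m (P *m Z *m W + V *m Z *m Q)) = 0.
  by rewrite eq0 mulmx0 mxtrace0.
rewrite mulmxDr mxtraceD => e; apply/eqP; rewrite eq_le wfrob_ge0// andbT.
by rewrite -(addrK (\tr (Z^T *m (V *m Z *m Q))) (\tr _)) e sub0r oppr_le0 wfrob_ge0.
Qed.

Lemma sylmx_unit n (P W V Q : 'M[R]_n) : spd P -> spd W -> spd V -> spd Q ->
  sylmx P W V Q \in unitmx.
Proof.
move=> pP pW pV pQ; rewrite unitmxE unitfE; apply/negP => /det0P[v v0].
rewrite -[v]vec_mxK mul_sylmx => /(congr1 vec_mx); rewrite mxvecK linear0.
by move=> /(syl_eq0 pP pW pV pQ) vv; rewrite -[v]vec_mxK vv linear0 eqxx in v0.
Qed.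

Definition sylsol n (P W V Q C : 'M[R]_n) : 'M[R]_n :=
  vec_mx (mxvec C *m invmx (sylmx P W V Q)).

Lemma sylsolP n (P W V Q C : 'M[R]_n) : spd P -> spd W -> spd V -> spd Q ->
  P *m sylsol P W V Q C *m W + V *m sylsol P W V Q C *m Q = C.
Proof.
move=> pP pW pV pQ; apply: (can_inj mxvecK); rewrite -mul_sylmx vec_mxK.
by rewrite mulmxKV ?sylmx_unit.
Qed.

Lemma sylsol_uniq n (P W V Q C Z : 'M[R]_n) :
  spd P -> spd W -> spd V -> spd Q ->
  P *m Z *m W + V *m Z *m Q = C -> Z = sylsol P W V Q C.
Proof.
move=> pP pW pV pQ <-; rewrite /sylsol -mul_sylmx mulmxK ?mxvecK//.
exact: sylmx_unit.
Qed.

(** (A + B)(A - B) + (A - B)(A + B) = 2 (A^2 - B^2) = 0 is a Sylvester equation for A - B. *)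
Lemma sqrt_uniq n (A B : 'M[R]_n) :
  spd A -> spd B -> A *m A = B *m B -> A = B.
Proof.
move=> pA pB AB; apply/subr0_eq.
have pAB := spdD pA pB; have p1 := spd_1 n.
apply: (syl_eq0 pAB p1 p1 pAB); rewrite mulmx1 mul1mx.
rewrite !mulmxDr !mulmxDl !mulmxN !mulNmx AB addrACA addrC -!addrA.
by apply/matrixP => i j; rewrite !mxE; ring.
Qed.

Definition msqrt n (A : 'M[R]_n) : 'M[R]_n :=
  xget 0 [set B | spd B /\ B *m B = A].

Lemma msqrtP n (A : 'M[R]_n) : spd A -> spd (msqrt A) /\ msqrt A *m msqrt A = A.
Proof.
move=> /spd_sqrt[B pB BA]; rewrite /msqrt.
by case: xgetP => [C -> //|/(_ B)]; case.
Qed.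

(** With N the square root of G^-1, S G^-1 is similar to the symmetric matrix N S N. If no
    eigenvalue were negative, N S N would be a fourth power of a symmetric C and x S x^T the squared
    norm of C^2 N^-1 x^T. *)
Lemma neg_eigenvalue n (S G : 'M[R]_n) (x : 'rV[R]_n) :
  S^T = S -> spd G -> (x *m S *m x^T) 0 0 < 0 ->
  exists2 a, a < 0 & eigenvalue (S *m invmx G) a.
Proof.
move=> sS pG xSx; have [N pN NG] := spd_sqrt (spd_inv pG).
have sN := spd_sym pN; have uN := spd_unit pN.
apply: contrapT => noeig.
have [] := @symmetric_fourth_root R n (N *m S *m N).
- by rewrite !trmx_mul sN sS mulmxA.
- move=> a v v0 va; rewrite leNgt; apply/negP => a0; apply: noeig; exists a => //.
  apply/eigenvalueP; exists (v *m N).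
    by rewrite -NG scalemxAl -va !mulmxA.
  by apply: contraNneq v0 => vN; rewrite -(mulmxK uN v) vN mul0mx.
move=> C sC CA; suff : 0 <= (x *m S *m x^T) 0 0 by rewrite leNgt xSx.
have -> : x *m S *m x^T =
    (C *m C *m invmx N *m x^T)^T *m (C *m C *m invmx N *m x^T).
  transitivity (x *m invmx N *m (C *m C *m (C *m C)) *m invmx N *m x^T).
    by rewrite CA !mulmxA mulmxKV// mulmxK.
  by rewrite !trmx_mul trmxK sC trmx_inv sN !mulmxA.
by rewrite -tr11 frob_ge0.
Qed.

End PositiveDefinite.

(** * Calculus of maps of class C^k *)

Section Differentiability.
Context {R : realType} {E F : normedModType R}.

Lemma diff_eps (f : E -> F) (df : {linear E -> F}) (x : E) : continuous df ->
  (forall e, 0 < e ->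
     \forall h \near 0, `|f (h + x) - f x - df h| <= e * `|h|) ->
  differentiable f x /\ 'd f x = df :> (E -> F).
Proof.
move=> cdf hf; have eqo : f \o shift x = cst (f x) + df +o_ 0 id.
  apply/eqaddoP => e e0; have := hf _ e0.
  apply: filterS => h; rewrite -[(_ - _) h]/(f (h + x) - (f x + df h)).
  by rewrite opprD addrA.
have ddf : 'd f x = df :> (E -> F) by exact: diff_unique.
by split=> //; apply/diff_locallyP; rewrite ddf.
Qed.

Lemma diff_epsE (f : E -> F) (x : E) : differentiable f x ->
  forall e, 0 < e ->
    \forall h \near 0, `|f (h + x) - f x - 'd f x h| <= e * `|h|.
Proof.
move=> /diff_locally/eqaddoP df e e0; have := df _ e0.
apply: filterS => h; rewrite -[(_ - _) h]/(f (h + x) - (f x + 'd f x h)).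
by rewrite opprD addrA.
Qed.

Lemma near_eq_differentiable (f g : E -> F) (x : E) :
  {near x, f =1 g} -> differentiable f x -> differentiable g x.
Proof.
move=> fg df; suff [] : differentiable g x /\ 'd g x = 'd f x :> (E -> F) by [].
apply: diff_eps => [|e e0]; first exact: diff_continuous.
have nfg : \forall h \near 0, f (h + x) = g (h + x).
  have : \forall y \near x, f y = g y by [].
  by rewrite (near_shift 0 x)/= subr0.
move: nfg (diff_epsE df e0); apply: filterS2 => h ->.
by rewrite -(nbhs_singleton fg).
Qed.

End Differentiability.

Section CkGeneral.
Context {R : realType} {E : normedModType R}.

(* An inductive copy of [Ck_on]: unlike the fixpoint it never unfolds, which
   keeps unification and conversion tests cheap. *)
Variant Ck (F : normedModType R) k (D : set E) (f : E -> F) : Prop :=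
  CkI of Ck_on k D f.

Lemma Ck_0P (F : normedModType R) (D : set E) (f : E -> F) :
  Ck 0 D f <-> forall x, D x -> {for x, continuous f}.
Proof. by split=> [[]|]. Qed.

Lemma Ck_SP (F : normedModType R) k (D : set E) (f : E -> F) :
  Ck k.+1 D f <-> (forall x, D x -> differentiable f x) /\
    (forall v, Ck k D (fun x => 'D_v f x)).
Proof.
split=> [[[df vf]]|[df vf]]; first by split=> [//|v]; constructor; apply: vf.
by constructor; split=> [//|v]; case: (vf v).
Qed.

Lemma Ck_S (F : normedModType R) k (D : set E) (f : E -> F) :
  Ck k.+1 D f -> Ck k D f.
Proof.
elim: k f => [|k IH] f /Ck_SP[df vf].
  by apply/Ck_0P => x /df/differentiable_continuous.
by apply/Ck_SP; split=> // v; apply: IH; apply: vf.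
Qed.

Lemma Ck_le (F : normedModType R) k l (D : set E) (f : E -> F) :
  (k <= l)%N -> Ck l D f -> Ck k D f.
Proof.
move=> /subnK <-; elim: (l - k)%N => // j IH fk.
by apply: IH; apply: Ck_S.
Qed.

Lemma Ck_subset (F : normedModType R) k (D D' : set E) (f : E -> F) :
  D' `<=` D -> Ck k D f -> Ck k D' f.
Proof.
move=> DD; elim: k f => [|k IH] f.
  by move=> /Ck_0P cf; apply/Ck_0P => x /DD/cf.
by move=> /Ck_SP[df vf]; apply/Ck_SP; split=> [x /DD/df//|v]; apply: IH.
Qed.

Lemma Ck_continuous (F : normedModType R) k (D : set E) (f : E -> F) x :
  Ck k D f -> D x -> {for x, continuous f}.
Proof. by move=> /(Ck_le (leq0n k))/Ck_0P; apply. Qed.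

Lemma Ck_eq (F : normedModType R) k (D : set E) (f g : E -> F) :
  open D -> (forall x, D x -> f x = g x) -> Ck k D f -> Ck k D g.
Proof.
move=> oD; elim: k f g => [|k IH] f g fg.
  move=> /Ck_0P cf; apply/Ck_0P => x Dx.
  have nD : nbhs x D by exact: open_nbhs_nbhs.
  rewrite /prop_for/continuous_at -fg//; have := cf _ Dx.
  apply: cvg_trans; apply: near_eq_cvg; apply: filterS nD => y Dy.
  by rewrite fg.
move=> /Ck_SP[df vf]; apply/Ck_SP; split=> [x Dx|v].
  have nD : nbhs x D by exact: open_nbhs_nbhs.
  by apply: near_eq_differentiable (df _ Dx); apply: filterS nD => y /fg.
apply: IH (vf v) => x Dx; apply: near_eq_derive.
have nD : nbhs x D by exact: open_nbhs_nbhs.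
by apply: filterS nD => y /fg.
Qed.

Lemma Ck_cst (F : normedModType R) k (D : set E) (a : F) :
  Ck k D (fun=> a).
Proof.
elim: k a => [|k IH] a; first by apply/Ck_0P => x _; apply: cst_continuous.
apply/Ck_SP; split=> [x _|v]; first exact: (differentiable_cst a x).
have -> : (fun x => 'D_v (fun=> a) x) = (fun=> 0).
  by apply/funext => x; rewrite (derive_cst a).
exact: IH.
Qed.

Lemma derive_lin (F F' : normedModType R) (l : F -> F') (f : E -> F) x v :
  linear l -> continuous l -> differentiable f x ->
  differentiable (l \o f) x /\ 'D_v (l \o f) x = l ('D_v f x).
Proof.
move=> ll cl df.
pose L : {linear F -> F'} := HB.pack l (GRing.isLinear.Build _ _ _ _ l ll).
have dL y : differentiable L y by apply: linear_differentiable.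
have dLf : differentiable (L \o f) x by apply: differentiable_comp.
split=> //; rewrite (deriveE v dLf) (deriveE v df) diff_comp//=.
by rewrite -[X in _ = X _]/(L : F -> F') -(diff_lin (f x) (cl : continuous L)).
Qed.

Lemma Ck_lin (F F' : normedModType R) k (D : set E) (l : F -> F') (f : E -> F) :
  open D -> linear l -> continuous l -> Ck k D f -> Ck k D (l \o f).
Proof.
move=> oD ll cl; elim: k f => [|k IH] f.
  by move=> /Ck_0P cf; apply/Ck_0P => x Dx; apply: continuous_comp; [exact: cf|exact: cl].
move=> /Ck_SP[df vf]; apply/Ck_SP; split=> [x Dx|v].
  by have [] := derive_lin 0 ll cl (df _ Dx).
apply: Ck_eq (IH _ (vf v)) => // x Dx /=.
by have [_ ->] := derive_lin v ll cl (df _ Dx).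
Qed.

Lemma Ck_D (F : normedModType R) k (D : set E) (f g : E -> F) : open D ->
  Ck k D f -> Ck k D g -> Ck k D (fun x => f x + g x).
Proof.
move=> oD; elim: k f g => [|k IH] f g.
  by move=> /Ck_0P cf /Ck_0P cg; apply/Ck_0P => x Dx; apply: cvgD; [exact: cf|exact: cg].
move=> /Ck_SP[df vf] /Ck_SP[dg vg]; apply/Ck_SP; split=> [x Dx|v].
  by apply: differentiableD; [exact: df|exact: dg].
apply: Ck_eq (IH _ _ (vf v) (vg v)) => // x Dx.
rewrite (@deriveD _ _ _ f g)//; apply: diff_derivable; [exact: df|exact: dg].
Qed.

Lemma Ck_N (F : normedModType R) k (D : set E) (f : E -> F) : open D ->
  Ck k D f -> Ck k D (fun x => - f x).
Proof.
move=> oD; apply: (@Ck_lin _ _ _ _ (fun y => - y)) => //.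
  by move=> a u v; rewrite opprD scalerN.
by move=> x; apply: cvgN.
Qed.

Lemma Ck_B (F : normedModType R) k (D : set E) (f g : E -> F) : open D ->
  Ck k D f -> Ck k D g -> Ck k D (fun x => f x - g x).
Proof. by move=> oD cf cg; apply: Ck_D => //; apply: Ck_N. Qed.

Lemma Ck_sum (F : normedModType R) k (D : set E) (I : Type) (s : seq I)
    (P : pred I) (f : I -> E -> F) : open D ->
  (forall i, P i -> Ck k D (f i)) ->
  Ck k D (fun x => \sum_(i <- s | P i) f i x).
Proof.
move=> oD cf; elim: s => [|i s IH].
  by apply: Ck_eq (Ck_cst _ _ 0) => // x _; rewrite big_nil.
have [Pi|nPi] := boolP (P i).
  apply: (@Ck_eq _ _ _ (fun x => f i x + \sum_(j <- s | P j) f j x)) => //.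
    by move=> x _; rewrite big_cons Pi.
  by apply: Ck_D => //; apply: cf.
by apply: Ck_eq IH => // x _; rewrite big_cons (negbTE nPi).
Qed.

Lemma Ck_M k (D : set E) (f g : E -> R) : open D ->
  Ck k D f -> Ck k D g -> Ck k D (fun x => f x * g x).
Proof.
move=> oD; elim: k f g => [|k IH] f g cf cg.
  move: cf cg => /Ck_0P cf /Ck_0P cg; apply/Ck_0P => x Dx.
  by apply: cvgM; [exact: cf|exact: cg].
have [df vf] := (Ck_SP _ _ _).1 cf; have [dg vg] := (Ck_SP _ _ _).1 cg.
apply/Ck_SP; split=> [x Dx|v].
  by apply: differentiableM; [exact: df|exact: dg].
apply: (@Ck_eq _ _ _ (fun x => f x * 'D_v g x + g x * 'D_v f x)) => //.
  move=> x Dx; rewrite (@deriveM _ _ f g)//.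
  by apply: diff_derivable; exact: df.
  by apply: diff_derivable; exact: dg.
apply: Ck_D => //; apply: IH; [exact: Ck_S|exact: vg|exact: Ck_S|exact: vf].
Qed.

Lemma Ck_prod k (D : set E) (I : Type) (s : seq I) (f : I -> E -> R) :
  open D -> (forall i, Ck k D (f i)) ->
  Ck k D (fun x => \prod_(i <- s) f i x).
Proof.
move=> oD cf; elim: s => [|i s IH].
  apply: (@Ck_eq _ _ _ (fun=> 1 : R)) => //; last exact: Ck_cst.
  by move=> x _; rewrite big_nil.
apply: (@Ck_eq _ _ _ (fun x => f i x * \prod_(j <- s) f j x)) => //.
  by move=> x _; rewrite big_cons.
by apply: Ck_M => //; apply: cf.
Qed.

Lemma Ck_V k (D : set E) (f : E -> R) : open D ->
  (forall x, D x -> f x != 0) -> Ck k D f -> Ck k D (fun x => (f x)^-1).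
Proof.
move=> oD f0; elim: k => [|k IH] cf.
  by move: cf => /Ck_0P cf; apply/Ck_0P => x Dx; apply: cvgV; [exact: f0|exact: cf].
have [df vf] := (Ck_SP _ _ _).1 cf; apply/Ck_SP; split=> [x Dx|v].
  by apply: (differentiableV (df _ Dx)); exact: f0.
apply: (@Ck_eq _ _ _ (fun x => - ((f x)^-1 * (f x)^-1 * 'D_v f x))) => //.
  move=> x Dx; rewrite (@deriveV _ _ f x v (f0 _ Dx)); last first.
    by apply: diff_derivable; exact: df.
  by rewrite scaleNr -exprVn.
have cV : Ck k D (fun x => (f x)^-1) by apply: IH; exact: Ck_S.
by apply: Ck_N => //; apply: Ck_M; [|exact: Ck_M|exact: vf].
Qed.

Lemma Ck_scale (F : normedModType R) k (D : set E) (f : E -> R) (w : F) :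
  open D -> Ck k D f -> Ck k D (fun x => f x *: w).
Proof.
move=> oD; apply: (@Ck_lin _ _ _ _ (fun a : R => a *: w)) => //.
  by move=> a u v; rewrite scalerDl scalerA.
exact: scalel_continuous.
Qed.

Lemma Ck_pair (F G : normedModType R) k (D : set E) (f : E -> F) (g : E -> G) :
  open D -> Ck k D f -> Ck k D g -> Ck k D (fun x => (f x, g x)).
Proof.
move=> oD; elim: k f g => [|k IH] f g.
  by move=> /Ck_0P cf /Ck_0P cg; apply/Ck_0P => x Dx; apply: cvg_pair; [exact: cf|exact: cg].
move=> /Ck_SP[df vf] /Ck_SP[dg vg]; apply/Ck_SP; split=> [x Dx|v].
  by apply: differentiable_pair; [exact: df|exact: dg].
apply: Ck_eq (IH _ _ (vf v) (vg v)) => // x Dx.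
have dfx := df _ Dx; have dgx := dg _ Dx.
rewrite (deriveE v (differentiable_pair dfx dgx)) diff_pair//=.
by rewrite (deriveE v dfx) (deriveE v dgx).
Qed.

Lemma Ck_fst (F G : normedModType R) k (D : set E) (f : E -> F * G) :
  open D -> Ck k D f -> Ck k D (fun x => (f x).1).
Proof.
by move=> oD; apply: (@Ck_lin _ _ _ _ fst) => // x; apply: cvg_fst.
Qed.

Lemma Ck_snd (F G : normedModType R) k (D : set E) (f : E -> F * G) :
  open D -> Ck k D f -> Ck k D (fun x => (f x).2).
Proof.
by move=> oD; apply: (@Ck_lin _ _ _ _ snd) => // x; apply: cvg_snd.
Qed.

End CkGeneral.

Section CkMatrix.
Context {R : realType} {E : normedModType R} {k : nat} {D : set E}.
Hypothesis oD : open D.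

Lemma Ck_entry m n (A : E -> 'M[R]_(m, n)) i j :
  Ck k D A -> Ck k D (fun x => A x i j).
Proof.
apply: (@Ck_lin _ _ _ _ _ _ (fun B : 'M[R]_(m, n) => B i j)) => //.
  by move=> a u v; rewrite !mxE.
exact: coord_continuous.
Qed.

Lemma Ck_mx m n (A : E -> 'M[R]_(m, n)) :
  (forall i j, Ck k D (fun x => A x i j)) -> Ck k D A.
Proof.
move=> cA.
apply: (@Ck_eq _ _ _ _ _ (fun x => \sum_i \sum_j A x i j *: delta_mx i j)) => //.
  by move=> x _; rewrite -matrix_sum_delta.
by apply: Ck_sum => // i _; apply: Ck_sum => // j _; apply: Ck_scale.
Qed.

Lemma Ck_mulmx m n p (A : E -> 'M[R]_(m, n)) (B : E -> 'M[R]_(n, p)) :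
  Ck k D A -> Ck k D B -> Ck k D (fun x => A x *m B x).
Proof.
move=> cA cB; apply: Ck_mx => i j.
apply: (@Ck_eq _ _ _ _ _ (fun x => \sum_l A x i l * B x l j)) => //.
  by move=> x _; rewrite mxE.
by apply: Ck_sum => // l _; apply: Ck_M => //; apply: Ck_entry.
Qed.

(** Expanding in the matrix units [delta_mx i j] makes [l] a finite sum over the entries, so its
    continuity comes for free. *)
Lemma Ck_linmx (F : normedModType R) m n (l : 'M[R]_(m, n) -> F)
    (A : E -> 'M[R]_(m, n)) :
  linear l -> Ck k D A -> Ck k D (fun x => l (A x)).
Proof.
move=> ll cA.
pose L : {linear 'M[R]_(m, n) -> F} :=
  HB.pack l (GRing.isLinear.Build _ _ _ _ l ll).
apply: (@Ck_eq _ _ _ _ _ (fun x => \sum_i \sum_j A x i j *: L (delta_mx i j))) => //.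
  move=> x _; rewrite -[l]/(L : _ -> _) {2}(matrix_sum_delta (A x)) linear_sum.
  by apply: eq_bigr => i _; rewrite linear_sum; apply: eq_bigr => j _; rewrite linearZ.
apply: Ck_sum => // i _; apply: Ck_sum => // j _; apply: Ck_scale => //.
exact: Ck_entry.
Qed.

Lemma Ck_tr m n (A : E -> 'M[R]_(m, n)) :
  Ck k D A -> Ck k D (fun x => (A x)^T).
Proof. by apply: Ck_linmx => a u v; rewrite linearP. Qed.

Lemma Ck_mxtrace n (A : E -> 'M[R]_n) :
  Ck k D A -> Ck k D (fun x => \tr (A x)).
Proof. by apply: (@Ck_linmx R^o) => a u v; rewrite linearP. Qed.

Lemma Ck_det n (A : E -> 'M[R]_n) :
  Ck k D A -> Ck k D (fun x => \det (A x)).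
Proof.
move=> cA; apply: Ck_sum => // s _; apply: Ck_M => //; first exact: Ck_cst.
by apply: Ck_prod => // i; apply: Ck_entry.
Qed.

(** By Cramer's rule the entries of the inverse are cofactors divided by the determinant. *)
Lemma Ck_invmx n (A : E -> 'M[R]_n) : (forall x, D x -> A x \in unitmx) ->
  Ck k D A -> Ck k D (fun x => invmx (A x)).
Proof.
move=> uA cA; apply: (@Ck_eq _ _ _ _ _
  (fun x => \matrix_(i, j) ((\det (A x))^-1 * cofactor (A x) j i))) => //.
  by move=> x Dx; apply/matrixP => i j; rewrite /invmx uA// !mxE.
apply: Ck_mx => i j; apply: (@Ck_eq _ _ _ _ _
  (fun x => (\det (A x))^-1 * cofactor (A x) j i)) => //.
  by move=> x _; rewrite mxE.
apply: Ck_M => //.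
  apply: Ck_V => //; last exact: Ck_det.
  by move=> x /uA; rewrite unitmxE unitfE.
apply: Ck_M => //; first exact: Ck_cst.
apply: Ck_sum => // s _; apply: Ck_M => //; first exact: Ck_cst.
apply: Ck_prod => // l.
rewrite [X in Ck _ _ X](_ : _ = fun x => A x (lift j l) (lift i (perm.fun_of_perm s l))).
  exact: Ck_entry.
by apply/funext => x; rewrite !mxE.
Qed.

Lemma Ck_sylmx n (P W V Q : E -> 'M[R]_n) :
  Ck k D P -> Ck k D W -> Ck k D V -> Ck k D Q ->
  Ck k D (fun x => sylmx (P x) (W x) (V x) (Q x)).
Proof.
move=> cP cW cV cQ; apply: Ck_mx => i j.
pose Z := vec_mx (delta_mx 0 i : 'rV[R]_(n * n)).
apply: (@Ck_eq _ _ _ _ _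
  (fun x => mxvec (P x *m Z *m W x + V x *m Z *m Q x) 0 j)) => //.
  by move=> x _; rewrite !mxE.
apply: Ck_entry; apply: Ck_linmx; first by move=> a u v; rewrite linearP.
by apply: Ck_D => //; do 2?apply: Ck_mulmx => //; exact: Ck_cst.
Qed.

Lemma Ck_sylsol n (P W V Q C : E -> 'M[R]_n) :
  (forall x, D x -> [/\ spd (P x), spd (W x), spd (V x) & spd (Q x)]) ->
  Ck k D P -> Ck k D W -> Ck k D V -> Ck k D Q -> Ck k D C ->
  Ck k D (fun x => sylsol (P x) (W x) (V x) (Q x) (C x)).
Proof.
move=> pd cP cW cV cQ cC; apply: Ck_linmx; first by move=> a u v; rewrite linearP.
apply: Ck_mulmx; first by apply: Ck_linmx => // a u v; rewrite linearP.
apply: Ck_invmx; last exact: Ck_sylmx.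
by move=> x /pd[*]; apply: sylmx_unit.
Qed.

End CkMatrix.

(** * Differentiation rules in a fixed direction *)

Section HasDerive.
Context {R : realType} {E : normedModType R}.

(** Frechet differentiability is carried along with the directional derivative because the chain
    rule relies on it. *)
Definition has_derive (F : normedModType R) (f : E -> F) (x v : E) (df : F) :=
  differentiable f x /\ 'D_v f x = df.

Lemma has_deriveE (F : normedModType R) (f : E -> F) (x v : E) :
  differentiable f x -> has_derive f x v ('d f x v).
Proof. by move=> df; split=> //; rewrite deriveE. Qed.

Lemma has_derive_diff (F : normedModType R) (f : E -> F) (x v : E) (w : F) :
  has_derive f x v w -> 'd f x v = w.
Proof. by move=> [df <-]; rewrite deriveE. Qed.

Lemma has_derive_eq (F : normedModType R) (f : E -> F) (x v : E) (w w' : F) :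
  has_derive f x v w -> w = w' -> has_derive f x v w'.
Proof. by move=> fw <-. Qed.

Lemma near_has_derive (F : normedModType R) (f g : E -> F) (x v : E) (w : F) :
  {near x, f =1 g} -> has_derive f x v w -> has_derive g x v w.
Proof.
move=> fg [df <-]; split; first exact: near_eq_differentiable df.
by apply: near_eq_derive; move: fg; apply: filterS => y ->.
Qed.

Lemma has_derive_cst (F : normedModType R) (a : F) (x v : E) :
  has_derive (fun=> a) x v 0.
Proof. by split; [exact: (differentiable_cst a)|exact: (derive_cst a)]. Qed.

Lemma has_derive_lin (F F' : normedModType R) (l : F -> F') (f : E -> F) x v w :
  linear l -> continuous l -> has_derive f x v w ->
  has_derive (fun y => l (f y)) x v (l w).
Proof. by move=> ll cl [df <-]; have := derive_lin v ll cl df. Qed.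

Lemma has_deriveD (F : normedModType R) (f g : E -> F) x v w w' :
  has_derive f x v w -> has_derive g x v w' ->
  has_derive (fun y => f y + g y) x v (w + w').
Proof.
move=> [df <-] [dg <-]; split; first exact: differentiableD.
by rewrite (@deriveD _ _ _ f g)//; apply: diff_derivable.
Qed.

Lemma has_deriveN (F : normedModType R) (f : E -> F) x v w :
  has_derive f x v w -> has_derive (fun y => - f y) x v (- w).
Proof.
apply: (@has_derive_lin _ _ (fun y => - y)).
  by move=> a u u'; rewrite opprD scalerN.
by move=> y; apply: cvgN.
Qed.

Lemma has_deriveB (F : normedModType R) (f g : E -> F) x v w w' :
  has_derive f x v w -> has_derive g x v w' ->
  has_derive (fun y => f y - g y) x v (w - w').
Proof. by move=> df dg; apply: has_deriveD => //; apply: has_deriveN. Qed.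

Lemma has_derive_sum (F : normedModType R) (I : Type) (s : seq I)
    (f : I -> E -> F) (w : I -> F) x v :
  (forall i, has_derive (f i) x v (w i)) ->
  has_derive (fun y => \sum_(i <- s) f i y) x v (\sum_(i <- s) w i).
Proof.
move=> fw; elim: s => [|i s IH].
  rewrite big_nil; have := has_derive_cst (0 : F) x v; apply: near_has_derive.
  by near=> y; rewrite big_nil.
rewrite big_cons; have := has_deriveD (fw i) IH; apply: near_has_derive.
by near=> y; rewrite big_cons.
Unshelve. all: by end_near. Qed.

Lemma has_deriveM (f g : E -> R) x v w w' :
  has_derive f x v w -> has_derive g x v w' ->
  has_derive (fun y => f y * g y) x v (w * g x + f x * w').
Proof.
move=> [df <-] [dg <-]; split; first exact: differentiableM.
rewrite (@deriveM _ _ f g)//; try exact: diff_derivable.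
by rewrite addrC [in LHS]/GRing.scale/= [g x * _]mulrC.
Qed.

Lemma has_derive_scale (F : normedModType R) (f : E -> R) (u : F) x v w :
  has_derive f x v w -> has_derive (fun y => f y *: u) x v (w *: u).
Proof.
apply: (@has_derive_lin _ _ (fun a : R => a *: u)).
  by move=> a b c; rewrite scalerDl scalerA.
exact: scalel_continuous.
Qed.

Lemma has_derive_pair (F G : normedModType R) (f : E -> F) (g : E -> G) x v w w' :
  has_derive f x v w -> has_derive g x v w' ->
  has_derive (fun y => (f y, g y)) x v (w, w').
Proof.
move=> [df <-] [dg <-]; split; first exact: differentiable_pair.
rewrite (deriveE v (differentiable_pair df dg)) diff_pair//=.
by rewrite (deriveE v df) (deriveE v dg).
Qed.

Lemma has_derive_fst (F G : normedModType R) (f : E -> F * G) x v w :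
  has_derive f x v w -> has_derive (fun y => (f y).1) x v w.1.
Proof. by apply: (@has_derive_lin _ _ fst) => // y; apply: cvg_fst. Qed.

Lemma has_derive_snd (F G : normedModType R) (f : E -> F * G) x v w :
  has_derive f x v w -> has_derive (fun y => (f y).2) x v w.2.
Proof. by apply: (@has_derive_lin _ _ snd) => // y; apply: cvg_snd. Qed.

Lemma has_derive_entry m n (A : E -> 'M[R]_(m, n)) x v (W : 'M[R]_(m, n)) i j :
  has_derive A x v W -> has_derive (fun y => A y i j) x v (W i j).
Proof.
apply: (@has_derive_lin _ _ (fun B : 'M[R]_(m, n) => B i j)).
  by move=> a u u'; rewrite !mxE.
exact: coord_continuous.
Qed.

Lemma has_derive_mx m n (A : E -> 'M[R]_(m, n)) x v (W : 'M[R]_(m, n)) :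
  (forall i j, has_derive (fun y => A y i j) x v (W i j)) ->
  has_derive A x v W.
Proof.
move=> AW; rewrite [W]matrix_sum_delta.
have : has_derive (fun y => \sum_i \sum_j A y i j *: delta_mx i j) x v
    (\sum_i \sum_j W i j *: delta_mx i j).
  by apply: has_derive_sum => i; apply: has_derive_sum => j; apply: has_derive_scale.
by apply: near_has_derive; near=> y; rewrite -matrix_sum_delta.
Unshelve. all: by end_near. Qed.

Lemma has_derive_mulmx m n p (A : E -> 'M[R]_(m, n)) (B : E -> 'M[R]_(n, p)) x v
    (W : 'M[R]_(m, n)) (W' : 'M[R]_(n, p)) :
  has_derive A x v W -> has_derive B x v W' ->
  has_derive (fun y => A y *m B y) x v (W *m B x + A x *m W').
Proof.
move=> AW BW; apply: has_derive_mx => i j.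
have : has_derive (fun y => \sum_k A y i k * B y k j) x v
    (\sum_k (W i k * B x k j + A x i k * W' k j)).
  apply: has_derive_sum => k; apply: has_deriveM; exact: has_derive_entry.
move=> /has_derive_eq h; have {h} : has_derive (fun y => \sum_k A y i k * B y k j) x v
    ((W *m B x + A x *m W') i j).
  by apply: h; rewrite !mxE -big_split.
by apply: near_has_derive; near=> y; rewrite mxE.
Unshelve. all: by end_near. Qed.

Lemma has_derive_linmx (F : normedModType R) m n (l : 'M[R]_(m, n) -> F)
    (A : E -> 'M[R]_(m, n)) x v (W : 'M[R]_(m, n)) :
  linear l -> has_derive A x v W -> has_derive (fun y => l (A y)) x v (l W).
Proof.
move=> ll AW.
pose L : {linear 'M[R]_(m, n) -> F} :=
  HB.pack l (GRing.isLinear.Build _ _ _ _ l ll).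
have lE B : l B = \sum_i \sum_j B i j *: L (delta_mx i j).
  rewrite -[l]/(L : _ -> _) {1}(matrix_sum_delta B) linear_sum.
  by apply: eq_bigr => i _; rewrite linear_sum; apply: eq_bigr => j _; rewrite linearZ.
rewrite lE.
have : has_derive (fun y => \sum_i \sum_j A y i j *: L (delta_mx i j)) x v
    (\sum_i \sum_j W i j *: L (delta_mx i j)).
  apply: has_derive_sum => i; apply: has_derive_sum => j; apply: has_derive_scale.
  exact: has_derive_entry.
by apply: near_has_derive; near=> y; rewrite lE.
Unshelve. all: by end_near. Qed.

Lemma has_derive_tr m n (A : E -> 'M[R]_(m, n)) x v (W : 'M[R]_(m, n)) :
  has_derive A x v W -> has_derive (fun y => (A y)^T) x v W^T.
Proof. by apply: has_derive_linmx => a u w; rewrite linearP. Qed.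

(* At a zero of [b] the product rule needs no derivative of [a]. *)
Lemma has_derive_vanish (a b : E -> R) x v w : {for x, continuous a} -> b x = 0 ->
  has_derive b x v w -> has_derive (fun y => b y * a y) x v (w * a x).
Proof.
move=> ca bx0 [db <-].
pose l h := 'd b x h * a x.
have ll : linear l by move=> c u u'; rewrite /l linearP mulrDl -scalerAl.
pose L : {linear E -> R} := HB.pack l (GRing.isLinear.Build _ _ _ _ l ll).
have cL : continuous L.
  by move=> h; apply: cvgM; [exact: diff_continuous|exact: cvg_cst].
have [K K0 dbK] := linear_lipschitz (diff_continuous db).
suff [df dE] : differentiable (fun y => b y * a y) x /\
    'd (fun y => b y * a y) x = L :> (E -> R).
  by split=> //; rewrite (deriveE v df) dE /L/= /l (deriveE v db).
apply: diff_eps => // e e0.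
(* [M] bounds [a] near [x] and [K] is a Lipschitz constant of ['d b x]; the tolerances are chosen so
   that each of the two error terms is at most [e / 2] times the norm of [h]. *)
pose M := `|a x| + 1; have M0 : 0 < M by rewrite ltr_wpDl.
have e1 : 0 < e / (2 * M) by rewrite divr_gt0// mulr_gt0.
have e2 : 0 < Num.min 1 (e / (2 * K)) by rewrite lt_min ltr01 divr_gt0// mulr_gt0.
have nb := diff_epsE db e1.
have na : \forall h \near 0, `|a x - a (h + x)| < Num.min 1 (e / (2 * K)).
  have : \forall y \near x, `|a x - a y| < Num.min 1 (e / (2 * K)).
    by move/cvgrPdist_lt : ca; exact.
  by rewrite (near_shift 0 x)/= subr0.
move: nb na; apply: filterS2 => h; rewrite bx0 subr0 mul0r subr0.
rewrite lt_min => hb /andP[ha1 ha2]; rewrite /L/= /l.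
have -> : b (h + x) * a (h + x) - 'd b x h * a x =
    (b (h + x) - 'd b x h) * a (h + x) - 'd b x h * (a x - a (h + x)) by ring.
apply: (le_trans (ler_normB _ _)); rewrite !normrM.
have aM : `|a (h + x)| <= M.
  rewrite -[a (h + x)](subKr (a x)) (le_trans (ler_normB _ _))// lerD2l.
  exact: ltW.
have h1 : `|b (h + x) - 'd b x h| * `|a (h + x)| <= e / 2 * `|h|.
  apply: (le_trans (ler_pM _ _ hb aM)) => //.
  by rewrite le_eqVlt; apply/orP; left; apply/eqP; field; rewrite gt_eqF.
have h2 : `|'d b x h| * `|a x - a (h + x)| <= e / 2 * `|h|.
  apply: (le_trans (ler_pM _ _ (dbK h) (ltW ha2))) => //.
  by rewrite le_eqVlt; apply/orP; left; apply/eqP; field; rewrite gt_eqF.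
by rewrite (le_trans (lerD h1 h2))// -mulrDl -splitr.
Qed.

Lemma has_derive_vanish_mulmx m n p (B : E -> 'M[R]_(m, n))
    (A : E -> 'M[R]_(n, p)) x v (W : 'M[R]_(m, n)) :
  {for x, continuous A} -> B x = 0 -> has_derive B x v W ->
  has_derive (fun y => B y *m A y) x v (W *m A x).
Proof.
move=> cA B0 BW; apply: has_derive_mx => i j.
have h : has_derive (fun y => \sum_k B y i k * A y k j) x v
    (\sum_k (W i k * A x k j)).
  apply: has_derive_sum => k; apply: has_derive_vanish; last exact: has_derive_entry.
    apply: (@continuous_comp _ _ _ A (fun B : 'M[R]_(n, p) => B k j)) => //.
    exact: coord_continuous.
  by rewrite B0 mxE.
have {h} : has_derive (fun y => \sum_k B y i k * A y k j) x v ((W *m A x) i j).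
  by rewrite mxE.
by apply: near_has_derive; near=> y; rewrite mxE.
Unshelve. all: by end_near. Qed.

End HasDerive.

Section CkComp.
Context {R : realType} {E : normedModType R}.

(** The chain rule is expanded in the matrix units, so that the induction hypothesis applies to
    derivatives of [f] in directions that do not depend on the point. *)
Lemma Ck_comp m n k (D : set E) (f : 'M[R]_(m, n) -> R) (s : E -> 'M[R]_(m, n)) :
  open D -> Ck k setT f -> Ck k D s -> Ck k D (f \o s).
Proof.
move=> oD; elim: k f => [|k IH] f cf cs.
  move: cf cs => /Ck_0P cf /Ck_0P cs; apply/Ck_0P.
  by move=> x Dx; apply: continuous_comp; [exact: cs|exact: cf].
have [df vf] := (Ck_SP _ _ _).1 cf; have [ds vs] := (Ck_SP _ _ _).1 cs.
apply/Ck_SP; split=> [x Dx|v].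
  by apply: differentiable_comp; [exact: ds|exact: df].
apply: (@Ck_eq _ _ _ _ _ (fun x => \sum_i \sum_j
   'D_v s x i j * ((fun y => 'D_(delta_mx i j) f y) \o s) x)) => //.
  move=> x Dx; have dsx := ds _ Dx; have dfx := df (s x) I.
  rewrite (deriveE v (differentiable_comp dsx dfx)) diff_comp//=.
  rewrite -(deriveE v dsx) [in RHS](matrix_sum_delta ('D_v s x)) linear_sum.
  apply: eq_bigr => i _; rewrite linear_sum; apply: eq_bigr => j _.
  by rewrite linearZ/= (deriveE _ dfx).
apply: Ck_sum => // i _; apply: Ck_sum => // j _; apply: Ck_M => //.
  by apply: Ck_entry => //; exact: (vs v).
by apply: IH; [exact: (vf (delta_mx i j))|exact: Ck_S].
Qed.

End CkComp.

(** * Smoothness of the positive definite square root *)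

Section SmoothSqrt.
Context {R : realType}.

(* Half of the Frobenius product of [Q - P] with
   [(Q + P)(Q - P) + (Q - P)(Q + P) = 2 (Q^2 - P^2)] bounds
   [|C (Q - P)|^2], where [C^2 = P]; conclude by Young's inequality. *)
Lemma sqrt_diff_bound n (P Q C : 'M[R]_n) : spd P -> spd Q -> spd C ->
  C *m C = P ->
  \tr ((C *m (Q - P))^T *m (C *m (Q - P))) <=
  4 * \tr ((invmx C *m (Q *m Q - P *m P))^T *m (invmx C *m (Q *m Q - P *m P))).
Proof.
move=> pP pQ pC CP; set Z := Q - P; set A := _ - _.
have sC := spd_sym pC; have uC := spd_unit pC.
set X := C *m Z; set Y := invmx C *m A.
have XX : \tr (X^T *m X) = \tr (Z^T *m (P *m Z)).
  by rewrite trmx_mul sC -CP !mulmxA.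
have XY : \tr (X^T *m Y) = \tr (Z^T *m A).
  by rewrite trmx_mul sC -mulmxA mulKVmx.
have eA : 2 *: A = Q *m Z + P *m Z + Z *m (Q + P).
  rewrite /A /Z !(mulmxBr, mulmxDr, mulmxBl, mulmxDl) scaler_nat mulr2n.
  by apply/matrixP => i j; rewrite !mxE; ring.
have p1 := @spd_1 R n.
have t1 := wfrob_ge0 Z pQ p1; have t2 := wfrob_ge0 Z p1 (spdD pQ pP).
rewrite mulmx1 in t1; rewrite mul1mx in t2.
have t3 : 2 * \tr (Z^T *m A) =
    \tr (Z^T *m (Q *m Z)) + \tr (X^T *m X) + \tr (Z^T *m (Z *m (Q + P))).
  by rewrite XX -!mxtraceD -!mulmxDr -eA -scalemxAr mxtraceZ.
have := frob_ge0 (X - 2 *: Y).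
have -> : (X - 2 *: Y)^T = X^T - 2 *: Y^T by rewrite linearB/= linearZ.
rewrite mulmxBr !mulmxBl -!scalemxAl -!scalemxAr.
rewrite !raddfB /= !mxtraceZ [\tr (Y^T *m X)]frobC XY.
move: (\tr (Z^T *m A)) (\tr (X^T *m X)) (\tr (Y^T *m Y)) t1 t2 t3.
by move: (\tr _) (\tr _) => *; lra.
Qed.

Context {E : normedModType R}.

Lemma cvg_mx m n (A : E -> 'M[R]_(m, n)) (x : E) :
  (forall i j, {for x, continuous (fun y => A y i j)}) ->
  {for x, continuous A}.
Proof.
move=> cA; rewrite /prop_for/continuous_at.
have -> : A = fun y => \sum_i \sum_j A y i j *: delta_mx i j.
  by apply/funext => y; rewrite -matrix_sum_delta.
apply: cvg_big => [|i _]; first exact: add_continuous.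
apply: cvg_big => [|j _]; first exact: add_continuous.
by apply: cvgZr_tmp; exact: cA.
Qed.

(** A squeeze: [sqrt_diff_bound] dominates each entry of [C *m (N y - N x)] by the root of a
    continuous function vanishing at [x]. Multiplying by the inverse of [C] recovers [N y]. *)
Lemma msqrt_continuous n (D : set E) (A : E -> 'M[R]_n) : open D ->
  (forall x, D x -> spd (A x)) -> Ck 0 D A -> Ck 0 D (fun x => msqrt (A x)).
Proof.
move=> oD pA cA; apply/Ck_0P => x Dx; set N := fun x => msqrt (A x).
have [pN NA] := msqrtP (pA _ Dx); have [C pC CN] := spd_sqrt pN.
have uC := spd_unit pC.
have cX : {for x, continuous (fun y => C *m (N y - N x))}.
  apply: cvg_mx => i j; rewrite /prop_for/continuous_at subrr mulmx0 mxE.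
  pose phi y := 4 * \tr ((invmx C *m (A y - A x))^T *m (invmx C *m (A y - A x))).
  have cphi : {for x, continuous phi}.
    suff /Ck_0P : Ck 0 D phi by apply.
    have cB : Ck 0 D (fun y => invmx C *m (A y - A x)).
      apply: Ck_mulmx => //; first exact: Ck_cst.
      by apply: Ck_B => //; exact: Ck_cst.
    apply: Ck_M => //; first exact: Ck_cst.
    by apply: Ck_mxtrace => //; apply: Ck_mulmx => //; apply: Ck_tr.
  have phi0 : phi x = 0 by rewrite /phi subrr mulmx0 mulmx0 mxtrace0 mulr0.
  apply/norm_cvg0P.
  have cs : Num.sqrt (phi y) @[y --> x] --> (0 : R).
    rewrite -(@sqrtr0 R) -phi0; apply: (@continuous_comp _ _ _ phi Num.sqrt) => //.
    exact: sqrt_continuous.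
  apply: (squeeze_cvgr _ (cvg_cst 0) cs).
  have nD : nbhs x D by exact: open_nbhs_nbhs.
  apply: filterS nD => y Dy; rewrite normr_ge0 -sqrtr_sqr.
  have [pNy NAy] := msqrtP (pA _ Dy).
  rewrite ler_wsqrtr//; apply: (le_trans (frob_entry_le _ i j)).
  by rewrite /phi -NA -NAy; apply: sqrt_diff_bound.
rewrite /prop_for/continuous_at.
have -> : N = fun y => invmx C *m (C *m (N y - N x)) + N x.
  by apply/funext => y; rewrite mulKmx// subrK.
apply: cvgD; last exact: cvg_cst.
have cl : continuous (fun Z : 'M[R]_n => invmx C *m Z).
  move=> Z; suff /Ck_0P : Ck 0 setT (fun Z : 'M[R]_n => invmx C *m Z) by apply.
  apply: (@Ck_linmx _ _ _ _ openT _ _ _ _ id) => //.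
    by move=> a u v; rewrite linearP.
  by apply/Ck_0P => y _.
exact: (continuous_comp cX (cl _)).
Qed.

(* The difference of two square roots solves a Sylvester equation whose right-hand
   side is the difference of the squares; hence differentiability follows from
   continuity, and the derivative is again a function of the square root. *)
Lemma Ck_msqrt n k (D : set E) (A : E -> 'M[R]_n) : open D ->
  (forall x, D x -> spd (A x)) -> Ck k D A -> Ck k D (fun x => msqrt (A x)).
Proof.
move=> oD pA; elim: k => [|k IH] cA; first exact: msqrt_continuous.
have cA0 := Ck_le (leq0n _) cA; have c0 := msqrt_continuous oD pA cA0.
set N := fun x => msqrt (A x); have p1 := @spd_1 R n.
have pN x : D x -> spd (N x) by move=> /pA/msqrtP[].
have dN x v : D x -> has_derive N x v
    (sylsol (N x + N x) 1%:M 1%:M (N x + N x) (2 *: 'D_v A x)).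
  move=> Dx; have pNx := pN _ Dx; have dA := proj1 ((Ck_SP _ _ _).1 cA) _ Dx.
  pose K y := invmx (sylmx (N y + N x) 1%:M 1%:M (N y + N x)).
  have cK : {for x, continuous K}.
    suff /Ck_0P : Ck 0 D K by apply.
    have cNN : Ck 0 D (fun y => N y + N x) by apply: Ck_D => //; exact: Ck_cst.
    apply: Ck_invmx => //.
      by move=> y Dy; apply: sylmx_unit => //; apply: spdD => //; exact: pN.
    by apply: Ck_sylmx => //; exact: Ck_cst.
  pose B y : 'rV[R]_(n * n) := mxvec (2 *: (A y - A x)).
  have dB : has_derive B x v (mxvec (2 *: 'D_v A x)).
    have dAx : has_derive (fun y => A y - A x) x v ('D_v A x).
      by rewrite -[X in has_derive _ _ _ X]subr0; apply: has_deriveB => //; exact: has_derive_cst.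
    apply: (has_derive_linmx (l := fun Z => mxvec (2 *: Z)) _ dAx).
    by move=> a u w; rewrite scalerDr scalerA mulrC -scalerA linearP.
  have B0 : B x = 0 by rewrite /B subrr scaler0 linear0.
  have := has_derive_vanish_mulmx cK B0 dB => dBK.
  have := has_deriveD (has_derive_cst (N x) x v) (has_derive_linmx (l := vec_mx) _ dBK).
  rewrite add0r => /(_ (fun a u w => linearP _ a u w)).
  apply: near_has_derive; have nD : nbhs x D by exact: open_nbhs_nbhs.
  apply: filterS nD => y Dy; have pNy := pN _ Dy; have pNN := spdD pNy pNx.
  rewrite -[RHS](subrK (N x)) addrC; congr (_ + _).
  apply/esym/sylsol_uniq => //; rewrite mulmx1 mul1mx.
  rewrite -(msqrtP (pA _ Dx)).2 -(msqrtP (pA _ Dy)).2 -/(N x) -/(N y).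
  rewrite !(mulmxBr, mulmxDr, mulmxBl, mulmxDl) scaler_nat mulr2n.
  by apply/matrixP => i j; rewrite !mxE; ring.
have cN : Ck k D N by apply: IH; exact: Ck_S.
apply/Ck_SP; split=> [x Dx|v]; first by have [] := dN x 0 Dx.
apply: (@Ck_eq _ _ _ _ _
   (fun x => sylsol (N x + N x) 1%:M 1%:M (N x + N x) (2 *: 'D_v A x))) => //.
  by move=> x Dx; have [] := dN x v Dx.
have cNN : Ck k D (fun x => N x + N x) by apply: Ck_D.
apply: Ck_sylsol => //; try exact: Ck_cst.
  by move=> x Dx; split=> //; apply: spdD; exact: pN.
by apply: Ck_linmx; [|move=> a u w; rewrite scalerDr !scalerA mulrC|exact: (proj2 ((Ck_SP _ _ _).1 cA))].
Qed.

End SmoothSqrt.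

(** * Symmetry of second derivatives *)

Section Schwarz.
Context {R : realType} {E : normedModType R}.

Lemma has_derive_comp (U F G : normedModType R) (s : U -> F) (f : F -> G) x v w :
  differentiable f (s x) -> has_derive s x v w ->
  has_derive (fun y => f (s y)) x v ('d f (s x) w).
Proof.
move=> df [ds <-]; have dc := differentiable_comp ds df.
by split=> //; rewrite (deriveE v dc) diff_comp//= (deriveE v ds).
Qed.

Lemma has_derive_line (F : normedModType R) (p v : F) (t : R) :
  has_derive (fun s : R => s *: v + p) t 1 v.
Proof.
rewrite -[X in has_derive _ _ _ X]addr0; apply: has_deriveD.
  have := @has_derive_scale R _ F id v t 1 1; rewrite scale1r; apply.
  by split; [by have [] := is_diff_id t|exact: derive_id].
exact: has_derive_cst.
Qed.

Lemma has_derive_is_derive (F : normedModType R) (f : R -> F) t w :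
  has_derive f t 1 w <-> is_derive t (1 : R) f w.
Proof.
split=> [[df <-]|[df <-]]; first exact/derivableP/diff_derivable.
by split=> //; exact/derivable1_diffP.
Qed.

(** The mean value theorem in the direction [v] turns the second difference into [t] times a
    difference of [a], the derivative of [f] along [v]; the first-order expansion of [a] at [x]
    evaluates that up to o(t). *)
Lemma second_difference (f : E -> R) (D : set E) (x v w : E) : open D -> D x ->
  Ck 2 D f -> forall e : R, 0 < e -> \forall t \near 0^'+,
    `|f (t *: v + (t *: w + x)) - f (t *: v + x) - f (t *: w + x) + f x
      - t ^+ 2 * 'D_w (fun y => 'D_v f y) x| <= e * t ^+ 2.
Proof.
move=> oD Dx /Ck_SP[df vf] e e0; pose a y := 'D_v f y.
have da : differentiable a x by have [+ _] := (Ck_SP _ _ _).1 (vf v); apply.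
(* All points involved lie within [t * K] of [x], so two remainders of size [e / (2 * K) * (t * K)]
   add up to [e * t]. The 1 keeps [K] positive when both directions vanish. *)
pose K := `|v| + `|w| + 1; have K0 : 0 < K by rewrite ltr_wpDl// addr_ge0.
have e1 : 0 < e / (2 * K) by rewrite divr_gt0// mulr_gt0.
have nD : \forall h \near (0 : E), D (h + x).
  have : \forall y \near x, D y by exact: open_nbhs_nbhs.
  by rewrite (near_shift 0 x)/= subr0.
have /nbhs_norm0P[d /= d0 Hd] :
    \forall h \near (0 : E), D (h + x) /\ `|a (h + x) - a x - 'd a x h| <= e / (2 * K) * `|h|.
  by move: nD (diff_epsE da e1); apply: filterS2 => h; split.
near=> t; have t0 : 0 < t by near: t; exact: nbhs_right_gt.
have td : t * K < d.
  rewrite -ltr_pdivlMr//; near: t; apply: nbhs_right_lt; exact: divr_gt0.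
have small h1 h2 : 0 <= h1 <= t -> 0 <= h2 <= t -> `|h1 *: v + h2 *: w| <= t * K.
  move=> /andP[h10 h1t] /andP[h20 h2t]; apply: (le_trans (ler_normD _ _)).
  rewrite !normrZ !ger0_norm// /K mulrDr mulrDr -[leLHS]addr0.
  by rewrite !lerD ?ler_wpM2r ?mulr1// ltW.
pose g s := f (s *: v + (t *: w + x)) - f (s *: v + x).
have dg s : 0 <= s <= t -> has_derive g s 1 (a (s *: v + (t *: w + x)) - a (s *: v + x)).
  move=> s0t; have ? : 0 <= t <= t by rewrite lexx ltW.
  have ? : (0 : R) <= 0 <= t by rewrite lexx ltW.
  have D1 : D (s *: v + (t *: w + x)).
    by rewrite addrA; apply: (Hd _ _).1; rewrite /= (le_lt_trans (small _ _ _ _)).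
  have D2 : D (s *: v + x).
    have := small s 0 s0t; rewrite scale0r addr0 => sm.
    by apply: (Hd _ _).1; rewrite /= (le_lt_trans (sm _)).
  rewrite /a (deriveE v (df _ D1)) (deriveE v (df _ D2)).
  by apply: has_deriveB; (apply: has_derive_comp; [exact: df|exact: has_derive_line]).
have [||c] := @MVT R g (fun s => a (s *: v + (t *: w + x)) - a (s *: v + x)) 0 t t0.
- move=> s; rewrite in_itv/= => /andP[s0 st].
  by apply/has_derive_is_derive/dg; rewrite !ltW.
- apply: derivable_within_continuous => s; rewrite in_itv/= => s0t.
  by apply: diff_derivable; have [] := dg _ s0t.
rewrite in_itv/= => /andP[c0 ct]; rewrite subr0 /g !scale0r !add0r => gE.
have c0t : 0 <= c <= t by rewrite !ltW.
have t0t : 0 <= t <= t by rewrite lexx ltW.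
have z0t : (0 : R) <= 0 <= t by rewrite lexx ltW.
have -> : f (t *: v + (t *: w + x)) - f (t *: v + x) - f (t *: w + x) + f x =
  (a (c *: v + (t *: w + x)) - a (c *: v + x)) * t by rewrite -gE; ring.
have sm1 := small _ _ c0t t0t; have sm2 := small _ _ c0t z0t.
have [_ h1] := Hd _ (le_lt_trans sm1 td).
have [_ h2] := Hd _ (le_lt_trans sm2 td).
rewrite scale0r addr0 in sm2 h2; rewrite -[_ + _ + x]addrA in h1.
have -> : 'D_w (fun y => 'D_v f y) x = 'd a x w by rewrite (deriveE w da).
have l1 : 'd a x (c *: v + t *: w) = 'd a x (c *: v) + t * 'd a x w.
  by rewrite linearD/= [X in _ + X]linearZ.
rewrite l1 in h1; set p := a (c *: v + (t *: w + x)) in h1 *.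
set q := a (c *: v + x) in h2 *; set y := 'd a x (c *: v) in h1 h2.
have -> : (p - q) * t - t ^+ 2 * 'd a x w =
   t * ((p - a x - (y + t * 'd a x w)) - (q - a x - y)) by ring.
rewrite normrM gtr0_norm// expr2 mulrCA ler_pM2l//.
apply: (le_trans (ler_normB _ _)); apply: (le_trans (lerD h1 h2)).
rewrite -mulrDr.
apply: (@le_trans _ _ (e / (2 * K) * (t * K + t * K))).
  by rewrite ler_pM2l// lerD.
by rewrite le_eqVlt; apply/orP; left; apply/eqP; field; rewrite gt_eqF.
Unshelve. all: by end_near. Qed.

(** The second difference is symmetric in [v] and [w], yet approximates [t ^+ 2] times either mixed
    derivative; divide by [t ^+ 2]. *)
Lemma derive_swap (f : E -> R) (D : set E) (x v w : E) : open D -> D x ->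
  Ck 2 D f -> 'D_w (fun y => 'D_v f y) x = 'D_v (fun y => 'D_w f y) x.
Proof.
move=> oD Dx cf; set A := LHS; set B := RHS.
apply/eqP; rewrite -subr_eq0 -normr_le0; apply/ler_addgt0Pl => e e0.
rewrite addr0; have e20 : 0 < e / 2 by rewrite divr_gt0.
have h1 := second_difference v w oD Dx cf e20.
have h2 := second_difference w v oD Dx cf e20.
suff hAB : \forall t \near (0 : R)^'+, `|A - B| <= e by have [] := filter_ex hAB.
have h0 := nbhs_right_gt (0 : R).
move: h0 h1 h2; apply: filterS3 => t t0.
rewrite -/A -/B [t *: w + (t *: v + x)]addrCA.
set T := f (t *: v + (t *: w + x)); set p := f (t *: v + x); set q := f (t *: w + x).
move=> hA hB; have t20 : 0 < t ^+ 2 by rewrite exprn_gt0.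
rewrite -(ler_pM2l t20) -{1}(gtr0_norm t20) -normrM.
have -> : t ^+ 2 * (A - B) = (T - q - p + f x - t ^+ 2 * B) -
   (T - p - q + f x - t ^+ 2 * A) by ring.
apply: (le_trans (ler_normB _ _)); apply: (le_trans (lerD hB hA)).
by rewrite -mulrDl -splitr mulrC.
Qed.

End Schwarz.

(** * Critical points in local coordinates *)

Section CriticalPoint.
Context {R : realType} {d : nat}.
Implicit Types (G : 'rV[R]_d -> 'M[R]_d) (phi psi : 'rV[R]_d -> R).

Definition hess_mx phi : 'M[R]_d := \matrix_(j, l) partial j (partial l phi) 0.

(** For a strict saddle, the negative eigenvalue is replaced by a direction of negative curvature of
    the ordinary Hessian, which involves no metric. *)
Definition crit_kind (k : point_kind) phi : Prop :=
  (forall l, partial l phi 0 = 0) /\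
  match k with
  | FOSP => True
  | SOSP => forall xi : 'rV[R]_d, 0 <= (xi *m hess_mx phi *m xi^T) 0 0
  | StrictSaddle => exists xi : 'rV[R]_d, (xi *m hess_mx phi *m xi^T) 0 0 < 0
  end.

Lemma near_crit_kind k phi psi : {near (0 : 'rV[R]_d), phi =1 psi} ->
  crit_kind k phi -> crit_kind k psi.
Proof.
(* Passing to the interior makes [phi] and [psi] agree near every point close to 0, so that their
   first partials agree near 0 as well and can be differentiated again. *)
move=> /nbhs_interior; rewrite near_simpl => eqn.
have eqp l : {near (0 : 'rV[R]_d), partial l phi =1 partial l psi}.
  by apply: filterS eqn => u eu; apply: near_eq_derive.
have -> : crit_kind k phi = crit_kind k psi; last by [].
rewrite /crit_kind.
have -> : hess_mx phi = hess_mx psi.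
  by apply/matrixP => j l; rewrite !mxE; apply: near_eq_derive; exact: eqp.
have -> // : (forall l, partial l phi 0 = 0) = (forall l, partial l psi 0 = 0).
by apply: eq_forall => l; rewrite (nbhs_singleton (eqp l)).
Qed.

Variables (D : set 'rV[R]_d) (G : 'rV[R]_d -> 'M[R]_d) (phi : 'rV[R]_d -> R).
Hypotheses (oD : open D) (D0 : D 0).
Hypotheses (spdG : forall u, D u -> spd (G u)) (cG : Ck 0 D G) (cphi : Ck 2 D phi).

Lemma hess_mx_sym : (hess_mx phi)^T = hess_mx phi.
Proof. by apply/matrixP => i j; rewrite !mxE /partial (derive_swap _ _ oD D0 cphi). Qed.

Lemma riem_grad_eq0 :
  riem_grad G phi 0 = 0 <-> forall l, partial l phi 0 = 0.
Proof.
have uG := spd_unit (spdG D0).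
have gE : (riem_grad G phi 0)^T = invmx (G 0) *m \col_l partial l phi 0.
  by apply/matrixP => i j; rewrite !mxE; apply: eq_bigr => l _; rewrite !mxE.
split=> [g0 l|p0].
  have : \col_l partial l phi 0 = 0 :> 'cV[R]_d.
    by rewrite -(mulKVmx uG (\col_l _)) -gE g0 trmx0 mulmx0.
  by move=> /matrixP/(_ l 0); rewrite !mxE.
apply: trmx_inj; rewrite gE trmx0 [X in _ *m X](_ : _ = 0) ?mulmx0//.
by apply/matrixP => i j; rewrite !mxE.
Qed.

(** The Christoffel sum has the vanishing gradient as a factor. In the derivative of the gradient
    the partials vanish at 0, so [has_derive_vanish] applies with [G] merely continuous. *)
Lemma riem_hess_crit : (forall l, partial l phi 0 = 0) ->
  riem_hess G phi 0 = hess_mx phi *m invmx (G 0).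
Proof.
move=> p0; have g0 := riem_grad_eq0.2 p0.
have symG : (invmx (G 0))^T = invmx (G 0).
  by rewrite trmx_inv (spd_sym (spdG D0)).
rewrite -symG; apply/matrixP => j k; rewrite !mxE.
rewrite [X in _ + X]big1 ?addr0 => [|l _]; last by rewrite g0 mxE mulr0.
have cGV : Ck 0 D (fun u => invmx (G u)).
  by apply: Ck_invmx => // u /spdG/spd_unit.
have : has_derive (fun w => \sum_(l < d) partial l phi w * invmx (G w) k l) 0 (e_ j)
    (\sum_(l < d) partial j (partial l phi) 0 * invmx (G 0) k l).
  apply: has_derive_sum => l; apply: has_derive_vanish => //.
    exact: (Ck_continuous (Ck_entry oD k l cGV) D0).
  split=> //; have [_ /(_ (e_ l))] := (Ck_SP _ _ _).1 cphi.
  by move=> /Ck_SP[+ _]; apply.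
move=> [_ h]; under [RHS]eq_bigr do rewrite !mxE; rewrite -h /partial.
apply: near_eq_derive; near=> w; rewrite mxE; apply: eq_bigr => l _.
exact: mulrC.
Unshelve. all: by end_near. Qed.

(** Writing the Hessian as S G^-1, the quadratic form in the SOSP condition is x S x^T. An
    eigenvector v for a < 0 satisfies v S v^T = a v G v^T < 0; the converse is [neg_eigenvalue]. *)
Lemma riem_crit_kind k :
  (riem_grad G phi 0 = 0 /\
   match k with
   | FOSP => True
   | SOSP => forall xi : 'rV[R]_d,
       0 <= ((xi *m riem_hess G phi 0) *m G 0 *m xi^T) 0 0
   | StrictSaddle => exists2 a : R, a < 0 & eigenvalue (riem_hess G phi 0) a
   end) <-> crit_kind k phi.
Proof.
have pG := spdG D0; have uG := spd_unit pG.
rewrite /crit_kind riem_grad_eq0; split=> -[p0 h]; split=> //; move: h;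
  rewrite riem_hess_crit//; case: k => //.
- by move=> h xi; have := h xi; rewrite mulmxA mulmxKV.
- move=> [a a0 /eigenvalueP[v vH v0]]; exists v.
  have -> : v *m hess_mx phi = a *: (v *m G 0).
    by rewrite scalemxAl -vH mulmxA mulmxKV.
  by rewrite -scalemxAl mxE nmulr_rlt0// spd_row.
- by move=> h xi; have := h xi; rewrite mulmxA mulmxKV.
by move=> [xi]; apply: neg_eigenvalue => //; exact: hess_mx_sym.
Qed.

End CriticalPoint.

(** * The quotient metric in a parametrization *)

Section Tangent.
Context {R : realType} {E : normedModType R}.

Lemma tangentP (S : set E) x v : tangent_space S x v <->
  exists g : R -> E, [/\ g 0 = x, \forall t \near (0 : R), S (g t) &
                         has_derive g 0 1 v].
Proof.
by split=> -[g [g0 Sg /has_derive_is_derive dg]]; exists g.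
Qed.

Lemma tangent_sub (S S' : set E) x v :
  S `<=` S' -> tangent_space S x v -> tangent_space S' x v.
Proof.
move=> SS [g [g0 Sg dg]]; exists g; split=> //.
by move: Sg; apply: filterS => t /SS.
Qed.

Lemma tangent_param (U : normedModType R) (S : set E) (D : set U) (s : U -> E) u xi :
  open D -> D u -> differentiable s u -> (forall u, D u -> S (s u)) ->
  tangent_space S (s u) ('d s u xi).
Proof.
move=> oD Du ds Ss; apply/tangentP; exists (fun t => s (t *: xi + u)); split.
- by rewrite scale0r add0r.
- have : {for (0 : R), continuous (fun t : R => t *: xi + u)}.
    have [dl _] := @has_derive_line R U u xi 0.
    exact: differentiable_continuous dl.
  rewrite /prop_for/continuous_at scale0r add0r => /(_ D).
  have nD : nbhs u D by exact: open_nbhs_nbhs.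
  move=> /(_ nD) nDt; have : \forall t \near (0 : R), D (t *: xi + u) by exact: nDt.
  by apply: filterS => t /Ss.
have := @has_derive_comp R R U E (fun t : R => t *: xi + u) s 0 1 xi.
rewrite scale0r add0r => h; apply: h => //; exact: has_derive_line.
Qed.

(* [LT x] is a linear space containing the tangent space to [total Q] at [x],
   and [mt x v w] is the quotient metric read through horizontal lifts. *)
Record lifted_metric (Q : quotient_geometry E) (LT : E -> set E)
    (mt : E -> E -> E -> R) : Prop := LiftedMetric {
  lm_tangent : forall x v, total Q x -> tangent_space (total Q) x v -> LT x v;
  lm_metric : forall x v w, total Q x -> LT x v -> LT x w ->
    metric Q x (hlift Q x v) (hlift Q x w) = mt x v w;
  lm_linear : forall x w, linear (fun v => mt x v w : R^o);
  lm_sym : forall x v w, total Q x -> mt x v w = mt x w v;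
  lm_pos : forall x v, total Q x -> LT x v -> vertical Q x v \/ 0 < mt x v v;
  lm_continuous : forall d (D : set 'rV[R]_d) (s a b : 'rV[R]_d -> E),
    open D -> (forall u, D u -> total Q (s u)) ->
    Ck 0 D s -> Ck 0 D a -> Ck 0 D b -> Ck 0 D (fun u => mt (s u) (a u) (b u))
}.

Variables (Q : quotient_geometry E) (LT : E -> set E) (mt : E -> E -> E -> R).
Hypothesis lm : lifted_metric Q LT mt.

Section Param.
Context {d : nat} {D : set 'rV[R]_d} {s : 'rV[R]_d -> E}.
Hypothesis ps : local_param Q D s.

Lemma param_Ck k : Ck k D s.
Proof. by case: ps => _ sms _ _ _; constructor. Qed.

Lemma param_diff u : D u -> differentiable s u.
Proof. by move=> Du; have [+ _] := (Ck_SP _ _ _).1 (param_Ck 1); apply. Qed.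

Lemma param_tangent u xi : D u -> tangent_space (total Q) (s u) ('d s u xi).
Proof.
case: ps => -[oD _] _ ts _ _ Du.
by apply: (tangent_param xi oD Du _ ts); exact: param_diff.
Qed.

Lemma qmetric_mxE u i j : D u ->
  qmetric_mx Q s u i j = mt (s u) ('D_(e_ i) s u) ('D_(e_ j) s u).
Proof.
case: (ps) => _ _ ts _ _ Du; rewrite mxE (lm_metric lm)//; first exact: ts.
- apply: (lm_tangent lm); first exact: ts.
  by rewrite deriveE; [exact: param_tangent|exact: param_diff].
apply: (lm_tangent lm); first exact: ts.
by rewrite deriveE; [exact: param_tangent|exact: param_diff].
Qed.

(** By bilinearity the quadratic form is [mt] on the image of x under the differential of [s]. That
    image is vertical only for x = 0, by the injectivity in [local_param]. *)
Lemma qmetric_mx_spd u : D u -> spd (qmetric_mx Q s u).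
Proof.
case: (ps) => -[oD _] _ ts inj _ Du; have tsu := ts _ Du; have dsu := param_diff Du.
have qE := qmetric_mxE _ _ Du.
split; first by apply/matrixP => i j; rewrite mxE !qE (lm_sym lm).
move=> x x0; have dsE : 'd s u x^T = \sum_i x i 0 *: 'D_(e_ i) s u.
  rewrite [in LHS](row_sum_delta x^T) linear_sum; apply: eq_bigr => i _.
  by rewrite linearZ/= mxE (deriveE _ dsu).
have linr w : linear (fun v => mt (s u) w v : R^o).
  by move=> a v v'; rewrite !(lm_sym lm w _ tsu) (lm_linear lm).
have -> : (x^T *m qmetric_mx Q s u *m x) 0 0 = mt (s u) ('d s u x^T) ('d s u x^T).
  pose L w : {linear E -> R^o} := HB.pack (fun v => mt (s u) v w : R^o)
    (GRing.isLinear.Build _ _ _ _ _ (lm_linear lm (s u) w)).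
  pose L' w : {linear E -> R^o} := HB.pack (fun v => mt (s u) w v : R^o)
    (GRing.isLinear.Build _ _ _ _ _ (linr w)).
  rewrite -[RHS]/(L' ('d s u x^T) ('d s u x^T)) {2}dsE linear_sum mxE.
  apply: eq_bigr => j _; rewrite linearZ/= mulrC; congr (_ * _).
  rewrite -[RHS]/(L ('D_(e_ j) s u) ('d s u x^T)) dsE linear_sum mxE.
  by apply: eq_bigr => i _; rewrite linearZ/= qE mxE.
have LTx : LT (s u) ('d s u x^T).
  by apply: (lm_tangent lm) => //; exact: param_tangent.
have [/(inj _ _ Du) xT0|//] := lm_pos lm tsu LTx.
by case/negP: x0; rewrite -[x]trmxK xT0 trmx0.
Qed.

Lemma qmetric_mx_Ck : Ck 0 D (qmetric_mx Q s).
Proof.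
case: (ps) => -[oD _] _ ts _ _; apply: Ck_mx => // i j.
apply: (@Ck_eq _ _ _ _ _ (fun u => mt (s u) ('D_(e_ i) s u) ('D_(e_ j) s u))) => //.
  by move=> u Du; rewrite qmetric_mxE.
have cd l : Ck 0 D (fun u => 'D_(e_ l) s u).
  by have [_ +] := (Ck_SP _ _ _).1 (param_Ck 1); apply.
by apply: (lm_continuous lm) => //; exact: param_Ck.
Qed.

End Param.

(** Removes the metric from [riem_point]: for every parametrization the metric matrix is positive
    definite and continuous, so [riem_crit_kind] applies. *)
Lemma riem_pointP (h : E -> R) k (c : set E) :
  (forall d (D : set 'rV[R]_d) s, open D -> (forall j, Ck j D s) ->
     (forall u, D u -> total Q (s u)) -> Ck 2 D (h \o s)) ->
  riem_point k Q h c <->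
  exists d (D : set 'rV[R]_d) s,
    [/\ local_param Q D s, c (s 0) & crit_kind k (h \o s)].
Proof.
move=> ch.
have key d (D : set 'rV[R]_d) s (ps : local_param Q D s) :
    riem_grad (qmetric_mx Q s) (h \o s) 0 = 0 /\ _ <-> crit_kind k (h \o s) :=
  let: And5 (conj oD D0) _ ts _ _ := ps in
  riem_crit_kind oD D0 (qmetric_mx_spd ps) (qmetric_mx_Ck ps)
    (ch _ _ _ oD (param_Ck ps) ts) k.
split=> -[d [D [s]]].
  move=> [ps cs g0 hk]; exists d, D, s; split=> //.
  exact: (key _ _ _ ps).1.
move=> [ps cs /(key _ _ _ ps)[g0 hk]]; exists d, D, s; split=> //.
Qed.

End Tangent.

(** * Fibrations over the matrices of rank r *)

Section Transfer.
Context {R : realType} {p1 p2 r : nat}.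
Notation Mat := 'M[R]_(p1, p2).
Notation Me := (@embedded_geometry R p1 p2 r).
Notation rank_r := [set X : Mat | \rank X = r].

(** The class of [X] is a singleton, so a curve in it is locally constant. *)
Lemma vertical_embedded (X v : Mat) : \rank X = r -> vertical Me X v <-> v = 0.
Proof.
move=> rX; split=> [/tangentP[g [g0 Xg [_ <-]]]|->].
  rewrite (@near_eq_derive _ _ _ g (fun=> X)) ?(derive_cst X)//.
  by move: Xg; apply: filterS => t [].
apply/tangentP; exists (fun=> X); split=> //; last exact: has_derive_cst.
by near=> t; split.
Unshelve. all: by end_near. Qed.

Lemma hlift_embedded (X v : Mat) : \rank X = r -> tangent_space rank_r X v ->
  hlift Me X v = v.
Proof.
move=> rX Tv; rewrite /hlift; case: xgetP => [w _ [_ /(vertical_embedded _ rX)]|].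
  by move=> /eqP; rewrite subr_eq0 => /eqP.
by move=> /(_ v); case; split=> //; apply/vertical_embedded; rewrite ?subrr.
Qed.

Lemma embedded_lifted_metric :
  lifted_metric Me (fun X => tangent_space rank_r X) (fun _ v w => \tr (v^T *m w)).
Proof.
split=> //.
- by move=> X v w rX Tv Tw; rewrite !hlift_embedded.
- move=> _ w a v v'; rewrite linearD linearZ/= mulmxDl -scalemxAl.
  by rewrite mxtraceD mxtraceZ.
- by move=> _ v w _; exact: frobC.
- move=> X v rX _; have [->|v0] := eqVneq v 0; first by left; apply/vertical_embedded.
  right; have := wfrob_gt0 (@spd_1 R _) (@spd_1 R _) v0.
  by rewrite mul1mx mulmx1.
move=> d D s a b oD _ _ ca cb; apply: Ck_mxtrace => //.
by apply: Ck_mulmx => //; exact: Ck_tr.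
Qed.

(* [dphi] is the differential of [phi], and [LT] is as in [lifted_metric]. *)
Record rank_fibration (E : normedModType R) (Q : quotient_geometry E)
    (LT : E -> set E) (phi : E -> Mat) (dphi : E -> E -> Mat) : Prop :=
  RankFibration {
  rf_derive : forall (U : normedModType R) (g : U -> E) u v w,
    has_derive g u v w -> has_derive (phi \o g) u v (dphi (g u) w);
  rf_derB : forall x v w, dphi x (v - w) = dphi x v - dphi x w;
  rf_Ck : forall d (D : set 'rV[R]_d) (s : 'rV[R]_d -> E) k,
    open D -> Ck k D s -> Ck k D (phi \o s);
  rf_rank : forall x, total Q x -> \rank (phi x) = r;
  rf_linB : forall x v w, LT x v -> LT x w -> LT x (v - w);
  rf_ker : forall x w, total Q x -> LT x w -> dphi x w = 0 -> vertical Q x w;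
  rf_surj : forall x v, total Q x -> tangent_space rank_r (phi x) v ->
    exists2 w, tangent_space (total Q) x w & dphi x w = v;
  rf_rel : forall x y, total Q x -> total Q y -> rel_eq Q x y <-> phi x = phi y;
  rf_section : forall X, \rank X = r -> exists (N : set Mat) (sg : Mat -> E),
    [/\ open N, N X,
        forall Y, N Y -> \rank Y = r -> total Q (sg Y) /\ phi (sg Y) = Y &
        forall d (D : set 'rV[R]_d) (s : 'rV[R]_d -> Mat) k, open D ->
          (forall u, D u -> N (s u) /\ \rank (s u) = r) ->
          Ck k D s -> Ck k D (sg \o s)]
}.

Context {E : normedModType R} {Q : quotient_geometry E} {LT : E -> set E}.
Context {mt : E -> E -> E -> R} {phi : E -> Mat} {dphi : E -> E -> Mat}.
Hypotheses (lm : lifted_metric Q LT mt) (rf : rank_fibration Q LT phi dphi).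
Context {f : Mat -> R}.
Hypothesis cf : Ck 2 setT f.

Lemma vertical_ker x v : total Q x -> vertical Q x v -> dphi x v = 0.
Proof.
move=> tx /tangentP[g [g0 xg dg]].
have [_] := rf_derive rf dg; rewrite g0 => <-.
rewrite (@near_eq_derive _ _ _ _ (fun=> phi x)) ?(derive_cst (phi x))//.
move: xg; apply: filterS => t [tg rg].
by apply/esym/(rf_rel rf).
Qed.

Lemma derive_phi d (D : set 'rV[R]_d) (s : 'rV[R]_d -> E) u xi :
  local_param Q D s -> D u -> 'd (phi \o s) u xi = dphi (s u) ('d s u xi).
Proof.
move=> ps Du; apply: has_derive_diff; apply: (rf_derive rf).
by apply: has_deriveE; exact: param_diff ps _ Du.
Qed.

(** Injectivity holds because the kernel of [dphi] is vertical. For surjectivity, lift the tangent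
    vector, decompose the lift modulo vertical vectors, and apply [dphi], which kills them. *)
Lemma push_param d (D : set 'rV[R]_d) (s : 'rV[R]_d -> E) :
  local_param Q D s -> local_param Me D (phi \o s).
Proof.
move=> ps; have [[oD D0] _ ts inj surj] := ps.
have rk u : D u -> \rank (phi (s u)) = r by move=> /ts/(rf_rank rf).
split=> //.
- by move=> k; have [] := rf_Ck rf oD (param_Ck ps k).
- move=> u xi Du /(vertical_embedded _ (rk _ Du)); rewrite (derive_phi _ ps Du) => dxi.
  apply: (inj u) => //; apply: (rf_ker rf) => //; first exact: ts.
  by apply: (lm_tangent lm); [exact: ts|exact: (param_tangent ps)].
move=> u v Du Tv; have [w Tw <-] := rf_surj rf (ts _ Du) Tv.
have [xi /(vertical_ker (ts _ Du)) vxi] := surj _ _ Du Tw; exists xi.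
apply/vertical_embedded; first exact: rk.
by rewrite (derive_phi _ ps Du) -(rf_derB rf).
Qed.

Lemma Ck_phi d (D : set 'rV[R]_d) s : open D -> (forall j, Ck j D s) ->
  (forall u, D u -> total Q (s u)) -> Ck 2 D ((f \o phi) \o s).
Proof. by move=> oD cs _; apply: (Ck_comp oD cf); exact: (rf_Ck rf). Qed.

Lemma riem_point_push k x : total Q x ->
  riem_point k Q (f \o phi) (qclass Q x) ->
  riem_point k Me f (qclass Me (phi x)).
Proof.
move=> tx /(riem_pointP lm _ _ Ck_phi)[d [D [s [ps [ts0 rs0] ck]]]].
apply/(riem_pointP embedded_lifted_metric).
  by move=> d' D' s' oD' cs' _; apply: Ck_comp.
exists d, D, (phi \o s); split=> //; first exact: push_param.
by split; [exact: (rf_rank rf)|exact/(rf_rel rf)].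
Qed.

(** The chart [s] around [X] lifts to [sg \o s] over the same coordinates, and [phi] maps it back to
    [s]; hence the function read in the coordinates does not change near 0. The class is unique
    because [rf_rel] makes each fiber of [phi] a single class. *)
Lemma riem_point_lift k X : \rank X = r -> riem_point k Me f (qclass Me X) ->
  exists c, unique (class_over Q phi X) c /\ riem_point k Q (f \o phi) c.
Proof.
move=> rX /(riem_pointP embedded_lifted_metric) [].
  by move=> d' D' s' oD' cs' _; apply: Ck_comp.
move=> d [D [s [ps [/= rs0 eX] ck]]]; have [[oD D0] _ ts inj surj] := ps.
have [N [sg [oN NX sgP sgC]]] := rf_section rf rX.
have cs j : Ck j D s by exact: param_Ck ps j.
(* The section is defined only near [X], so the chart is shrunk to the preimage of [N]. *)
pose D' := D `&` s @^-1` N.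
have oD' : open D'.
  rewrite openE => u [Du Nu]; apply: filterI; first exact: open_nbhs_nbhs.
  by apply: (Ck_continuous (cs 0) Du); exact: open_nbhs_nbhs.
have D'0 : D' 0 by split=> //=; rewrite -eX.
have D'D : D' `<=` D by move=> u [].
have sgs u : D' u -> total Q (sg (s u)) /\ phi (sg (s u)) = s u.
  by move=> [Du Nu]; apply: sgP => //; exact: ts.
have ts' u : D' u -> total Q (sg (s u)) by move=> /sgs[].
have cs' j : Ck j D' (sg \o s).
  apply: sgC => //; last exact: Ck_subset (cs j).
  by move=> u [Du Nu]; split=> //; exact: ts.
have ds' u : D' u -> differentiable (sg \o s) u.
  by move=> Du; have [+ _] := (Ck_SP _ _ _).1 (cs' 1); apply.
(* Differentiate [phi (sg (s w)) = s w]. *)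
have dphis u xi : D' u -> dphi (sg (s u)) ('d (sg \o s) u xi) = 'd s u xi.
  move=> Du; have /(rf_derive rf)/has_derive_diff <- := has_deriveE xi (ds' u Du).
  apply: has_derive_diff; have := has_deriveE xi (param_diff ps (D'D _ Du)).
  apply: near_has_derive; have : nbhs u D' by exact: open_nbhs_nbhs.
  by apply: filterS => w /sgs[].
have Tds u xi : D' u -> tangent_space (total Q) (sg (s u)) ('d (sg \o s) u xi).
  by move=> Du; apply: (tangent_param xi oD' Du (ds' _ Du)).
have ps' : local_param Q D' (sg \o s).
  split=> //.
  - by move=> j; have [] := cs' j.
  - move=> u xi Du /(vertical_ker (ts' _ Du)); rewrite dphis// => dxi.
    apply: (inj u); first exact: D'D.
    by apply/vertical_embedded => //; exact/ts/D'D.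
  (* Push [v] down by [dphi] and express the result through the chart [s]. The difference upstairs
     then lies in the kernel of [dphi], hence is vertical. *)
  move=> u v Du Tv; have Du' := D'D _ Du.
  have Tw : tangent_space (total Me) (s u) (dphi (sg (s u)) v).
    have /tangentP[g [g0 tg dg]] := Tv; apply/tangentP; exists (phi \o g); split.
    - by rewrite /= g0; have [] := sgs _ Du.
    - by move: tg; apply: filterS => t /(rf_rank rf).
    by rewrite -[sg (s u)]g0; apply: (rf_derive rf).
  have [xi /(vertical_embedded _ (ts _ Du')) vxi] := surj _ _ Du' Tw; exists xi.
  apply: (rf_ker rf); first exact: ts'.
    by apply: (rf_linB rf); apply: (lm_tangent lm) => //; [exact: ts'|exact: ts'|exact: Tds].
  by rewrite (rf_derB rf) dphis.
have rel_refl x y : total Q x -> total Q y -> phi x = phi y -> qclass Q x = qclass Q y.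
  move=> tx ty xy; apply/seteqP; split=> z [tz rz]; split=> //; apply/(rf_rel rf) => //.
    by rewrite -xy; exact/(rf_rel rf).
  by rewrite xy; exact/(rf_rel rf).
have [t0 e0] := sgs _ D'0.
exists (qclass Q (sg (s 0))); split.
  split; first by exists (sg (s 0)); split=> //; rewrite e0 eX.
  by move=> c' [y [ty -> ey]]; apply: rel_refl => //; rewrite e0 ey eX.
apply/(riem_pointP lm _ _ Ck_phi); exists d, D', (sg \o s).
split; first exact: ps'.
  by split; [exact: t0|exact/(rf_rel rf)].
move: ck; apply: near_crit_kind; have : nbhs (0 : 'rV[R]_d) D' by exact: open_nbhs_nbhs.
by apply: filterS => u /sgs[_ /= ->].
Qed.

End Transfer.

(** * Matrices of fixed rank and their tangent vectors *)

Section FullRank.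
Context {R : realType}.

Lemma full_col_rank_inj p r m (L : 'M[R]_(p, r)) (v : 'M[R]_(r, m)) :
  full_col_rank L -> L *m v = 0 -> v = 0.
Proof.
move=> rL /(congr1 trmx); rewrite trmx_mul trmx0 => /eqP.
rewrite mulmx_free_eq0; last by rewrite /row_free mxrank_tr rL.
by move=> /eqP/(congr1 trmx); rewrite trmxK trmx0.
Qed.

Lemma spd_gram_full p r (L : 'M[R]_(p, r)) : full_col_rank L -> spd (L^T *m L).
Proof. by move=> rL; apply: spd_gram => v; exact: full_col_rank_inj. Qed.

Lemma unit_full_col_rank p r (A : 'M[R]_(r, p)) (L : 'M[R]_(p, r)) :
  A *m L \in unitmx -> full_col_rank L.
Proof.
move=> uAL; apply/eqP; rewrite eqn_leq rank_leq_col/=.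
by rewrite -{1}(mxrank_unit uAL) mxrankM_maxr.
Qed.

Lemma full_col_rankP p r (L : 'M[R]_(p, r)) :
  full_col_rank L <-> L^T *m L \in unitmx.
Proof.
by split=> [/spd_gram_full/spd_unit|]; last exact: unit_full_col_rank.
Qed.

Lemma full_col_rankM p r (L : 'M[R]_(p, r)) (M : 'M[R]_r) :
  full_col_rank L -> M \in unitmx -> full_col_rank (L *m M).
Proof. by move=> rL uM; rewrite /full_col_rank mxrankMfree// row_free_unit. Qed.

Lemma stiefel_full p r (U : 'M[R]_(p, r)) : stiefel U -> full_col_rank U.
Proof. by move=> sU; apply/full_col_rankP; rewrite sU unitmx1. Qed.

Lemma rank_mul_tr p1 p2 r (L : 'M[R]_(p1, r)) (S : 'M[R]_(p2, r)) :
  full_col_rank L -> full_col_rank S -> \rank (L *m S^T) = r.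
Proof. by move=> rL rS; rewrite mxrankMfree// /row_free mxrank_tr rS. Qed.

Lemma rank_factor p1 p2 r (X : 'M[R]_(p1, p2)) : \rank X = r ->
  exists (L : 'M[R]_(p1, r)) (S : 'M[R]_(p2, r)),
    [/\ full_col_rank L, full_col_rank S & X = L *m S^T].
Proof.
move=> <-; exists (col_base X), (row_base X)^T; split.
- by apply/eqP; have := col_base_full X.
- by rewrite /full_col_rank mxrank_tr; apply/eqP; have := row_base_free X.
by rewrite trmxK mulmx_base.
Qed.

(* The Schur complement of an invertible [r x r] block of a matrix of rank [r]
   vanishes. *)
Lemma schur_rank p1 p2 r (Y : 'M[R]_(p1, p2)) (A : 'M[R]_(p2, r)) (B : 'M[R]_(r, p1)) :
  \rank Y = r -> B *m Y *m A \in unitmx ->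
  Y *m A *m invmx (B *m Y *m A) *m (B *m Y) = Y.
Proof.
move=> /rank_factor[L [S [rL rS ->]]].
rewrite mulmxA -mulmxA -[L *m S^T *m A]mulmxA.
move: (B *m L) (S^T *m A) => P Q; rewrite unitmx_mul => /andP[uP uQ].
have -> : invmx (P *m Q) = invmx Q *m invmx P.
  apply: (can_inj (mulKmx (_ : P *m Q \in unitmx))).
    by rewrite unitmx_mul uP.
  by rewrite mulmxV ?unitmx_mul ?uP// mulmxA mulmxK// mulmxV.
by rewrite !mulmxA mulmxK// mulmxKV.
Qed.

Lemma open_unitmx n : open [set M : 'M[R]_n | M \in unitmx].
Proof.
have -> : [set M : 'M[R]_n | M \in unitmx] = (@determinant R n) @^-1` [set x | x != 0].
  by apply/seteqP; split=> M /=; rewrite unitmxE unitfE.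
apply: open_comp; last exact: open_neq.
move=> M _; apply: (@Ck_continuous _ _ _ 0 setT) => //.
by apply: Ck_det; [exact: openT|apply/Ck_0P => x _].
Qed.

Lemma invmx_continuous n (M : 'M[R]_n) : M \in unitmx -> 
  {for M, continuous (invmx : 'M[R]_n -> 'M[R]_n)}.
Proof.
move=> uM; apply: (@Ck_continuous _ _ _ 0 [set M | M \in unitmx]) => //.
by apply: (Ck_invmx (open_unitmx (n := n)) _ (A := id)) => //; apply/Ck_0P => x _.
Qed.

Section Curves.
Context {E : normedModType R}.

Lemma has_derive_cont (F : normedModType R) (f : E -> F) x v w :
  has_derive f x v w -> {for x, continuous f}.
Proof. by move=> [/differentiable_continuous]. Qed.

Lemma near_unitmx n (A : E -> 'M[R]_n) x : {for x, continuous A} ->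
  A x \in unitmx -> \forall y \near x, A y \in unitmx.
Proof.
move=> cA uA; have : nbhs (A x) [set M : 'M[R]_n | M \in unitmx].
  by apply: open_nbhs_nbhs; split=> //; exact: open_unitmx.
exact: cA.
Qed.

Lemma has_derive_mull m n p (C : 'M[R]_(m, n)) (A : E -> 'M[R]_(n, p)) x v
    (W : 'M[R]_(n, p)) :
  has_derive A x v W -> has_derive (fun y => C *m A y) x v (C *m W).
Proof. by apply: has_derive_linmx => a u w; rewrite linearP. Qed.

Lemma has_derive_mulr m n p (C : 'M[R]_(n, p)) (A : E -> 'M[R]_(m, n)) x v
    (W : 'M[R]_(m, n)) :
  has_derive A x v W -> has_derive (fun y => A y *m C) x v (W *m C).
Proof.
move=> dA; apply: (has_derive_linmx (l := fun Z => Z *m C) _ dA) => a u w.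
by rewrite mulmxDl scalemxAl.
Qed.

(** Near [x] the inverse of [A y] is A(x)^-1 - A(x)^-1 (A(y) - A(x)) A(y)^-1. The subtracted product
    vanishes at [x] in its first factor, so continuity of the inverse suffices. *)
Lemma has_derive_invmx n (A : E -> 'M[R]_n) x v (W : 'M[R]_n) :
  A x \in unitmx -> has_derive A x v W ->
  has_derive (fun y => invmx (A y)) x v (- (invmx (A x) *m W *m invmx (A x))).
Proof.
move=> uA dA; have cA := has_derive_cont dA.
have cV : {for x, continuous (fun y => invmx (A y))}.
  exact: (continuous_comp cA (invmx_continuous uA)).
have dB : has_derive (fun y => invmx (A x) *m (A y - A x)) x v (invmx (A x) *m W).
  apply: has_derive_mull; rewrite -[W]subr0.
  by apply: has_deriveB => //; exact: has_derive_cst.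
have B0 : invmx (A x) *m (A x - A x) = 0 by rewrite subrr mulmx0.
have := has_deriveB (has_derive_cst (invmx (A x)) x v)
  (has_derive_vanish_mulmx cV B0 dB).
rewrite sub0r; apply: near_has_derive.
have := near_unitmx cA uA; apply: filterS => y uy.
by rewrite mulmxBr mulVmx// mulmxBl mul1mx mulmxK// subKr.
Qed.

End Curves.

(** By [schur_rank], N g N' = (N g S) M^-1 (L^T g N') along the curve. Both outer factors vanish at
    0, so the product has zero derivative there. *)
Lemma tangent_rank p1 p2 r (L : 'M[R]_(p1, r)) (S : 'M[R]_(p2, r)) (v : 'M[R]_(p1, p2))
    m n (N : 'M[R]_(m, p1)) (N' : 'M[R]_(p2, n)) :
  full_col_rank L -> full_col_rank S -> N *m L = 0 -> S^T *m N' = 0 ->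
  tangent_space [set X : 'M[R]_(p1, p2) | \rank X = r] (L *m S^T) v ->
  N *m v *m N' = 0.
Proof.
move=> rL rS NL SN /tangentP[g [g0 rg dg]].
pose M t := L^T *m g t *m S.
have dM : has_derive M 0 1 (L^T *m v *m S).
  by apply: has_derive_mulr; exact: has_derive_mull.
have uM : M 0 \in unitmx.
  rewrite /M g0 !mulmxA -mulmxA unitmx_mul.
  by rewrite !spd_unit//; exact: spd_gram_full.
have d1 := has_derive_mulr S (has_derive_mull N dg).
have d2 := has_derive_mulr N' (has_derive_mull L^T dg).
have z1 : N *m g 0 *m S = 0 by rewrite g0 mulmxA NL !mul0mx.
have z2 : L^T *m g 0 *m N' = 0 by rewrite g0 mulmxA -[_ *m S^T *m N']mulmxA SN mulmx0.
have d3 := has_derive_mulmx (has_derive_mulmx d1 (has_derive_invmx uM dM)) d2.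
rewrite z1 z2 !mul0mx mulmx0 addr0 in d3.
have d4 := has_derive_mulr N' (has_derive_mull N dg).
rewrite -(has_derive_diff d4); apply: has_derive_diff.
move: d3; apply: near_has_derive.
have nM := near_unitmx (has_derive_cont dM) uM.
move: rg nM; apply: filterS2 => t rt ut.
rewrite -[in RHS](schur_rank rt ut) /M.
by rewrite !mulmxA.
Qed.

(** The Cayley transform of T = t Om / 2: I - T and I + T are transposes of each other and commute,
    which makes the quotient orthogonal. The factor 1/2 gives the velocity [Om]. *)
Lemma cayley_curve n (Om : 'M[R]_n) : Om^T = - Om ->
  exists C : R -> 'M[R]_n, [/\ C 0 = 1%:M,
    \forall t \near (0 : R), orthogonal_mx (C t) & has_derive C 0 1 Om].
Proof.
move=> skO; pose T (t : R) := t *: (2^-1 *: Om).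
have dT : has_derive T 0 1 (2^-1 *: Om).
  have := has_derive_line 0 (2^-1 *: Om) 0.
  by apply: near_has_derive; near=> t; rewrite addr0.
have skT t : (T t)^T = - T t by rewrite /T !linearZ/= skO !scalerN.
have T0 : T 0 = 0 by rewrite /T scale0r.
have d1 : has_derive (fun t => 1%:M - T t) 0 1 (- (2^-1 *: Om)).
  by rewrite -[X in has_derive _ _ _ X]sub0r; apply: has_deriveB => //; exact: has_derive_cst.
have d2 : has_derive (fun t => 1%:M + T t) 0 1 (2^-1 *: Om).
  by rewrite -[X in has_derive _ _ _ X]add0r; apply: has_deriveD => //; exact: has_derive_cst.
have u1 : 1%:M - T 0 \in unitmx by rewrite T0 subr0 unitmx1.
exists (fun t => invmx (1%:M - T t) *m (1%:M + T t)); split.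
- by rewrite T0 subr0 addr0 invmx1 mulmx1.
- have := near_unitmx (has_derive_cont d1) u1; apply: filterS => t ut.
  have tE : (1%:M - T t)^T = 1%:M + T t by rewrite linearB/= trmx1 skT opprK.
  have tE' : (1%:M + T t)^T = 1%:M - T t by rewrite -tE trmxK.
  have ut' : 1%:M + T t \in unitmx by rewrite -tE unitmx_tr.
  have comm : (1%:M - T t) *m (1%:M + T t) = (1%:M + T t) *m (1%:M - T t).
    by rewrite !(mulmxDr, mulmxDl, mulmxN, mulNmx, mulmx1, mul1mx) addrACA [T t - _]addrC addrACA.
  rewrite /orthogonal_mx trmx_mul trmx_inv tE tE' mulmxA.
  apply: (can_inj (mulmxK ut)); rewrite mul1mx -!mulmxA -comm.
  by rewrite mulKmx// mulVmx// mulmx1.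
have := has_derive_mulmx
  (has_derive_invmx (A := fun t : R => 1%:M - T t) u1 d1) d2.
rewrite T0 subr0 addr0 invmx1 !mul1mx !mulmx1 opprK.
by rewrite -scalerDl (_ : 2^-1 + 2^-1 = 1) ?scale1r//; field.
Unshelve. all: by end_near. Qed.

(** The linearization of [U^T *m U = 1%:M]. *)
Definition stiefel_tan p r (U w : 'M[R]_(p, r)) : Prop := U^T *m w + w^T *m U = 0.

Lemma stiefel_tan_skew p r (U w : 'M[R]_(p, r)) : stiefel_tan U w ->
  (U^T *m w)^T = - (U^T *m w).
Proof.
by move=> e; rewrite trmx_mul trmxK; apply/eqP; rewrite -addr_eq0 addrC e.
Qed.

Lemma skew_stiefel_tan p r (U w : 'M[R]_(p, r)) :
  (U^T *m w)^T = - (U^T *m w) -> stiefel_tan U w.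
Proof. by rewrite trmx_mul trmxK /stiefel_tan => ->; rewrite subrr. Qed.

Lemma stiefel_tanB p r (U v w : 'M[R]_(p, r)) :
  stiefel_tan U v -> stiefel_tan U w -> stiefel_tan U (v - w).
Proof.
move=> ev ew; apply: skew_stiefel_tan; rewrite mulmxBr linearB/=.
by rewrite !stiefel_tan_skew// opprD.
Qed.

Lemma stiefel_tangent p r (U w : 'M[R]_(p, r)) : stiefel U ->
  tangent_space [set U : 'M[R]_(p, r) | stiefel U] U w <-> stiefel_tan U w.
Proof.
move=> sU; rewrite /stiefel_tan; split=> [/tangentP[g [g0 sg dg]]|skw].
  have d := has_derive_mulmx (has_derive_tr dg) dg.
  rewrite addrC -g0 -(has_derive_diff d).
  apply: has_derive_diff; have := has_derive_cst (1%:M : 'M[R]_r) (0 : R) 1.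
  by apply: near_has_derive; move: sg; apply: filterS => t ->.
have wU : w^T *m U = - (U^T *m w) by apply/eqP; rewrite -addr_eq0 addrC skw.
(* [A] is skew and [A *m U = w], so rotating [U] along the Cayley curve of [A] stays on the Stiefel
   manifold and has velocity [w]. *)
pose A := w *m U^T - U *m w^T - U *m (U^T *m w) *m U^T.
have [|C [C0 oC dC]] := @cayley_curve p A.
  rewrite /A !linearB/= !trmx_mul !trmxK wU !(mulmxN, mulNmx) !mulmxA.
  by apply/matrixP => i j; rewrite !mxE; ring.
have AU : A *m U = w.
  rewrite /A !mulmxBl -!mulmxA sU !mulmx1 wU mulmxN opprK.
  by rewrite addrK.
apply/tangentP; exists (fun t => C t *m U); split.
- by rewrite C0 mul1mx.
- move: oC; apply: filterS => t oC.
  by rewrite /= /stiefel trmx_mul mulmxA -[_ *m C t]mulmxA oC mulmx1 sU.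
by rewrite -AU; exact: has_derive_mulr.
Qed.

End FullRank.

(** * Polar factors and smooth local lifts of matrices of rank r *)

Section Orthonormalization.
Context {R : realType}.

(** The orthonormal factor in the polar decomposition of [L]; its smoothness in [L] comes from that
    of [msqrt]. *)
Definition onb p r (L : 'M[R]_(p, r)) : 'M[R]_(p, r) :=
  L *m invmx (msqrt (L^T *m L)).

Lemma onb_stiefel p r (L : 'M[R]_(p, r)) : full_col_rank L -> stiefel (onb L).
Proof.
move=> /spd_gram_full pL; have [pN NL] := msqrtP pL; have uN := spd_unit pN.
rewrite /stiefel trmx_mul trmx_inv (spd_sym pN) mulmxA -[_ *m L^T *m L]mulmxA.
by rewrite -{2}NL mulmxA mulVmx// mul1mx mulmxV.
Qed.

Lemma onbK p r (L : 'M[R]_(p, r)) : full_col_rank L ->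
  onb L *m msqrt (L^T *m L) = L.
Proof. by move=> /spd_gram_full/msqrtP[/spd_unit uN _]; rewrite mulmxKV. Qed.

Lemma Ck_onb (E : normedModType R) k (D : set E) p r (L : E -> 'M[R]_(p, r)) :
  open D -> (forall u, D u -> full_col_rank (L u)) ->
  Ck k D L -> Ck k D (fun u => onb (L u)).
Proof.
move=> oD rL cL; apply: Ck_mulmx => //; apply: Ck_invmx => //.
  by move=> u /rL/spd_gram_full/msqrtP[/spd_unit].
apply: Ck_msqrt => //; first by move=> u /rL/spd_gram_full.
by apply: Ck_mulmx => //; exact: Ck_tr.
Qed.

(** Orthonormalize a basis of the kernel of [U^T]; [onb] changes it by an invertible right factor
    only, so the span is kept. *)
Lemma orth_compl_span p r (U : 'M[R]_(p, r)) : stiefel U ->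
  exists Up : 'M[R]_(p, p - r), orth_compl U Up /\
    forall m (w : 'M[R]_(p, m)), U^T *m w = 0 -> exists D, w = Up *m D.
Proof.
move=> sU.
have [N [rN UN spanN]] : exists N : 'M[R]_(p, p - r),
    [/\ full_col_rank N, U^T *m N = 0 &
      forall m (w : 'M[R]_(p, m)), U^T *m w = 0 -> exists D, w = N *m D].
  have : \rank (kermx U) = (p - r)%N by rewrite mxrank_ker (stiefel_full sU).
  move=> <-; exists (row_base (kermx U))^T; split.
  - by rewrite /full_col_rank mxrank_tr; apply/eqP; have := row_base_free (kermx U).
  - apply: trmx_inj; rewrite trmx_mul !trmxK trmx0; apply/sub_kermxP.
    by rewrite eq_row_base.
  move=> m w /(congr1 trmx); rewrite trmx_mul trmxK trmx0 => /sub_kermxP.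
  rewrite -(eq_row_base (kermx U)) => /submxP[D wD]; exists D^T.
  by apply: trmx_inj; rewrite trmx_mul !trmxK.
exists (onb N); split.
  by split; [exact: onb_stiefel|rewrite /onb mulmxA UN mul0mx].
move=> m w /spanN[D ->]; exists (msqrt (N^T *m N) *m D).
by rewrite mulmxA onbK.
Qed.

Section Lift.
Context {p1 p2 r : nat} (S : 'M[R]_(p2, r)).

(** Where [Y *m S] has full column rank. If moreover Y has rank r, then [Y *m S] spans the column
    space of Y, [lift_U] is an orthonormal basis of it, and the polar decomposition of [lift_Y]
    supplies the factors B and V. *)
Definition lift_dom : set 'M[R]_(p1, p2) :=
  [set Y | (Y *m S)^T *m (Y *m S) \in unitmx].
Definition lift_U (Y : 'M[R]_(p1, p2)) : 'M[R]_(p1, r) := onb (Y *m S).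
Definition lift_Y (Y : 'M[R]_(p1, p2)) : 'M[R]_(p2, r) := Y^T *m lift_U Y.
Definition lift_B (Y : 'M[R]_(p1, p2)) : 'M[R]_r :=
  msqrt ((lift_Y Y)^T *m lift_Y Y).

Lemma lift_dom_open : open lift_dom.
Proof.
have -> : lift_dom = (fun Y : 'M[R]_(p1, p2) => (Y *m S)^T *m (Y *m S)) @^-1`
    [set M | M \in unitmx] by [].
apply: open_comp; last exact: open_unitmx.
move=> Y _; apply: (@Ck_continuous _ _ _ 0 setT) => //; have oT := openT.
have cS : Ck 0 setT (fun Y : 'M[R]_(p1, p2) => Y *m S).
  by apply: Ck_mulmx => //; [apply/Ck_0P => x _|exact: Ck_cst].
by apply: Ck_mulmx => //; exact: Ck_tr.
Qed.

Lemma lift_dom0 (L : 'M[R]_(p1, r)) : full_col_rank L -> full_col_rank S ->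
  lift_dom (L *m S^T).
Proof.
move=> rL rS; apply/full_col_rankP; rewrite -mulmxA; apply: full_col_rankM => //.
exact/full_col_rankP.
Qed.

Lemma lift_U_stiefel Y : lift_dom Y -> stiefel (lift_U Y).
Proof. by move=> /full_col_rankP; exact: onb_stiefel. Qed.

(** Factor Y = L S'^T. Invertibility of S'^T S puts the columns of L in the span of U = [lift_U Y],
    on which U U^T is the identity. *)
Lemma lift_UK Y : lift_dom Y -> \rank Y = r -> lift_U Y *m (lift_Y Y)^T = Y.
Proof.
move=> dY rY; have sU := lift_U_stiefel dY; move: dY => /full_col_rankP fY.
have [L [S' [rL rS' YE]]] := rank_factor rY.
have uQ : S'^T *m S \in unitmx.
  move: (fY) => /full_col_rankP; rewrite {2}YE -mulmxA mulmxA unitmx_mul.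
  by move=> /andP[].
have eL : L = lift_U Y *m (msqrt ((Y *m S)^T *m (Y *m S)) *m invmx (S'^T *m S)).
  by rewrite mulmxA onbK// {1}YE -(mulmxA L) mulmxK.
rewrite /lift_Y trmx_mul trmxK; move: sU eL.
move: (lift_U Y) (_ *m invmx _) => U K sU eL.
have UUL : U *m (U^T *m L) = L by rewrite {1}eL (mulmxA U^T) sU mul1mx -eL.
by rewrite YE (mulmxA U^T) mulmxA UUL.
Qed.

Lemma lift_Y_full Y : lift_dom Y -> \rank Y = r -> full_col_rank (lift_Y Y).
Proof.
move=> dY rY; apply/eqP; rewrite eqn_leq rank_leq_col/=.
by rewrite -{1}rY -{1}(lift_UK dY rY) -[\rank (lift_Y Y)]mxrank_tr mxrankM_maxr.
Qed.

Lemma lift_B_spd Y : lift_dom Y -> \rank Y = r -> spd (lift_B Y).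
Proof. by move=> dY rY; have /spd_gram_full/msqrtP[] := lift_Y_full dY rY. Qed.

Lemma lift_BK Y : lift_dom Y -> \rank Y = r ->
  lift_U Y *m lift_B Y *m (onb (lift_Y Y))^T = Y.
Proof.
move=> dY rY; rewrite -mulmxA -[lift_B Y](spd_sym (lift_B_spd dY rY)) -trmx_mul.
by rewrite onbK ?lift_UK//; exact: lift_Y_full.
Qed.

Section Ck.
Context {E : normedModType R} {k : nat} {D : set E} {s : E -> 'M[R]_(p1, p2)}.
Hypotheses (oD : open D) (sD : forall u, D u -> lift_dom (s u) /\ \rank (s u) = r).
Hypothesis cs : Ck k D s.

Lemma Ck_lift_U : Ck k D (fun u => lift_U (s u)).
Proof.
apply: Ck_onb => //; first by move=> u /sD[/full_col_rankP].
by apply: Ck_mulmx => //; exact: Ck_cst.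
Qed.

Lemma Ck_lift_Y : Ck k D (fun u => lift_Y (s u)).
Proof. by apply: Ck_mulmx => //; [exact: Ck_tr|exact: Ck_lift_U]. Qed.

Lemma Ck_lift_B : Ck k D (fun u => lift_B (s u)).
Proof.
apply: Ck_msqrt => //; first by move=> u /sD[dY rY]; apply/spd_gram_full/lift_Y_full.
by apply: Ck_mulmx => //; [apply: Ck_tr => //; exact: Ck_lift_Y|exact: Ck_lift_Y].
Qed.

Lemma Ck_lift_V : Ck k D (fun u => onb (lift_Y (s u))).
Proof.
by apply: Ck_onb => //; [move=> u /sD[]; exact: lift_Y_full|exact: Ck_lift_Y].
Qed.

End Ck.
End Lift.
End Orthonormalization.

(** * The three quotient geometries *)

Section WeightedTrace.
Context {R : realType} {p r : nat}.
Implicit Types (W : 'M[R]_r) (a b c : 'M[R]_(p, r)).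

Lemma wtraceDl W a b c (t : R) :
  \tr (W *m (t *: a + b)^T *m c) =
  t * \tr (W *m a^T *m c) + \tr (W *m b^T *m c).
Proof.
by rewrite linearD linearZ/= mulmxDr -scalemxAr mulmxDl -scalemxAl mxtraceD mxtraceZ.
Qed.

Lemma wtrace_sym W a b : W^T = W ->
  \tr (W *m a^T *m b) = \tr (W *m b^T *m a).
Proof.
move=> sW; rewrite -mxtrace_tr !trmx_mul trmxK sW mulmxA.
by rewrite -[W *m b^T *m a]mulmxA [RHS]mxtrace_mulC.
Qed.

Lemma wtrace_frob W a b : \tr (W *m a^T *m b) = \tr (a^T *m (1%:M *m b *m W)).
Proof. by rewrite mul1mx -mulmxA mxtrace_mulC mulmxA. Qed.

Lemma wtrace_ge0 W a : spd W -> 0 <= \tr (W *m a^T *m a).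
Proof. by move=> pW; rewrite wtrace_frob wfrob_ge0//; exact: spd_1. Qed.

Lemma wtrace_gt0 W a : spd W -> a != 0 -> 0 < \tr (W *m a^T *m a).
Proof. by move=> pW a0; rewrite wtrace_frob wfrob_gt0//; exact: spd_1. Qed.

End WeightedTrace.

(** * The quotient by GL(r) of pairs (L, R) *)

Section Geometry1.
Context {R : realType} {p1 p2 r : nat}.
Notation T1 := ('M[R]_(p1, r) * 'M[R]_(p2, r))%type.
Variables (W V : T1 -> 'M[R]_r).
Hypotheses (pW : forall x, tot1 x -> spd (W x)) (pV : forall x, tot1 x -> spd (V x)).
Hypotheses (cW : forall x, tot1 x -> {for x, continuous W}).
Hypotheses (cV : forall x, tot1 x -> {for x, continuous V}).
Notation Q1 := (quotient_geometry1 W V).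
Implicit Types x v w : T1.

(** The differential of (L, R) -> L R^T, shared by the first and third geometries. *)
Definition dmap_tr x w : 'M[R]_(p1, p2) := w.1 *m x.2^T + x.1 *m w.2^T.

Lemma dmap_trB x v w : dmap_tr x (v - w) = dmap_tr x v - dmap_tr x w.
Proof.
rewrite /dmap_tr -[(v - w).1]/(v.1 - w.1) -[(v - w).2]/(v.2 - w.2).
by rewrite mulmxBl linearB/= mulmxBr opprD addrACA.
Qed.

Lemma map1_derive (U : normedModType R) (g : U -> T1) (u v : U) w :
  has_derive g u v w -> has_derive (@map1 R p1 p2 r \o g) u v (dmap_tr (g u) w).
Proof.
move=> dg; apply: has_derive_mulmx; first exact: has_derive_fst.
by apply: has_derive_tr; exact: has_derive_snd.
Qed.

Lemma Ck_map1 (E : normedModType R) (D : set E) (s : E -> T1) k :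
  open D -> Ck k D s -> Ck k D (@map1 R p1 p2 r \o s).
Proof.
move=> oD cs; apply: Ck_mulmx => //; first exact: Ck_fst.
by apply: Ck_tr => //; exact: Ck_snd.
Qed.

Lemma rel1_map1 x y : tot1 x -> tot1 y -> rel1 x y <-> map1 x = map1 y.
Proof.
case: x y => [L S] [L' S'] [/= rL rS] [/= rL' rS']; rewrite /map1/=; split.
  move=> [M uM /= [-> ->]]; rewrite trmx_mul trmxK mulmxA mulmxK//.
move=> e; have uSS : S'^T *m S' \in unitmx by exact/full_col_rankP.
(* Forced by multiplying L S^T = L' S'^T on the right by S'. *)
pose M := S^T *m S' *m invmx (S'^T *m S').
have eL : L' = L *m M by rewrite /M !mulmxA e -(mulmxA L') mulmxK.
have uM : M \in unitmx.
  have /full_col_rankP := rL'; rewrite {2}eL mulmxA unitmx_mul.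
  by move=> /andP[].
exists M => //; congr pair => //=; apply: trmx_inj; rewrite trmx_mul trmxK.
apply: (can_inj (mulKmx uM)); rewrite mulKVmx//.
apply/eqP; rewrite -subr_eq0; apply/eqP/(full_col_rank_inj rL).
by rewrite mulmxBr mulmxA -eL e subrr.
Qed.

(** Multiplying wL S^T + L wS^T = 0 on the right by S determines Z, and cancelling L gives the
    second component. The vectors obtained are the infinitesimal action of GL(r). *)
Lemma dmap_tr_ker x w : tot1 x -> dmap_tr x w = 0 <->
  exists Z : 'M[R]_r, w = (x.1 *m Z, - (x.2 *m Z^T)).
Proof.
case: x w => [L S] [wL wS] [/= rL rS]; rewrite /dmap_tr/=; split.
  have uSS : S^T *m S \in unitmx by exact/full_col_rankP.
  move=> e; pose Z := - (wS^T *m S *m invmx (S^T *m S)).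
  have wLE : wL = L *m Z.
    rewrite /Z mulmxN !mulmxA; apply: (can_inj (mulmxK uSS)).
    rewrite mulNmx mulmxKV// mulmxA; apply/eqP.
    by rewrite -addr_eq0 -mulmxDl e mul0mx.
  exists Z; congr pair => //; apply/eqP; rewrite -addr_eq0; apply/eqP.
  apply: trmx_inj; rewrite linearD/= trmx_mul trmxK trmx0.
  by apply: (full_col_rank_inj rL); rewrite mulmxDr mulmxA -wLE addrC.
by move=> [Z [-> ->]]; rewrite linearN/= trmx_mul trmxK mulmxN mulmxA subrr.
Qed.

Lemma fiber1_tangent x Z : tot1 x ->
  tangent_space (qclass Q1 x) x (x.1 *m Z, - (x.2 *m Z^T)).
Proof.
case: x => [L S] [/= rL rS]; pose M (t : R) := t *: Z + 1%:M.
have dM : has_derive M 0 1 Z by exact: has_derive_line.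
have M0 : M 0 = 1%:M by rewrite /M scale0r add0r.
have uM : M 0 \in unitmx by rewrite M0 unitmx1.
apply/tangentP; exists (fun t => (L *m M t, S *m (invmx (M t))^T)); split.
- by rewrite M0 invmx1 trmx1 !mulmx1.
- have := near_unitmx (has_derive_cont dM) uM; apply: filterS => t ut.
  split; last by exists (M t).
  by split; apply: full_col_rankM => //; rewrite unitmx_tr unitmx_inv.
apply: has_derive_pair; first exact: has_derive_mull.
rewrite -mulmxN; apply: has_derive_mull; rewrite -linearN/=; apply: has_derive_tr.
by have := has_derive_invmx uM dM; rewrite M0 invmx1 mul1mx mulmx1.
Qed.

Lemma fiber1_ker x w : tot1 x -> tangent_space [set y | rel1 x y] x w ->
  dmap_tr x w = 0.
Proof.
move=> tx /tangentP[g [g0 rg dg]]; have := map1_derive dg; rewrite g0.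
move=> /has_derive_diff <-; apply: has_derive_diff.
have := has_derive_cst (map1 x) (0 : R) 1; apply: near_has_derive.
move: rg; apply: filterS => t [M uM gt].
by rewrite /map1 /= gt /= trmx_mul trmxK mulmxA mulmxK.
Qed.

(** With PL and PS the orthogonal projectors onto the column spaces of L and S, [tangent_rank] gives
    (1 - PL) v (1 - PS) = 0. Hence v = (1 - PL) v PS + PL v, and each summand is a term of
    [dmap_tr]. *)
Lemma embedded_tangent_map1 x (v : 'M[R]_(p1, p2)) : tot1 x ->
  tangent_space [set X : 'M[R]_(p1, p2) | \rank X = r] (map1 x) v ->
  exists w, dmap_tr x w = v.
Proof.
case: x => [L S] [/= rL rS] Tv.
have uL : L^T *m L \in unitmx by exact/full_col_rankP.
have uS : S^T *m S \in unitmx by exact/full_col_rankP.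
pose PL := L *m invmx (L^T *m L) *m L^T; pose PS := S *m invmx (S^T *m S) *m S^T.
have NL : (1%:M - PL) *m L = 0.
  by rewrite mulmxBl mul1mx /PL -(mulmxA _ L^T) mulmxKV// subrr.
have SN : S^T *m (1%:M - PS) = 0.
  by rewrite mulmxBr mulmx1 /PS !mulmxA mulmxV// mul1mx subrr.
have := tangent_rank rL rS NL SN Tv; rewrite mulmxBr mulmx1 => /subr0_eq e.
exists ((1%:M - PL) *m v *m (S *m invmx (S^T *m S)),
        (invmx (L^T *m L) *m L^T *m v)^T).
rewrite /dmap_tr/= trmxK -(mulmxA ((1%:M - PL) *m v)) -/PS -e.
by rewrite mulmxBl mul1mx !mulmxA subrK.
Qed.

Lemma rank_fibration1 : rank_fibration (r := r) Q1 (fun=> setT) (@map1 R p1 p2 r) dmap_tr.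
Proof.
have oT x w : tot1 x -> tangent_space (@tot1 R p1 p2 r) x w.
  move=> tx; apply/tangentP; exists (fun t => t *: w + x); split.
  - by rewrite scale0r add0r.
  - have dl := has_derive_line x w 0.
    have d1 := has_derive_fst dl; have d2 := has_derive_snd dl.
    have e1 := has_derive_mulmx (has_derive_tr d1) d1.
    have e2 := has_derive_mulmx (has_derive_tr d2) d2.
    have := near_unitmx (has_derive_cont e1) _.
    have := near_unitmx (has_derive_cont e2) _.
    rewrite scale0r add0r; case: tx => /full_col_rankP u1 /full_col_rankP u2.
    move=> /(_ u2) n2 /(_ u1); move: n2; apply: filterS2 => t.
    by move=> /full_col_rankP ? /full_col_rankP ?.
  exact: has_derive_line.
split=> //.
- exact: map1_derive.
- exact: dmap_trB.
- by move=> d D s k; exact: Ck_map1.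
- by move=> [L S] [/= rL rS]; exact: rank_mul_tr.
- move=> x w tx _ /(dmap_tr_ker _ tx)[Z ->]; exact: fiber1_tangent.
- move=> x v tx /(embedded_tangent_map1 tx)[w dw]; exists w => //.
  exact: oT.
- exact: rel1_map1.
move=> X /rank_factor[L [S [rL rS ->]]].
exists (lift_dom S), (fun Y => (lift_U S Y, lift_Y S Y)); split.
- exact: lift_dom_open.
- exact: lift_dom0.
- move=> Y dY rY; split; last exact: lift_UK.
  by split; [exact/stiefel_full/lift_U_stiefel|exact: lift_Y_full].
by move=> d D s k oD sD cs; apply: Ck_pair; [|exact: Ck_lift_U|exact: Ck_lift_Y].
Qed.

(** Coefficient of the vertical part of [v]: the Sylvester equation says that [hproj1 x v] is
    orthogonal to all vertical vectors. *)
Definition proj1_coef x v : 'M[R]_r :=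
  sylsol (x.1^T *m x.1) (W x) (V x) (x.2^T *m x.2)
    (x.1^T *m v.1 *m W x - V x *m v.2^T *m x.2).

Definition hproj1 x v : T1 :=
  (v.1 - x.1 *m proj1_coef x v, v.2 + x.2 *m (proj1_coef x v)^T).

Lemma proj1_spd x : tot1 x ->
  [/\ spd (x.1^T *m x.1), spd (W x), spd (V x) & spd (x.2^T *m x.2)].
Proof.
by move=> tx; have [r1 r2] := tx; split; [exact: spd_gram_full|exact: pW|exact: pV|
  exact: spd_gram_full].
Qed.

Lemma hor1P x v Z : tot1 x ->
  hor Q1 x (v.1 - x.1 *m Z, v.2 + x.2 *m Z^T) <-> Z = proj1_coef x v.
Proof.
move=> tx; have [q1 q2 q3 q4] := proj1_spd tx; have metE (Z' : 'M[R]_r) w : metric1 W V x (x.1 *m Z', - (x.2 *m Z'^T)) w =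
    \tr (Z'^T *m (x.1^T *m w.1 *m W x - V x *m w.2^T *m x.2)).
  rewrite /metric1 linearN mulmxN mulNmx raddfN/= !trmx_mul trmxK.
  rewrite [in RHS]mulmxBr raddfB/=.
  congr (_ - _); first by rewrite -!mulmxA mxtrace_mulC !mulmxA.
  rewrite -[RHS]mxtrace_tr !trmx_mul !trmxK (spd_sym q3) !mulmxA.
  by rewrite mxtrace_mulC !mulmxA mxtrace_mulC !mulmxA.
set w := (_, _).
have eqE : x.1^T *m w.1 *m W x - V x *m w.2^T *m x.2 = 0 <-> Z = proj1_coef x v.
  have wE : x.1^T *m w.1 *m W x - V x *m w.2^T *m x.2 =
     (x.1^T *m v.1 *m W x - V x *m v.2^T *m x.2) -
     (x.1^T *m x.1 *m Z *m W x + V x *m Z *m (x.2^T *m x.2)).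
    have -> : w.2^T = v.2^T + Z *m x.2^T by rewrite linearD/= trmx_mul trmxK.
    rewrite -[w.1]/(v.1 - x.1 *m Z) mulmxBr mulmxBl mulmxDr mulmxDl !mulmxA.
    by rewrite !opprD addrACA.
  rewrite wE; split=> [/subr0_eq/esym/sylsol_uniq->//|->].
  by rewrite sylsolP// subrr.
rewrite -eqE; split=> [hw|e eta Teta].
  (* Horizontality is tested against the vertical vector whose coefficient is the residual itself,
     which makes the squared norm of the residual vanish. *)
  apply: frob_eq0; rewrite -[X in \tr (X *m _)]trmxK trmxK.
  set A := _ - _; have := metE A w; rewrite hw//; apply: tangent_sub (fiber1_tangent A tx).
  by move=> y [].
have /(dmap_tr_ker _ tx)[Z' ->] := fiber1_ker tx Teta.
by rewrite metE e mulmx0 mxtrace0.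
Qed.

Lemma vertical1P x w : tot1 x -> vertical Q1 x w <->
  exists Z : 'M[R]_r, w = (x.1 *m Z, - (x.2 *m Z^T)).
Proof.
move=> tx; split=> [Tw|[Z ->]]; last exact: fiber1_tangent.
apply/dmap_tr_ker => //; apply: fiber1_ker => //; apply: tangent_sub Tw.
by move=> y [].
Qed.

Lemma hlift1 x v : tot1 x -> hlift Q1 x v = hproj1 x v.
Proof.
move=> tx; rewrite /hlift; case: xgetP => [w _ [hw /(vertical1P _ tx)[Z vw]]|].
  have wE : w = (v.1 - x.1 *m Z, v.2 + x.2 *m Z^T).
    have -> : w = v - (v - w) by rewrite subKr.
    by rewrite vw; congr pair; rewrite /= ?opprK.
  by rewrite wE /hproj1; rewrite wE in hw; move/(hor1P _ _ tx): hw => <-.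
move=> /(_ (hproj1 x v)); case; split; first exact/hor1P.
apply/vertical1P => //; exists (proj1_coef x v).
by congr pair; rewrite /= ?subKr// opprD addNKr.
Qed.

Lemma hproj1_linear x a v w : hproj1 x (a *: v + w) = a *: hproj1 x v + hproj1 x w.
Proof.
have coefE : proj1_coef x (a *: v + w) = a *: proj1_coef x v + proj1_coef x w.
  rewrite /proj1_coef /sylsol.
  set C := (X in mxvec X); have -> : C = a *: (x.1^T *m v.1 *m W x - V x *m v.2^T *m x.2)
      + (x.1^T *m w.1 *m W x - V x *m w.2^T *m x.2).
    have -> : C = x.1^T *m (a *: v.1 + w.1) *m W x - V x *m (a *: v.2^T + w.2^T) *m x.2.
      have trE : (a *: v.2 + w.2)^T = a *: v.2^T + w.2^T by rewrite linearP.
      by rewrite -trE.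
    rewrite !mulmxDr !mulmxDl -!scalemxAr -!scalemxAl.
    by rewrite scalerBr opprD addrACA.
  by rewrite linearP/= mulmxDl -scalemxAl linearP.
rewrite /hproj1 coefE; congr pair => /=.
  by rewrite mulmxDr -scalemxAr scalerBr opprD addrACA.
by rewrite linearP/= mulmxDr -scalemxAr scalerDr addrACA.
Qed.

Lemma metric1Dl x (a : R) v w u :
  metric1 W V x (a *: v + w) u = a * metric1 W V x v u + metric1 W V x w u.
Proof.
rewrite /metric1 -[(a *: v + w).1]/(a *: v.1 + w.1).
rewrite -[(a *: v + w).2]/(a *: v.2 + w.2).
by rewrite (wtraceDl _ v.1 w.1) (wtraceDl _ v.2 w.2) mulrDr addrACA.
Qed.

Lemma metric1_sym x v w : spd (W x) -> spd (V x) ->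
  metric1 W V x v w = metric1 W V x w v.
Proof.
move=> [sW _] [sV _]; rewrite /metric1 wtrace_sym//.
by rewrite [X in _ + X]wtrace_sym.
Qed.

Lemma metric1_gt0 x v : spd (W x) -> spd (V x) -> v != 0 ->
  0 < metric1 W V x v v.
Proof.
move=> p1x p2x ne; rewrite /metric1; have [e1|e1] := eqVneq v.1 0.
  rewrite ltr_wpDl ?wtrace_ge0// wtrace_gt0//; apply: contraNneq ne => e2.
  by rewrite [v]surjective_pairing e1 e2.
by rewrite ltr_wpDr ?wtrace_ge0// wtrace_gt0.
Qed.

Lemma Ck_metric1 (E : normedModType R) k (D : set E) (s a b : E -> T1) :
  open D -> Ck k D (fun u => W (s u)) -> Ck k D (fun u => V (s u)) ->
  Ck k D a -> Ck k D b -> Ck k D (fun u => metric1 W V (s u) (a u) (b u)).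
Proof.
move=> oD cWs cVs ca cb; apply: Ck_D => //; apply: Ck_mxtrace => //.
  apply: Ck_mulmx => //; last exact: Ck_fst.
  by apply: Ck_mulmx => //; apply: Ck_tr => //; exact: Ck_fst.
apply: Ck_mulmx => //; last exact: Ck_snd.
by apply: Ck_mulmx => //; apply: Ck_tr => //; exact: Ck_snd.
Qed.

Lemma lifted_metric1 : lifted_metric Q1 (fun=> setT)
  (fun x v w => metric1 W V x (hproj1 x v) (hproj1 x w)).
Proof.
split.
- by [].
- by move=> x v w tx _ _; rewrite !hlift1.
- by move=> x w a v v'; rewrite (hproj1_linear x a v v') metric1Dl.
- by move=> x v w tx; apply: metric1_sym; [exact: pW|exact: pV].
- move=> x v tx _; have [e|ne] := eqVneq (hproj1 x v) 0.
    left; apply/vertical1P => //; exists (proj1_coef x v).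
    have /eqP := congr1 fst e; rewrite subr_eq0 => /eqP <-.
    have /eqP := congr1 snd e; rewrite addr_eq0 => /eqP <-.
    by case: (v).
  by right; apply: metric1_gt0 => //; [exact: pW|exact: pV].
move=> d D s a b oD ts cs ca cb.
have cWs : Ck 0 D (fun u => W (s u)).
  apply/Ck_0P => u Du; apply: (@continuous_comp _ _ _ s W); last exact/cW/ts.
  exact: Ck_continuous cs Du.
have cVs : Ck 0 D (fun u => V (s u)).
  apply/Ck_0P => u Du; apply: (@continuous_comp _ _ _ s V); last exact/cV/ts.
  exact: Ck_continuous cs Du.
have c1 := Ck_fst oD cs; have c2 := Ck_snd oD cs.
have cT1 := Ck_tr oD c1; have cT2 := Ck_tr oD c2.
have cp e : Ck 0 D e -> Ck 0 D (fun u => hproj1 (s u) (e u)).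
  move=> ce; have ce1 := Ck_fst oD ce; have ce2 := Ck_snd oD ce.
  have cc : Ck 0 D (fun u => proj1_coef (s u) (e u)).
    apply: Ck_sylsol => //; first by move=> u /ts; exact: proj1_spd.
    - exact: Ck_mulmx.
    - exact: Ck_mulmx.
    apply: Ck_B => //; first by do 2?apply: Ck_mulmx.
    by do 2?apply: Ck_mulmx => //; exact: Ck_tr.
  apply: Ck_pair => //; first by apply: Ck_B => //; exact: Ck_mulmx.
  by apply: Ck_D => //; apply: Ck_mulmx => //; exact: Ck_tr.
by apply: Ck_metric1 => //; exact: cp.
Qed.

End Geometry1.

(** * The quotient by the orthogonal group of pairs (U, Y) *)

Section Geometry3.
Context {R : realType} {p1 p2 r : nat}.
Notation T3 := ('M[R]_(p1, r) * 'M[R]_(p2, r))%type.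
Variables (VY WY : 'M[R]_(p2, r) -> 'M[R]_r).
Hypotheses (pV : forall Y, full_col_rank Y -> spd (VY Y)).
Hypotheses (pW : forall Y, full_col_rank Y -> spd (WY Y)).
Hypotheses (cV : forall Y, full_col_rank Y -> {for Y, continuous VY}).
Hypotheses (cW : forall Y, full_col_rank Y -> {for Y, continuous WY}).
Notation Q3 := (@quotient_geometry3 R p1 p2 r VY WY).
Implicit Types x v w : T3.

Definition tan3 x w : Prop := stiefel_tan x.1 w.1.

Lemma total3_tot1 x : total Q3 x -> tot1 x.
Proof. by move=> [/stiefel_full]. Qed.

Lemma tangent_full p (Y w : 'M[R]_(p, r)) : full_col_rank Y ->
  \forall t \near (0 : R), full_col_rank (t *: w + Y).
Proof.
move=> /full_col_rankP uY; have dl := has_derive_line Y w 0.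
have e := has_derive_mulmx (has_derive_tr dl) dl.
have := near_unitmx (has_derive_cont e) _; rewrite scale0r add0r => /(_ uY).
by apply: filterS => t /full_col_rankP.
Qed.

Lemma tangent3P x w : total Q3 x -> tangent_space (total Q3) x w <-> tan3 x w.
Proof.
move=> [sU rY]; split=> [/tangentP[g [g0 tg dg]]|].
  apply/stiefel_tangent => //; apply/tangentP; exists (fun t => (g t).1).
  split; [by rewrite g0|by move: tg; apply: filterS => t []|exact: has_derive_fst].
move=> /(stiefel_tangent _ sU)/tangentP[g [g0 sg dg]].
apply/tangentP; exists (fun t => (g t, t *: w.2 + x.2)); split.
- by rewrite g0 scale0r add0r; case: (x).
- by move: sg (tangent_full w.2 rY); apply: filterS2 => t ? ?.
have := has_derive_pair dg (has_derive_line x.2 w.2 0).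
by case: (w).
Qed.

(** The [M] given by [rel1_map1] relates two Stiefel matrices, so it is orthogonal and its inverse
    transpose is [M] itself. *)
Lemma rel3_map3 x y : total Q3 x -> total Q3 y ->
  rel_eq Q3 x y <-> map3 x = map3 y.
Proof.
move=> tx ty; have [sU _] := tx; have [sU' _] := ty.
rewrite -[map3 x]/(map1 x) -[map3 y]/(map1 y).
have rE := rel1_map1 (total3_tot1 tx) (total3_tot1 ty).
split=> [[C oC yE]|/rE[M uM yE]].
  apply/rE; have [_ uC] := mulmx1_unit oC.
  exists C => //; rewrite yE; congr (_, _ *m _); apply: trmx_inj; rewrite trmxK.
  by apply: (can_inj (mulmxK uC)); rewrite mulVmx.
have oM : orthogonal_mx M.
  have := sU'; rewrite /stiefel yE/= trmx_mul mulmxA -[_ *m x.1^T *m x.1]mulmxA sU.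
  by rewrite mulmx1.
exists M => //; rewrite yE; congr (_, _ *m _).
apply: trmx_inj; rewrite trmxK; apply: (can_inj (mulmxK uM)).
by rewrite mulVmx.
Qed.

Lemma fiber3_tangent x (Om : 'M[R]_r) : total Q3 x -> Om^T = - Om ->
  vertical Q3 x (x.1 *m Om, x.2 *m Om).
Proof.
move=> [sU rY] /cayley_curve[C [C0 oC dC]].
apply/tangentP; exists (fun t => (x.1 *m C t, x.2 *m C t)); split.
- by rewrite C0 !mulmx1; case: (x).
- move: oC; apply: filterS => t oC; have [_ uC] := mulmx1_unit oC.
  split; last by exists (C t).
  split=> /=; last exact: full_col_rankM.
  by rewrite /stiefel trmx_mul mulmxA -[_ *m x.1^T *m x.1]mulmxA sU mulmx1.
by apply: has_derive_pair; exact: has_derive_mull.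
Qed.

(** Tangency to the Stiefel factor makes the [Z] of [dmap_tr_ker] skew, so that - Y Z^T = Y Z. *)
Lemma ker3 x w : total Q3 x -> tan3 x w -> dmap_tr x w = 0 ->
  exists2 Om : 'M[R]_r, Om^T = - Om & w = (x.1 *m Om, x.2 *m Om).
Proof.
move=> tx tw /(dmap_tr_ker _ (total3_tot1 tx))[Z wE]; have [sU _] := tx.
have skZ : Z^T = - Z.
  by have := stiefel_tan_skew tw; rewrite wE/= mulmxA sU mul1mx.
by exists Z => //; rewrite wE skZ mulmxN opprK.
Qed.

Lemma rank_fibration3 :
  rank_fibration (r := r) Q3 tan3 (@map3 R p1 p2 r) (@dmap_tr R p1 p2 r).
Proof.
split.
- exact: map1_derive.
- exact: dmap_trB.
- by move=> d D s k; exact: Ck_map1.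
- by move=> x [sU rY]; apply: rank_mul_tr => //; exact: stiefel_full.
- by move=> x v w; exact: stiefel_tanB.
- move=> x w tx tw /(ker3 tx tw)[Om skO ->]; exact: fiber3_tangent.
- move=> x v tx /(embedded_tangent_map1 (total3_tot1 tx))[w0 <-].
  (* An arbitrary preimage [w0] is corrected by the kernel vector with this [Z]; its first component
     becomes orthogonal to [x.1], hence tangent to the Stiefel manifold. *)
  pose Z := - (x.1^T *m w0.1); have [sU _] := tx.
  have dZ : dmap_tr x (x.1 *m Z, - (x.2 *m Z^T)) = 0.
    by apply/dmap_tr_ker; [exact: total3_tot1|exists Z].
  exists (w0 - - (x.1 *m Z, - (x.2 *m Z^T))); last first.
    by rewrite dmap_trB -[- (x.1 *m Z, _)]sub0r dmap_trB dZ subr0 {2}/dmap_tr/=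
       mul0mx trmx0 mulmx0 addr0 subr0.
  apply/tangent3P => //; rewrite /tan3 /stiefel_tan opprK -[(w0 + _).1]/(w0.1 + x.1 *m Z).
  have UZ : x.1^T *m (w0.1 + x.1 *m Z) = 0 by rewrite mulmxDr mulmxA sU mul1mx subrr.
  by rewrite UZ add0r; apply: trmx_inj; rewrite trmx_mul trmxK UZ trmx0.
- exact: rel3_map3.
move=> X /rank_factor[L [S [rL rS ->]]].
exists (lift_dom S), (fun Y => (lift_U S Y, lift_Y S Y)); split.
- exact: lift_dom_open.
- exact: lift_dom0.
- move=> Y dY rY; split; last exact: lift_UK.
  by split; [exact: lift_U_stiefel|exact: lift_Y_full].
by move=> d D s k oD sD cs; apply: Ck_pair; [|exact: Ck_lift_U|exact: Ck_lift_Y].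
Qed.

(** Removes the fiber direction with skew coefficient [x.1^T *m v.1], leaving a first component
    orthogonal to [x.1]. *)
Definition hproj3 x v : T3 :=
  (v.1 - x.1 *m (x.1^T *m v.1), v.2 - x.2 *m (x.1^T *m v.1)).

Lemma hlift3 x v : total Q3 x -> tan3 x v -> hlift Q3 x v = hproj3 x v.
Proof.
move=> tx tv; have [sU rY] := tx; rewrite /hlift.
case: xgetP => [w _ [[Up [D [[_ UUp] wD]]] vw]|].
  have Tvw : tan3 x (v - w).
    by apply/tangent3P => //; apply: tangent_sub vw => y [].
  have [Om skO vwE] := ker3 tx Tvw (vertical_ker rank_fibration3 tx vw).
  (* Any horizontal [w] has first component orthogonal to [x.1], which forces the vertical part of
     [v]. *)
  have OmE : x.1^T *m v.1 = Om.
    have e1 : v.1 - w.1 = x.1 *m Om := congr1 fst vwE.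
    have -> : v.1 = x.1 *m Om + w.1 by rewrite -e1 subrK.
    by rewrite wD mulmxDr !mulmxA UUp mul0mx addr0 sU mul1mx.
  by rewrite /hproj3 OmE -[w](subKr v) vwE.
have [Up [oUp span]] := orth_compl_span sU.
move=> /(_ (hproj3 x v)); case; split.
  have [|D DE] := span _ (hproj3 x v).1.
    by rewrite /= mulmxBr [X in _ - X]mulmxA sU mul1mx subrr.
  by exists Up, D.
have -> : v - hproj3 x v = (x.1 *m (x.1^T *m v.1), x.2 *m (x.1^T *m v.1)).
  by congr pair; rewrite /= subKr.
by apply: fiber3_tangent => //; exact: stiefel_tan_skew.
Qed.

Lemma hproj3_linear x a v w : hproj3 x (a *: v + w) = a *: hproj3 x v + hproj3 x w.
Proof.
rewrite /hproj3 -[(a *: v + w).1]/(a *: v.1 + w.1) -[(a *: v + w).2]/(a *: v.2 + w.2).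
rewrite !mulmxDr -!scalemxAr; congr pair.
  by rewrite /= scalerBr opprD addrACA.
by rewrite /= scalerBr opprD addrACA.
Qed.

(** The metric of [Q3] is [metric1] with weights that read the second component only, so its algebra
    is shared with the first geometry. *)
Lemma lifted_metric3 : lifted_metric Q3 tan3
  (fun x v w => metric1 (VY \o snd) (WY \o snd) x (hproj3 x v) (hproj3 x w)).
Proof.
split.
- by move=> x v tx /(tangent3P _ tx).
- by move=> x v w tx tv tw; rewrite !hlift3.
- by move=> x w a v v'; rewrite (hproj3_linear x a v v') metric1Dl.
- by move=> x v w [_ rY]; apply: metric1_sym; [exact: pV|exact: pW].
- move=> x v tx tv; have [_ rY] := tx; have [e|ne] := eqVneq (hproj3 x v) 0.
    left; have -> : v = (x.1 *m (x.1^T *m v.1), x.2 *m (x.1^T *m v.1)).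
      have /eqP := congr1 fst e; rewrite subr_eq0 => /eqP <-.
      have /eqP := congr1 snd e; rewrite subr_eq0 => /eqP <-.
      by case: (v).
    by apply: fiber3_tangent => //; exact: stiefel_tan_skew.
  by right; apply: metric1_gt0 => //; [exact: pV|exact: pW].
move=> d D s a b oD ts cs ca cb; have c1 := Ck_fst oD cs; have c2 := Ck_snd oD cs.
have cVs : Ck 0 D (fun u => VY (s u).2).
  apply/Ck_0P => u Du; have [_ rY] := ts _ Du.
  apply: (@continuous_comp _ _ _ (fun u => (s u).2) VY); last exact: cV.
  exact: Ck_continuous c2 Du.
have cWs : Ck 0 D (fun u => WY (s u).2).
  apply/Ck_0P => u Du; have [_ rY] := ts _ Du.
  apply: (@continuous_comp _ _ _ (fun u => (s u).2) WY); last exact: cW.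
  exact: Ck_continuous c2 Du.
have cp e : Ck 0 D e -> Ck 0 D (fun u => hproj3 (s u) (e u)).
  move=> ce; have ce1 := Ck_fst oD ce; have ce2 := Ck_snd oD ce.
  have cO : Ck 0 D (fun u => (s u).1^T *m (e u).1).
    by apply: Ck_mulmx => //; exact: Ck_tr.
  by apply: Ck_pair => //; apply: Ck_B => //; exact: Ck_mulmx.
by apply: Ck_metric1 => //; exact: cp.
Qed.

End Geometry3.

(** * The quotient by the orthogonal group of triples (U, B, V) *)

Section Geometry2.
Context {R : realType} {p1 p2 r : nat}.
Notation T2 := ('M[R]_(p1, r) * 'M[R]_(r, r) * 'M[R]_(p2, r))%type.
Notation Q2 := (@quotient_geometry2 R p1 p2 r).
Implicit Types x v w : T2.

Definition tan2 x w : Prop :=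
  [/\ stiefel_tan x.1.1 w.1.1, w.1.2^T = w.1.2 & stiefel_tan x.2 w.2].

Definition dmap2 x w : 'M[R]_(p1, p2) :=
  (w.1.1 *m x.1.2 + x.1.1 *m w.1.2) *m x.2^T + x.1.1 *m x.1.2 *m w.2^T.

(** For skew [Om], the infinitesimal action of the orthogonal group: the velocity of (U C, C^T B C,
    V C) as C leaves the identity with velocity [Om]. *)
Definition fib2 x (Om : 'M[R]_r) : T2 :=
  (x.1.1 *m Om, x.1.2 *m Om - Om *m x.1.2, x.2 *m Om).

Lemma tan2B x v w : tan2 x v -> tan2 x w -> tan2 x (v - w).
Proof.
move=> [v1 v2 v3] [w1 w2 w3]; split; try exact: stiefel_tanB.
by rewrite -[(v - w).1.2]/(v.1.2 - w.1.2) linearB/= v2 w2.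
Qed.

Lemma map2_derive (U : normedModType R) (g : U -> T2) (u v : U) w :
  has_derive g u v w -> has_derive (@map2 R p1 p2 r \o g) u v (dmap2 (g u) w).
Proof.
move=> dg; have d1 := has_derive_fst dg.
apply: has_derive_mulmx.
  by apply: has_derive_mulmx; [exact: has_derive_fst|exact: has_derive_snd].
by apply: has_derive_tr; exact: has_derive_snd.
Qed.

Lemma dmap2B x v w : dmap2 x (v - w) = dmap2 x v - dmap2 x w.
Proof.
rewrite /dmap2 -[(v - w).1.1]/(v.1.1 - w.1.1) -[(v - w).1.2]/(v.1.2 - w.1.2).
rewrite -[(v - w).2]/(v.2 - w.2).
have -> : (v.2 - w.2)^T = v.2^T - w.2^T by rewrite linearB.
rewrite !(mulmxBl, mulmxBr, mulmxDl).
by apply/matrixP => i j; rewrite !mxE; ring.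
Qed.

Lemma Ck_map2 (E : normedModType R) (D : set E) (s : E -> T2) k :
  open D -> Ck k D s -> Ck k D (@map2 R p1 p2 r \o s).
Proof.
move=> oD cs; have c1 := Ck_fst oD cs; apply: Ck_mulmx => //.
  by apply: Ck_mulmx => //; [exact: Ck_fst|exact: Ck_snd].
by apply: Ck_tr => //; exact: Ck_snd.
Qed.

Lemma tangent2P x w : total Q2 x -> tangent_space (total Q2) x w <-> tan2 x w.
Proof.
move=> [sU pB sV]; split=> [/tangentP[g [g0 tg dg]]|].
  have d1 := has_derive_fst dg; have dB := has_derive_snd d1; split.
  - apply/stiefel_tangent => //; apply/tangentP; exists (fun t => (g t).1.1).
    split; [by rewrite g0|by move: tg; apply: filterS => t []|exact: has_derive_fst].
  - rewrite -(has_derive_diff (has_derive_tr dB)).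
    apply: has_derive_diff; move: dB; apply: near_has_derive.
    by move: tg; apply: filterS => t [_ [-> _]].
  apply/stiefel_tangent => //; apply/tangentP; exists (fun t => (g t).2).
  split; [by rewrite g0|by move: tg; apply: filterS => t []|exact: has_derive_snd].
move=> [/(stiefel_tangent _ sU)/tangentP[g [g0 sg dg]] symw].
move=> /(stiefel_tangent _ sV)/tangentP[g' [g'0 sg' dg']].
(* B moves by the congruence M^T B M with M = 1 + t Z, which preserves positive definiteness. This Z
   solves Z^T B + B Z = wB, wB being the middle component of [w]. *)
have uB := spd_unit pB; pose Z := 2^-1 *: (invmx x.1.2 *m w.1.2).
have dZ := has_derive_line 1%:M Z 0; pose M (t : R) := t *: Z + 1%:M.
have M0 : M 0 = 1%:M by rewrite /M scale0r add0r.
have uM : M 0 \in unitmx by rewrite M0 unitmx1.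
apply/tangentP; exists (fun t => (g t, (M t)^T *m x.1.2 *m M t, g' t)); split.
- by rewrite M0 trmx1 mul1mx mulmx1 g0 g'0; case: (x) => -[].
- have uMt := near_unitmx (has_derive_cont dZ) uM.
  by move: sg sg' uMt; apply: filterS3 => t ? ? ?; split => //; exact: spd_congr.
have dB : has_derive (fun t => (M t)^T *m x.1.2 *m M t) 0 1 w.1.2.
  have := has_derive_mulmx (has_derive_mulr x.1.2 (has_derive_tr dZ)) dZ.
  move=> /has_derive_eq; apply; rewrite -/(M 0) M0 trmx1 mul1mx mulmx1.
  rewrite /Z linearZ/= trmx_mul trmx_inv (spd_sym pB) symw -scalemxAl -scalemxAr.
  rewrite mulmxKV// mulKVmx// -scalerDl (_ : 2^-1 + 2^-1 = 1) ?scale1r//.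
  by field.
by have := has_derive_pair (has_derive_pair dg dB) dg'; case: (w) => -[].
Qed.

Lemma orthogonal_mulC (C : 'M[R]_r) : orthogonal_mx C -> C *m C^T = 1%:M.
Proof. by move=> /mulmx1C. Qed.

Lemma stiefelM p (U : 'M[R]_(p, r)) (C : 'M[R]_r) :
  stiefel U -> orthogonal_mx C -> stiefel (U *m C).
Proof.
by move=> sU oC; rewrite /stiefel trmx_mul mulmxA -[_ *m U^T *m U]mulmxA sU mulmx1.
Qed.

Lemma rel2_map2 x y : total Q2 x -> total Q2 y ->
  rel_eq Q2 x y <-> map2 x = map2 y.
Proof.
case: x y => [[U B] V] [[U' B'] V'] [/= sU pB sV] [/= sU' pB' sV'].
rewrite /map2/=; split.
  move=> [C oC [-> -> ->]]; have CC := orthogonal_mulC oC.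
  by rewrite trmx_mul !mulmxA -(mulmxA U C) CC mulmx1 -(mulmxA (U *m B) C) CC mulmx1.
move=> e; have uB := spd_unit pB; have uB' := spd_unit pB'.
(* Forced by multiplying U B V^T = U' B' V'^T on the right by V'. *)
pose C := B *m V^T *m V' *m invmx B'.
have eU : U' = U *m C.
  by rewrite /C !mulmxA e -(mulmxA _ V'^T) sV' mulmx1 mulmxK.
clearbody C.
have oC : orthogonal_mx C.
  by move: sU'; rewrite /stiefel eU trmx_mul mulmxA -(mulmxA _ U^T) sU mulmx1.
have CC := orthogonal_mulC oC.
have eBV : B *m V^T = C *m B' *m V'^T.
  rewrite -[LHS]mul1mx -sU -!mulmxA (mulmxA U) e eU !mulmxA sU mul1mx.
  by [].
(* Both sides are positive definite with square (B V^T)(B V^T)^T, so they agree by uniqueness of the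
   square root. *)
have eB : B = C *m B' *m C^T.
  apply: sqrt_uniq => //.
    by rewrite -{1}[C]trmxK; apply: spd_congr; rewrite // unitmx_tr; have [] := mulmx1_unit oC.
  rewrite !mulmxA -(mulmxA (C *m B')) oC mulmx1.
  have <- : B *m V^T *m (B *m V^T)^T = B *m B.
    by rewrite trmx_mul trmxK (spd_sym pB) mulmxA -(mulmxA B) sV mulmx1.
  rewrite eBV trmx_mul trmxK trmx_mul (spd_sym pB') !mulmxA.
  by rewrite -(mulmxA _ V'^T) sV' mulmx1.
exists C => //; congr (_, _, _) => //=.
  by rewrite eB !mulmxA oC mul1mx -mulmxA oC mulmx1.
have uCB : C *m B' \in unitmx by rewrite unitmx_mul uB' andbT; have [] := mulmx1_unit CC.
apply: trmx_inj; rewrite trmx_mul; apply: (can_inj (mulKmx uCB)).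
by rewrite -eBV mulmxA -eB.
Qed.

Lemma fiber2_tangent x (Om : 'M[R]_r) : total Q2 x -> Om^T = - Om ->
  vertical Q2 x (fib2 x Om).
Proof.
move=> [sU pB sV] skO; have [C [C0 oC dC]] := cayley_curve skO.
apply/tangentP; exists (fun t => (x.1.1 *m C t, (C t)^T *m x.1.2 *m C t, x.2 *m C t)).
split.
- by rewrite C0 trmx1 mul1mx !mulmx1; case: (x) => -[].
- move: oC; apply: filterS => t oC; have [_ uC] := mulmx1_unit oC.
  by split; [split; [exact: stiefelM|exact: spd_congr|exact: stiefelM]|exists (C t)].
have dB : has_derive (fun t => (C t)^T *m x.1.2 *m C t) 0 1 (x.1.2 *m Om - Om *m x.1.2).
  have := has_derive_mulmx (has_derive_mulr x.1.2 (has_derive_tr dC)) dC.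
  move=> /has_derive_eq; apply; rewrite C0 trmx1 mul1mx mulmx1 skO mulNmx.
  by rewrite addrC.
by apply: has_derive_pair; [apply: has_derive_pair|]; rewrite //; exact: has_derive_mull.
Qed.

(** With O1 = U^T wU and O2 = V^T wV, projecting the equation gives O1 B + wB = B O2. Subtracting
    its transpose yields a Sylvester equation for O1 - O2, so U and V rotate alike; cancelling B
    then recovers the components. *)
Lemma ker2 x w : total Q2 x -> tan2 x w -> dmap2 x w = 0 ->
  exists2 Om : 'M[R]_r, Om^T = - Om & w = fib2 x Om.
Proof.
case: x w => [[U B] V] [[wU wB] wV] [/= sU pB sV] [/= tU symw tV].
rewrite /dmap2/= => e; have uB := spd_unit pB; have symB := spd_sym pB.
pose O1 := U^T *m wU; pose O2 := V^T *m wV.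
have sk1 : O1^T = - O1 by exact: stiefel_tan_skew.
have sk2 : O2^T = - O2 by exact: stiefel_tan_skew.
have eV : wU *m B + U *m wB = U *m B *m O2.
  have := congr1 (mulmx^~ V) e; rewrite mul0mx mulmxDl -(mulmxA _ V^T) sV mulmx1.
  rewrite -(mulmxA _ wV^T) -[wV^T *m V]trmxK trmx_mul trmxK -/O2 sk2.
  by rewrite mulmxN => /subr0_eq.
have eU : (O1 *m B + wB) *m V^T = - (B *m wV^T).
  have := congr1 (mulmx U^T) e; rewrite mulmx0 mulmxDr !mulmxA sU mul1mx.
  by rewrite mulmxDr !mulmxA sU mul1mx => /eqP; rewrite addr_eq0 => /eqP.
have e12 : O1 *m B + wB = B *m O2.
  have := congr1 (mulmx U^T) eV; rewrite mulmxDr !mulmxA sU !mul1mx.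
  by [].
clearbody O1 O2.
have e21 : wB - B *m O1 = - (O2 *m B).
  have := congr1 trmx e12; rewrite linearD/= !trmx_mul sk1 sk2 symB symw.
  by rewrite mulmxN mulNmx addrC.
have O12 : O1 = O2.
  apply/subr0_eq; have q1 := @spd_1 R r; apply: (syl_eq0 q1 pB pB q1).
  rewrite mul1mx mulmx1 mulmxBl mulmxBr -e12.
  have -> : O2 *m B = B *m O1 - wB by rewrite -(opprK (O2 *m B)) -e21 opprB.
  by apply/matrixP => i j; rewrite !mxE; ring.
exists O1 => //; rewrite /fib2/=; congr (_, _, _).
- apply: (can_inj (mulmxK uB)); rewrite -[LHS](addrK (U *m wB)) eV -O12 -mulmxA.
  by rewrite -mulmxBr O12 -e12 addrK O12 mulmxA.
- by rewrite O12 -e12 O12 addrC addKr.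
apply: trmx_inj; rewrite trmx_mul sk1 mulNmx; apply: (can_inj (mulKmx uB)).
by rewrite -[LHS]opprK -eU e12 O12 mulmxN mulmxA.
Qed.

Lemma rank_map2 x : total Q2 x -> \rank (map2 x) = r.
Proof.
move=> [sU pB sV]; apply: rank_mul_tr; last exact: stiefel_full.
by apply: full_col_rankM; [exact: stiefel_full|exact: spd_unit].
Qed.

Lemma embedded_tangent_map2 x (v : 'M[R]_(p1, p2)) : total Q2 x ->
  tangent_space [set X : 'M[R]_(p1, p2) | \rank X = r] (map2 x) v ->
  exists2 w, tan2 x w & dmap2 x w = v.
Proof.
case: x => [[U B] V] [/= sU pB sV] Tv.
have uB := spd_unit pB; have symB := spd_sym pB; have p1' := @spd_1 R r.
pose N := 1%:M - U *m U^T; pose N' := 1%:M - V *m V^T.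
have UN : U^T *m N = 0 by rewrite mulmxBr mulmx1 mulmxA sU mul1mx subrr.
have NU : N *m U = 0 by rewrite mulmxBl mul1mx -mulmxA sU mulmx1 subrr.
have VN : V^T *m N' = 0 by rewrite mulmxBr mulmx1 mulmxA sV mul1mx subrr.
have NvN : N *m v *m N' = 0.
  apply: tangent_rank Tv; rewrite ?VN//.
  - by apply: full_col_rankM => //; exact: stiefel_full.
  - exact: stiefel_full.
  by rewrite mulmxA NU mul0mx.
(* The whole rotation is put into U. The core M must split as Om B + wB, and wB = M - Om B is
   symmetric exactly when the skew [Om] satisfies Om B + B Om = M - M^T. *)
pose M := U^T *m v *m V; pose Om := sylsol 1%:M B B 1%:M (M - M^T).
have eOm : Om *m B + B *m Om = M - M^T.
  by have := sylsolP (M - M^T) p1' pB pB p1'; rewrite mul1mx mulmx1.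
have skO : Om^T = - Om.
  apply: oppr_inj; rewrite opprK; apply: sylsol_uniq => //.
  rewrite mul1mx mulmx1 mulNmx mulmxN -opprD -[M - M^T]opprK; congr (- _).
  rewrite opprB -[M in RHS]trmxK -[in RHS](linearB trmx M^T^T)/= trmxK -eOm.
  by rewrite linearD/= (trmx_mul Om) (trmx_mul B) symB addrC.
pose wB := M - Om *m B.
have symw : wB^T = wB.
  rewrite /wB linearB/= (trmx_mul Om) symB skO mulmxN opprK.
  by apply/eqP; rewrite eq_sym subr_eq -addrA [B *m _ + _]addrC eOm addrC subrK.
exists (N *m v *m V *m invmx B + U *m Om, wB, N'^T *m v^T *m U *m invmx B).
  split=> //=; apply: skew_stiefel_tan.
    by rewrite mulmxDr !mulmxA UN !mul0mx add0r sU mul1mx.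
  suff -> : V^T *m (N'^T *m v^T *m U *m invmx B) = 0 by rewrite trmx0 oppr0.
  have -> : N'^T = N' by rewrite /N' linearB/= trmx1 trmx_mul trmxK.
  by rewrite !mulmxA VN !mul0mx.
have e1 : (N *m v *m V *m invmx B + U *m Om) *m B + U *m wB = N *m v *m V + U *m M.
  rewrite mulmxDl mulmxKV// -addrA -(mulmxA U Om) -mulmxDr /wB.
  by rewrite [Om *m B + _]addrC subrK.
have e2 : (N'^T *m v^T *m U *m invmx B)^T = invmx B *m (U^T *m v *m N').
  by rewrite !trmx_mul !trmxK trmx_inv symB !mulmxA.
have NvE : N *m v *m V *m V^T = N *m v.
  apply/esym/eqP; rewrite -subr_eq0 -mulmxA -{1}[N *m v]mulmx1 -mulmxBr.
  by rewrite NvN.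
rewrite /dmap2/= e1 e2 mulmxDl NvE (mulmxA _ (invmx B)) mulmxK//.
rewrite /M /N /N' mulmxBl mul1mx !mulmxBr mulmx1 !mulmxA.
by apply/matrixP => i j; rewrite !mxE; ring.
Qed.

Lemma rank_fibration2 :
  rank_fibration (r := r) Q2 tan2 (@map2 R p1 p2 r) dmap2.
Proof.
split.
- exact: map2_derive.
- exact: dmap2B.
- by move=> d D s k; exact: Ck_map2.
- exact: rank_map2.
- exact: tan2B.
- move=> x w tx tw /(ker2 tx tw)[Om skO ->]; exact: fiber2_tangent.
- move=> x v tx /(embedded_tangent_map2 tx)[w tw dw]; exists w => //.
  exact/tangent2P.
- exact: rel2_map2.
move=> X /rank_factor[L [S [rL rS ->]]].
exists (lift_dom S), (fun Y => (lift_U S Y, lift_B S Y, onb (lift_Y S Y))); split.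
- exact: lift_dom_open.
- exact: lift_dom0.
- move=> Y dY rY; split; last exact: lift_BK.
  split; [exact: lift_U_stiefel|exact: lift_B_spd|].
  by apply: onb_stiefel; exact: lift_Y_full.
move=> d D s k oD sD cs; apply: Ck_pair => //; last exact: Ck_lift_V.
by apply: Ck_pair => //; [exact: Ck_lift_U|exact: Ck_lift_B].
Qed.

(** Horizontality asks the rotations of U and V to be opposite. Subtracting the same Z from both
    achieves this when Z is their mean. *)
Definition proj2_coef x v : 'M[R]_r :=
  2^-1 *: (x.1.1^T *m v.1.1 + x.2^T *m v.2).

Definition hproj2 x v : T2 := v - fib2 x (proj2_coef x v).

Lemma proj2_coef_skew x v : tan2 x v -> (proj2_coef x v)^T = - proj2_coef x v.
Proof.
move=> [/stiefel_tan_skew e1 _ /stiefel_tan_skew e2].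
by rewrite /proj2_coef linearZ/= linearD/= e1 e2 -opprD scalerN.
Qed.

Lemma hlift2 x v : total Q2 x -> tan2 x v -> hlift Q2 x v = hproj2 x v.
Proof.
move=> tx tv; have [sU pB sV] := tx; rewrite /hlift.
case: xgetP => [w _ [[Up [Vp [D1 [D2 [Om]]]]]]|].
  move=> [[[_ UUp] [_ VVp]] skOm w1 _ w2] vw.
  have Tvw : tan2 x (v - w).
    by apply/tangent2P => //; apply: tangent_sub vw => y [].
  have [Z skZ vwE] := ker2 tx Tvw (vertical_ker rank_fibration2 tx vw).
  have e1 : v.1.1 - w.1.1 = x.1.1 *m Z := congr1 (fun y => y.1.1) vwE.
  have e2 : v.2 - w.2 = x.2 *m Z := congr1 snd vwE.
  have ZE : proj2_coef x v = Z.
    rewrite /proj2_coef; have -> : v.1.1 = x.1.1 *m Z + w.1.1 by rewrite -e1 subrK.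
    have -> : v.2 = x.2 *m Z + w.2 by rewrite -e2 subrK.
    rewrite w1 w2 !mulmxDr mulmxN !mulmxA UUp VVp sU sV !mul0mx !mul1mx !add0r.
    rewrite addrACA subrr addr0 scalerDr -scalerDl (_ : 2^-1 + 2^-1 = 1) ?scale1r//.
    by field.
  by rewrite /hproj2 ZE -vwE subKr.
have [Up [oUp spanU]] := orth_compl_span sU.
have [Vp [oVp spanV]] := orth_compl_span sV.
move=> /(_ (hproj2 x v)); case; split; last first.
  by rewrite /hproj2 subKr; apply: fiber2_tangent => //; exact: proj2_coef_skew.
set Z := proj2_coef x v; have skZ : Z^T = - Z := proj2_coef_skew tv.
have [tU symv tV] := tv.
have h1 : (hproj2 x v).1.1 = v.1.1 - x.1.1 *m Z by [].
have h2 : (hproj2 x v).2 = v.2 - x.2 *m Z by [].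
(* After removal of the mean rotation, U keeps [Om] and V keeps its opposite; the rest of each
   component lies in the orthogonal complement. *)
pose Om := x.1.1^T *m v.1.1 - Z.
have OmE : x.2^T *m v.2 - Z = - Om.
  rewrite /Om opprB; apply/eqP; rewrite subr_eq addrAC eq_sym subr_eq.
  rewrite [_ + x.1.1^T *m _]addrC; apply/eqP.
  rewrite /Z /proj2_coef -scalerDl (_ : 2^-1 + 2^-1 = 1) ?scale1r//.
  by field.
have [|D1 eD1] := spanU _ (v.1.1 - x.1.1 *m Z - x.1.1 *m Om).
  by rewrite !mulmxBr !mulmxA sU !mul1mx subrr.
have [|D2 eD2] := spanV _ (v.2 - x.2 *m Z + x.2 *m Om).
  by rewrite mulmxDr mulmxBr !mulmxA sV !mul1mx OmE addNr.
exists Up, Vp, D1, D2, Om; split.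
- by split.
- by rewrite /Om linearB/= stiefel_tan_skew// skZ -opprD opprK.
- by rewrite h1 -eD1 subrK.
- rewrite /symmetric_mx -[(hproj2 x v).1.2]/(v.1.2 - (x.1.2 *m Z - Z *m x.1.2)).
  have -> : x.1.2 *m Z - Z *m x.1.2 = x.1.2 *m Z + (x.1.2 *m Z)^T.
    by rewrite trmx_mul skZ (spd_sym pB) mulNmx.
  by rewrite linearB/= linearD/= trmxK symv [_^T + _]addrC.
by rewrite h2 -eD2 addrK.
Qed.

Lemma hproj2_linear x a v w : hproj2 x (a *: v + w) = a *: hproj2 x v + hproj2 x w.
Proof.
have cE : proj2_coef x (a *: v + w) = a *: proj2_coef x v + proj2_coef x w.
  rewrite /proj2_coef -[(a *: v + w).1.1]/(a *: v.1.1 + w.1.1).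
  rewrite -[(a *: v + w).2]/(a *: v.2 + w.2) !mulmxDr -!scalemxAr.
  rewrite addrACA -scalerDr [LHS]scalerDr; congr (_ + _).
  by rewrite !scalerA mulrC.
have fE Z Z' : fib2 x (a *: Z + Z') = a *: fib2 x Z + fib2 x Z'.
  rewrite /fib2 !mulmxDr mulmxDl -!scalemxAr -scalemxAl; congr (_, _, _).
  by rewrite /= scalerBr opprD addrACA.
by rewrite /hproj2 cE fE scalerBr opprD addrACA.
Qed.

Lemma metric2E x v w : metric Q2 x v w = \tr (v.1.1^T *m w.1.1) +
  \tr (invmx x.1.2 *m v.1.2 *m invmx x.1.2 *m w.1.2) + \tr (v.2^T *m w.2).
Proof. by []. Qed.

Lemma metric2_sym x v w : metric Q2 x v w = metric Q2 x w v.
Proof.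
rewrite !metric2E (frobC v.1.1) (frobC v.2); congr (_ + _ + _).
rewrite -(mulmxA _ (invmx x.1.2)) mxtrace_mulC.
by rewrite !mulmxA.
Qed.

Lemma metric2Dl x a v w u :
  metric Q2 x (a *: v + w) u = a * metric Q2 x v u + metric Q2 x w u.
Proof.
rewrite !metric2E -[(a *: v + w).1.1]/(a *: v.1.1 + w.1.1).
rewrite -[(a *: v + w).2]/(a *: v.2 + w.2) -[(a *: v + w).1.2]/(a *: v.1.2 + w.1.2).
have trE p (b c : 'M[R]_(p, r)) : (a *: b + c)^T = a *: b^T + c^T by rewrite linearP.
rewrite !trE !mulmxDr !mulmxDl -!scalemxAr -!scalemxAl !mxtraceD !mxtraceZ.
by ring.
Qed.

Lemma lifted_metric2 : lifted_metric Q2 tan2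
  (fun x v w => metric Q2 x (hproj2 x v) (hproj2 x w)).
Proof.
split.
- by move=> x v tx /(tangent2P _ tx).
- by move=> x v w tx tv tw; rewrite !hlift2.
- by move=> x w a v v'; rewrite (hproj2_linear x a v v') metric2Dl.
- by move=> x v w _; exact: metric2_sym.
- move=> x v tx tv; have [_ pB _] := tx; have [e|ne] := eqVneq (hproj2 x v) 0.
    left; have -> : v = fib2 x (proj2_coef x v) by apply/subr0_eq.
    by apply: fiber2_tangent => //; exact: proj2_coef_skew.
  right; have pI := spd_inv pB.
  have [_ symB _] : tan2 x (hproj2 x v).
    by apply: tan2B => //; apply/tangent2P => //; apply: tangent_sub
      (fiber2_tangent tx (proj2_coef_skew tv)) => y [].
  rewrite metric2E; move: (hproj2 x v) ne symB => -[[a b] c] /= ne symB.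
  (* Symmetry of [b] turns the middle term into a weighted Frobenius form with weight [invmx x.1.2]
     on both sides, which is definite. *)
  have bE : \tr (invmx x.1.2 *m b *m invmx x.1.2 *m b) =
      \tr (b^T *m (invmx x.1.2 *m b *m invmx x.1.2)) by rewrite mxtrace_mulC symB.
  rewrite bE; have a0 := frob_ge0 a; have c0 := frob_ge0 c; have b0 := wfrob_ge0 b pI pI.
  rewrite lt_neqAle !addr_ge0// andbT; apply: contraNneq ne => /esym e.
  have a00 : a = 0 by apply: frob_eq0; lra.
  have c00 : c = 0 by apply: frob_eq0; lra.
  have b00 : b = 0 by apply: (wfrob_eq0 pI pI); lra.
  by rewrite a00 b00 c00.
move=> d D s a b oD ts cs ca cb.
have [c1 c2] := (Ck_fst oD cs, Ck_snd oD cs).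
have [c11 c12] := (Ck_fst oD c1, Ck_snd oD c1).
have cp e : Ck 0 D e -> Ck 0 D (fun u => hproj2 (s u) (e u)).
  move=> ce; have ce1 := Ck_fst oD ce; have ce11 := Ck_fst oD ce1; have ce2 := Ck_snd oD ce.
  have cO : Ck 0 D (fun u => proj2_coef (s u) (e u)).
    apply: Ck_linmx => //; first by move=> t y z; rewrite scalerDr !scalerA mulrC.
    by apply: Ck_D => //; apply: Ck_mulmx => //; exact: Ck_tr.
  apply: Ck_B => //; apply: Ck_pair => //; last exact: Ck_mulmx.
  apply: Ck_pair => //; first exact: Ck_mulmx.
  by apply: Ck_B => //; exact: Ck_mulmx.
have ca' := cp _ ca; have cb' := cp _ cb.
have cI : Ck 0 D (fun u => invmx (s u).1.2).
  by apply: Ck_invmx => // u /ts[_ /spd_unit].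
have a1 := Ck_fst oD ca'; have b1 := Ck_fst oD cb'.
apply: Ck_D => //; [apply: Ck_D => //|]; apply: Ck_mxtrace => //.
- by apply: Ck_mulmx => //; [apply: Ck_tr => //; exact: Ck_fst|exact: Ck_fst].
- apply: Ck_mulmx => //; last exact: Ck_snd.
  by apply: Ck_mulmx => //; apply: Ck_mulmx => //; exact: Ck_snd.
by apply: Ck_mulmx => //; [apply: Ck_tr => //; exact: Ck_snd|exact: Ck_snd].
Qed.

End Geometry2.

Theorem corollary2 (R : realType) (p1 p2 r : nat)
  (hr1 : (1 <= r)%N) (hr : (r <= minn p1 p2)%N)
  (f : 'M[R]_(p1, p2) -> R) (hf : Ck_on 2 setT f)
  (W V : 'M[R]_(p1, r) * 'M[R]_(p2, r) -> 'M[R]_r)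
  (VY WY : 'M[R]_(p2, r) -> 'M[R]_r)
  (hWpd : forall x, tot1 x -> spd (W x))
  (hVpd : forall x, tot1 x -> spd (V x))
  (hWsm : smooth_on (@tot1 R p1 p2 r) W)
  (hVsm : smooth_on (@tot1 R p1 p2 r) V)
  (hVYpd : forall Y, full_col_rank Y -> spd (VY Y))
  (hWYpd : forall Y, full_col_rank Y -> spd (WY Y))
  (hVYsm : smooth_on [set Y | full_col_rank Y] VY)
  (hWYsm : smooth_on [set Y | full_col_rank Y] WY)
  (hW : forall (L : 'M[R]_(p1, r)) (Rm : 'M[R]_(p2, r)) (M : 'M[R]_r),
     full_col_rank L -> full_col_rank Rm -> M \in unitmx ->
     W (L, Rm) = M *m W (L *m M, Rm *m (invmx M)^T) *m M^T)
  (hV : forall (L : 'M[R]_(p1, r)) (Rm : 'M[R]_(p2, r)) (M : 'M[R]_r),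
     full_col_rank L -> full_col_rank Rm -> M \in unitmx ->
     V (L, Rm) =
       (invmx M)^T *m V (L *m M, Rm *m (invmx M)^T) *m invmx M)
  (hVY : forall (Y : 'M[R]_(p2, r)) (O : 'M[R]_r),
     full_col_rank Y -> orthogonal_mx O -> VY Y = O *m VY (Y *m O) *m O^T)
  (hWY : forall (Y : 'M[R]_(p2, r)) (O : 'M[R]_r),
     full_col_rank Y -> orthogonal_mx O -> WY Y = O *m WY (Y *m O) *m O^T) :
  let Me := embedded_geometry p1 p2 r in
  let Q1 := quotient_geometry1 W V in
  let Q2 := @quotient_geometry2 R p1 p2 r in
  let Q3 := @quotient_geometry3 R p1 p2 r VY WY in
  let h1 := f \o @map1 R p1 p2 r in
  let h2 := f \o @map2 R p1 p2 r in
  let h3 := f \o @map3 R p1 p2 r in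
  forall k : point_kind,
  (* (a) *)
  [/\ (forall (L : 'M[R]_(p1, r)) (Rm : 'M[R]_(p2, r)),
         full_col_rank L -> full_col_rank Rm ->
         riem_point k Q1 h1 (qclass Q1 (L, Rm)) ->
         riem_point k Me f (qclass Me (L *m Rm^T))),
      (forall (U : 'M[R]_(p1, r)) (B : 'M[R]_(r, r)) (V' : 'M[R]_(p2, r)),
         stiefel U -> spd B -> stiefel V' ->
         riem_point k Q2 h2 (qclass Q2 (U, B, V')) ->
         riem_point k Me f (qclass Me (U *m B *m V'^T))) &
      (forall (U : 'M[R]_(p1, r)) (Y : 'M[R]_(p2, r)),
         stiefel U -> full_col_rank Y ->
         riem_point k Q3 h3 (qclass Q3 (U, Y)) ->
         riem_point k Me f (qclass Me (U *m Y^T)))] /\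
  (* (b) *)
  (forall X : 'M[R]_(p1, p2), \rank X = r ->
     riem_point k Me f (qclass Me X) ->
     [/\ (exists c, unique (class_over Q1 (@map1 R p1 p2 r) X) c /\
                    riem_point k Q1 h1 c),
         (exists c, unique (class_over Q2 (@map2 R p1 p2 r) X) c /\
                    riem_point k Q2 h2 c) &
         (exists c, unique (class_over Q3 (@map3 R p1 p2 r) X) c /\
                    riem_point k Q3 h3 c)]).
Proof.
move=> Me Q1 Q2 Q3 h1 h2 h3 k; have cf : Ck 2 setT f by constructor.
have rf1 := rank_fibration1 W V; have rf2 := @rank_fibration2 R p1 p2 r.
have rf3 := @rank_fibration3 R p1 p2 r VY WY.
(* At order 0, [smooth_on] unfolds to the pointwise continuity of the weights. *)
have lm1 := lifted_metric1 hWpd hVpd (hWsm 0) (hVsm 0).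
have lm2 := @lifted_metric2 R p1 p2 r.
have lm3 := @lifted_metric3 R p1 p2 r VY WY hVYpd hWYpd (hVYsm 0) (hWYsm 0).
split; first split.
- by move=> L Rm rL rR; apply: (riem_point_push lm1 rf1 cf (x := (L, Rm))).
- by move=> U B V' sU pB sV; apply: (riem_point_push lm2 rf2 cf (x := (U, B, V'))).
- by move=> U Y sU rY; apply: (riem_point_push lm3 rf3 cf (x := (U, Y))).
move=> X rX Xk; split.
- exact: (riem_point_lift lm1 rf1 cf rX Xk).
- exact: (riem_point_lift lm2 rf2 cf rX Xk).
- exact: (riem_point_lift lm3 rf3 cf rX Xk).
Qed.
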